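(* Let $\Omega\subset\mathbb{R}^n$ be open and bounded and $\Omega'\Subset\Omega$. Let $s\in(0,1)$, $p\in(1,+\infty)$ and $f\in L^p(\Omega)$. Let $u\in L^p(\mathbb{R}^n)$ be a distributional solution of $(-\Delta)^su=f$ in $\Omega$. Then (the restriction of) $u$ belongs to $\mathcal{L}^p_{2s}(\Omega')$ and $\|u\|_{\mathcal{L}^p_{2s}(\Omega')}\le C\big(\|f\|_{L^p(\Omega)}+\|u\|_{L^p(\mathbb{R}^n)}\big)$ for a constant $C>0$ depending only on $n$, $s$, $p$, $\Omega$ and $\Omega'$.
   Context: $(-\Delta)^s\varphi:=\mathcal{F}^{-1}((2\pi|\xi|)^{2s}\widehat\varphi)$, $\widehat\varphi(\xi)=\int\varphi(x)e^{-2\pi ix\cdot\xi}dx$. Distributional solution in $\Omega$: $\int_{\mathbb{R}^n}u\,(-\Delta)^s\varphi\,dx=\int_\Omega f\varphi\,dx$ for all $\varphi\in C^\infty_c(\Omega)$. Bessel potential space: $\mathcal{L}^p_{2s}(\mathbb{R}^n):=\{v\in L^p: v=\mathcal{B}^{(s)}*g,\ g\in L^p\}$ with norm $\|g\|_{L^p}$, where $\mathcal{B}^{(s)}$ is the integrable function with Fourier transform $(1+4\pi^2|\xi|^2)^{-s}$. $\mathcal{L}^p_{2s}(\Omega')$ consists of restrictions to $\Omega'$ of elements of $\mathcal{L}^p_{2s}(\mathbb{R}^n)$, normed by $\|v\|_{\mathcal{L}^p_{2s}(\Omega')}:=\inf\{\|\tilde v\|_{\mathcal{L}^p_{2s}(\mathbb{R}^n)}:\tilde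 v=v\text{ in }\Omega'\}$. *)

(* Defs.v *)
From HB Require Import structures.
From mathcomp Require Import all_boot all_order all_algebra.
From mathcomp Require Import all_classical all_reals all_analysis.
From mathcomp.real_closed Require Import complex.

Set Implicit Arguments.
Unset Strict Implicit.
Unset Printing Implicit Defensive.
Import Order.TTheory GRing.Theory Num.Theory.
Import numFieldNormedType.Exports.
Local Open Scope classical_set_scope.
Local Open Scope ring_scope.
Local Open Scope complex_scope.

(** R^n is modelled by row vectors 'rV[R]_n (with their normed/topological
    structure, used for derivatives, continuity, closures, compactness).
    [Rn R n] is the same carrier equipped with the Borel sigma-algebra
    (generated by the open sets). *)
Definition Rn (R : realType) (n : nat) := g_sigma_algebraType (@open 'rV[R]_n).

(** [mu] is the Lebesgue measure on R^n: the (unique, by the pi-lambda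
    theorem) Borel measure giving each half-open box its volume. *)
Definition is_lebesgue (R : realType) (n : nat)
    (mu : {measure set (Rn R n) -> \bar R}) : Prop :=
  forall a b : 'rV[R]_n, (forall i, a ord0 i <= b ord0 i) ->
    mu [set x : Rn R n | forall i, a ord0 i <= x ord0 i < b ord0 i] =
    (\prod_(i < n) (b ord0 i - a ord0 i))%:E.

Definition dotv (R : realType) (n : nat) (x y : 'rV[R]_n) : R :=
  \sum_(i < n) x ord0 i * y ord0 i.
Definition enorm (R : realType) (n : nat) (x : 'rV[R]_n) : R :=
  Num.sqrt (dotv x x).

Definition cintegral (R : realType) (n : nat)
    (mu : {measure set (Rn R n) -> \bar R}) (D : set (Rn R n))
    (f : 'rV[R]_n -> R[i]) : R[i] :=
  Complex (Rintegral mu D (fun x => complex.Re (f x))) (Rintegral mu D (fun x => complex.Im (f x))).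

Definition cexpi (R : realType) (t : R) : R[i] := Complex (cos t) (sin t).

Definition fourier (R : realType) (n : nat)
    (mu : {measure set (Rn R n) -> \bar R}) (phi : 'rV[R]_n -> R)
    : 'rV[R]_n -> R[i] :=
  fun xi => cintegral mu setT
    (fun x => (phi x)%:C * cexpi (- (2 * pi * dotv x xi))).

Definition ifourier (R : realType) (n : nat)
    (mu : {measure set (Rn R n) -> \bar R}) (g : 'rV[R]_n -> R[i])
    : 'rV[R]_n -> R[i] :=
  fun x => cintegral mu setT (fun xi => g xi * cexpi (2 * pi * dotv x xi)).

Definition frac_lap (R : realType) (n : nat)
    (mu : {measure set (Rn R n) -> \bar R}) (s : R) (phi : 'rV[R]_n -> R)
    : 'rV[R]_n -> R[i] :=
  ifourier mu (fun xi => ((2 * pi * enorm xi) `^ (2 * s))%:C * fourier mu phi xi).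

Definition basis_vec (R : realType) (n : nat) (i : 'I_n) : 'rV[R]_n :=
  delta_mx ord0 i.

Definition iter_partial (R : realType) (n : nat) (l : seq 'I_n)
    (phi : 'rV[R]_n -> R) : 'rV[R]_n -> R :=
  foldr (fun i g => 'D_(basis_vec R i) g) phi l.

Definition smooth (R : realType) (n : nat) (phi : 'rV[R]_n -> R) : Prop :=
  forall l : seq 'I_n, continuous (iter_partial l phi) /\
    forall (i : 'I_n) (x : 'rV[R]_n), derivable (iter_partial l phi) x (basis_vec R i).

Definition fsupport (R : realType) (n : nat) (phi : 'rV[R]_n -> R) : set 'rV[R]_n :=
  closure [set x | phi x != 0].

Definition test_fun (R : realType) (n : nat) (Om : set 'rV[R]_n)
    (phi : 'rV[R]_n -> R) : Prop :=
  [/\ smooth phi, compact (fsupport phi) & fsupport phi `<=` Om].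

Definition lp_norm (R : realType) (n : nat)
    (mu : {measure set (Rn R n) -> \bar R}) (D : set (Rn R n)) (p : R)
    (f : 'rV[R]_n -> R) : \bar R :=
  ((\int[mu]_(x in D) (`|f x| `^ p)%:E) `^ p^-1)%E.

Definition in_Lp (R : realType) (n : nat)
    (mu : {measure set (Rn R n) -> \bar R}) (D : set (Rn R n)) (p : R)
    (f : 'rV[R]_n -> R) : Prop :=
  measurable_fun D (f : Rn R n -> R) /\ (lp_norm mu D p f < +oo)%E.

Definition dist_solution (R : realType) (n : nat)
    (mu : {measure set (Rn R n) -> \bar R}) (s : R) (Om : set 'rV[R]_n)
    (u f : 'rV[R]_n -> R) : Prop :=
  forall phi : 'rV[R]_n -> R, test_fun Om phi ->
    cintegral mu setT (fun x => (u x)%:C * frac_lap mu s phi x) =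
    (Rintegral mu Om (fun x => f x * phi x))%:C.

Definition is_bessel_kernel (R : realType) (n : nat)
    (mu : {measure set (Rn R n) -> \bar R}) (s : R) (B : 'rV[R]_n -> R) : Prop :=
  [/\ measurable_fun setT (B : Rn R n -> R),
      mu.-integrable setT (fun x : Rn R n => (B x)%:E) &
      forall xi, fourier mu B xi =
        ((1 + 4 * pi ^+ 2 * enorm xi ^+ 2) `^ (- s))%:C].

Definition conv (R : realType) (n : nat)
    (mu : {measure set (Rn R n) -> \bar R}) (B g : 'rV[R]_n -> R)
    : 'rV[R]_n -> R :=
  fun x => Rintegral mu setT (fun y => B (x - y) * g y).

Definition bessel_rep (R : realType) (n : nat)
    (mu : {measure set (Rn R n) -> \bar R}) (B : 'rV[R]_n -> R) (p : R)
    (v g : 'rV[R]_n -> R) : Prop :=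
  in_Lp mu setT p g /\ (v : Rn R n -> R) = conv mu B g %[ae mu].

(** The Bessel potential space L^p_{2s}(R^n) (B = B^(s)). *)
Definition bessel_space (R : realType) (n : nat)
    (mu : {measure set (Rn R n) -> \bar R}) (B : 'rV[R]_n -> R) (p : R)
    (v : 'rV[R]_n -> R) : Prop :=
  in_Lp mu setT p v /\ exists g, bessel_rep mu B p v g.

(** its norm ||v||_{L^p_{2s}(R^n)} = ||g||_{L^p}, where v = B * g
    (g is a.e. unique; we take the infimum over all representations). *)
Definition bessel_norm (R : realType) (n : nat)
    (mu : {measure set (Rn R n) -> \bar R}) (B : 'rV[R]_n -> R) (p : R)
    (v : 'rV[R]_n -> R) : \bar R :=
  ereal_inf [set lp_norm mu setT p g | g in [set g | bessel_rep mu B p v g]].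

Definition extends_on (R : realType) (n : nat)
    (mu : {measure set (Rn R n) -> \bar R}) (B : 'rV[R]_n -> R) (p : R)
    (O : set 'rV[R]_n) (v w : 'rV[R]_n -> R) : Prop :=
  bessel_space mu B p w /\ (w : Rn R n -> R) = v %[ae mu in O].

Definition in_bessel_loc (R : realType) (n : nat)
    (mu : {measure set (Rn R n) -> \bar R}) (B : 'rV[R]_n -> R) (p : R)
    (O : set 'rV[R]_n) (v : 'rV[R]_n -> R) : Prop :=
  exists w, extends_on mu B p O v w.

Definition bessel_loc_norm (R : realType) (n : nat)
    (mu : {measure set (Rn R n) -> \bar R}) (B : 'rV[R]_n -> R) (p : R)
    (O : set 'rV[R]_n) (v : 'rV[R]_n -> R) : \bar R :=
  ereal_inf [set bessel_norm mu B p w | w in [set w | extends_on mu B p O v w]].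

(* Main.v *)
(** Write [a = 4 pi^2 |xi|^2] for the symbol of the negative Laplacian. The Bessel kernel is the
    mixture [B = Gamma(s)^-1 \int_0^oo e^-l l^(s-1) h_l dl] of heat kernels, and
    [K = c \int_0^oo (1 - e^-l) l^(-1-s) h_l dl] is an integrable kernel with symbol
    [(1 + a)^s - a^s], so that [(-Lap)^s] differs from [(1 - Lap)^s] by a convolution.

    To localise, cut [B] off near the origin: [P = chi B]. Since [(1 - chi) h_l] has its mass
    away from the origin, uniformly in [l], [q = (1 - Lap)^2 (B - P)] is integrable, and
    [P^ = (1 + a)^-s (1 - r^)] with [r = B^(2-s) * q]. The factor [(1 + a)^s r^] is again the
    transform of an integrable kernel, [B^(2-2s) * q]. Hence [a^s P^ = 1 - (1 + a)^-s M^]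
    with [M] integrable.

    Test the equation with translates of [theta * P], where [theta = beta * beta] for a smooth
    bump [beta]; the square makes [theta^] integrable, hence Fourier inversion available. One
    gets [(-Lap)^s (theta * P) = theta - M * (B * theta)] and
    [theta * P = B * theta - r * (B * theta)], and by duality [u] and [B * g], with
    [g = f - r * f + M * u] ([f] extended by zero), have the same pairing with all translates of
    [theta] staying well inside [Omega]. Letting [theta] shrink gives [u = B * g] on [Omega'],
    and Young's inequality bounds the L^p norm of [g]. *)
Require Import Defs.
From HB Require Import structures.
From mathcomp Require Import all_boot all_order all_algebra.
From mathcomp Require Import all_classical all_reals all_analysis.
From mathcomp.real_closed Require Import complex.
From mathcomp Require Import measurable_realfun ring lra.
Import Order.TTheory GRing.Theory Num.Theory.
Import numFieldNormedType.Exports.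
Local Open Scope classical_set_scope.
Local Open Scope ring_scope.

Set Implicit Arguments.
Unset Strict Implicit.
Unset Printing Implicit Defensive.

(** * Real-valued integrals *)

(* [all_analysis] exports another [conv], that of convex.v. *)
Notation conv := Defs.conv.
Notation L1 mu f := (mu.-integrable setT (EFin \o f)).

(** No singular integral is estimated: every operator is convolution with an integrable kernel, so
    Young's inequality alone carries the L^p theory. Since (1 + a)^s is not the transform of an
    integrable function, it may only occur multiplied by r^, and this is why 1 - Lap is squared.
    With q = (1 - Lap)^m (B - P) the product (1 + a)^s r^ equals (1 + a)^(2 s - m) q^, and 2 s - m
    is negative for every s < 1 only if m >= 2. Truncating B is forced: B * theta has no compact
    support, hence is no test function, while the equation is known in Omega only. The function 1 -
    chi is built to vanish to fourth order in |x|^2, because (1 - Lap)^2 applied to (1 - chi) h_l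
    produces powers of 1 / l, which must be paid for by powers of |x|^2 as l tends to 0. Inversion
    and uniqueness of transforms hold almost everywhere only; functions are identified by testing
    them against boxes, the sets on which the measure is prescribed. *)

Section integration.
Context d (T : measurableType d) (R : realType).
Variable mu : {measure set T -> \bar R}.
Implicit Types f g h : T -> R.

Lemma L1_measurable f : L1 mu f -> measurable_fun setT f.
Proof. by move=> /measurable_int /measurable_EFinP. Qed.

Lemma L1_lty f : L1 mu f -> (\int[mu]_x `|f x|%:E < +oo)%E.
Proof. by move=> /integrableP[]. Qed.

Lemma L1I f : measurable_fun setT f -> (\int[mu]_x `|f x|%:E < +oo)%E -> L1 mu f.
Proof. by move=> mf fi; apply/integrableP; split => //; exact/measurable_EFinP. Qed.

Lemma L1D f g : L1 mu f -> L1 mu g -> L1 mu (fun x => f x + g x).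
Proof. by move=> fi gi; exact: (integrableD measurableT fi gi). Qed.

Lemma L1B f g : L1 mu f -> L1 mu g -> L1 mu (fun x => f x - g x).
Proof. by move=> fi gi; exact: (integrableB measurableT fi gi). Qed.

Lemma L1Z (c : R) f : L1 mu f -> L1 mu (fun x => c * f x).
Proof. by move=> fi; exact: (integrableZl measurableT c fi). Qed.

Lemma L1_le f g : measurable_fun setT f -> (forall x, `|f x| <= `|g x|) ->
  L1 mu g -> L1 mu f.
Proof.
move=> mf fg; apply: le_integrable => //; first exact/measurable_EFinP.
by move=> x _; rewrite /= lee_fin.
Qed.

Lemma L1_norm f : L1 mu f -> L1 mu (fun x => `|f x|).
Proof. by move=> fi; exact: integrable_norm. Qed.

Lemma L1M f h (M : R) : L1 mu f -> measurable_fun setT h ->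
  (forall x, `|h x| <= M) -> L1 mu (fun x => f x * h x).
Proof.
move=> fi mh hM; apply: (@L1_le _ (fun x => M * f x)) => //; last exact: L1Z.
- by apply: measurable_funM => //; exact: L1_measurable.
- move=> x; rewrite !normrM mulrC ler_wpM2r//.
  by rewrite (le_trans (hM x))// ler_norm.
Qed.

Lemma L1_sum (I : finType) (f : I -> T -> R) :
  (forall i, L1 mu (f i)) -> L1 mu (fun x => \sum_i f i x).
Proof.
move=> fi.
have := @integrable_sum _ _ _ mu setT measurableT _ (enum I) xpredT
  (fun i x => (f i x)%:E) (fun i _ => fi i).
apply: eq_integrable => // x _.
by rewrite /= -sumEFin big_enum.
Qed.

Lemma RintegralE f : L1 mu f -> (\int[mu]_x f x)%:E = (\int[mu]_x (f x)%:E)%E.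
Proof. by move=> fi; rewrite /Rintegral fineK//; exact: integrable_fin_num. Qed.

Lemma eq_RintegralT f g : f =1 g -> \int[mu]_x f x = \int[mu]_x g x.
Proof. by move=> fg; apply: eq_Rintegral => x _; exact: fg. Qed.

Lemma RintDT f g : L1 mu f -> L1 mu g ->
  \int[mu]_x (f x + g x) = \int[mu]_x f x + \int[mu]_x g x.
Proof. exact: RintegralD. Qed.

Lemma RintBT f g : L1 mu f -> L1 mu g ->
  \int[mu]_x (f x - g x) = \int[mu]_x f x - \int[mu]_x g x.
Proof. exact: RintegralB. Qed.

Lemma RintZT (c : R) f : L1 mu f -> \int[mu]_x (c * f x) = c * \int[mu]_x f x.
Proof. by move=> fi; rewrite RintegralZl. Qed.

Lemma Rint0 : \int[mu]_x (0 : R) = 0.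
Proof. by rewrite /Rintegral integral0. Qed.

Lemma Rint_sum (I : finType) (f : I -> T -> R) : (forall i, L1 mu (f i)) ->
  \int[mu]_x (\sum_i f i x) = \sum_i \int[mu]_x f i x.
Proof.
move=> fi; apply: EFin_inj; rewrite RintegralE; last exact: L1_sum.
rewrite -sumEFin.
under eq_integral do rewrite -sumEFin.
rewrite (integral_sum measurableT (fun i => fi i)).
by apply: eq_bigr => i _; rewrite RintegralE//.
Qed.

Lemma norm_Rint_le f g : L1 mu f -> L1 mu g -> (forall x, `|f x| <= g x) ->
  `|\int[mu]_x f x| <= \int[mu]_x g x.
Proof.
move=> fi gi fg; apply: (le_trans (le_normr_Rintegral measurableT fi)).
by apply: le_Rintegral => //; exact: L1_norm.
Qed.

Lemma ae_eq_RintT f g : measurable_fun setT f -> measurable_fun setT g ->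
  f = g %[ae mu] -> \int[mu]_x f x = \int[mu]_x g x.
Proof.
move=> mf mg fg; congr fine; apply: ae_eq_integral => //.
- exact/measurable_EFinP.
- exact/measurable_EFinP.
- by apply: filterS fg => x /(_ I) /= -> .
Qed.

Lemma ge0_ae_le_Rint f g : measurable_fun setT f -> (forall x, 0 <= f x) ->
  {ae mu, forall x, f x <= g x} -> L1 mu g ->
  L1 mu f /\ \int[mu]_x f x <= \int[mu]_x g x.
Proof.
move=> mf f0 fg gi; have gn := L1_norm gi.
have le : (\int[mu]_x (f x)%:E <= \int[mu]_x (`|g x|)%:E)%E.
  apply: ae_ge0_le_integral => //.
  - by move=> x _; rewrite lee_fin.
  - exact/measurable_EFinP.
  - exact: measurable_int gn.
  - by apply: filterS fg => x fgx _; rewrite lee_fin (le_trans fgx)// ler_norm.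
have fi : L1 mu f.
  apply: L1I => //; under eq_integral do rewrite ger0_norm//.
  by rewrite (le_lt_trans le)//; exact: L1_lty.
split => //; rewrite -lee_fin !RintegralE//.
(* Monotonicity is applied to a function that is nonnegative everywhere; [g] is so only almost
   everywhere, and its positive part takes its place. *)
rewrite (ae_eq_integral (fun x => (Num.max 0 (g x))%:E) (fun x => (g x)%:E))//.
- apply: ae_ge0_le_integral => //.
  + by move=> x _; rewrite lee_fin.
  + exact/measurable_EFinP.
  + by move=> x _; rewrite lee_fin le_max lexx.
  + by apply/measurable_EFinP/measurable_maxr => //; exact: L1_measurable.
  + by apply: filterS fg => x fgx _; rewrite lee_fin le_max fgx orbT.
- exact: measurable_int gi.
- by apply/measurable_EFinP/measurable_maxr => //; exact: L1_measurable.
- by apply: filterS fg => x fgx _; congr EFin; apply/esym/max_idPr; rewrite (le_trans (f0 x)).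
Qed.

Lemma Rint_dct_ae (f_ : nat -> T -> R) f g :
  (forall k, measurable_fun setT (f_ k)) -> measurable_fun setT f ->
  {ae mu, forall x, f_ ^~ x @ \oo --> f x} -> L1 mu g ->
  (forall k x, `|f_ k x| <= g x) ->
  L1 mu f /\ (fun k => \int[mu]_x f_ k x) @ \oo --> \int[mu]_x f x.
Proof.
move=> mf_ mf cf gi fg.
have [] := @dominated_convergence _ _ _ mu setT measurableT
   (fun n => EFin \o f_ n) (EFin \o f) (EFin \o g).
- by move=> n; exact/measurable_EFinP.
- exact/measurable_EFinP.
- apply: filterS cf => x cfx _; apply: cvg_EFin cfx; exact: nearW.
- exact: gi.
- by apply: aeW => x n _ /=; rewrite lee_fin.
move=> fi _ c; split => //.
rewrite /Rintegral; apply: (@fine_cvg R); rewrite fineK; first exact: c.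
exact: integrable_fin_num.
Qed.

Lemma Rint_dct (f_ : nat -> T -> R) f g :
  (forall k, measurable_fun setT (f_ k)) ->
  (forall x, f_ ^~ x @ \oo --> f x) -> L1 mu g ->
  (forall k x, `|f_ k x| <= g x) ->
  L1 mu f /\ (fun k => \int[mu]_x f_ k x) @ \oo --> \int[mu]_x f x.
Proof.
move=> mf_ cf gi fg; apply: (Rint_dct_ae mf_ _ _ gi fg); last exact: aeW.
by apply: (measurable_fun_cvg mf_) => x _; exact: cf.
Qed.

End integration.

(** * Fubini's theorem for real-valued integrals *)

Section fubini_real.
Context d1 d2 (T1 : measurableType d1) (T2 : measurableType d2) (R : realType).
Variables (m1 : {sigma_finite_measure set T1 -> \bar R})
          (m2 : {sigma_finite_measure set T2 -> \bar R}).
Implicit Types F : T1 * T2 -> R.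

Lemma prod_L1P1 F : measurable_fun setT F ->
  (\int[m1]_x \int[m2]_y `|F (x, y)|%:E < +oo)%E -> L1 (m1 \x m2)%E F.
Proof.
move=> mF h; apply/integrable12ltyP => //; exact/measurable_EFinP.
Qed.

Lemma prod_L1P2 F : measurable_fun setT F ->
  (\int[m2]_y \int[m1]_x `|F (x, y)|%:E < +oo)%E -> L1 (m1 \x m2)%E F.
Proof.
move=> mF h; apply/integrable21ltyP => //; exact/measurable_EFinP.
Qed.

(** Tonelli makes the partial integrals of the positive and negative parts measurable; [fine] then
    sends infinite values to 0, so that the statement covers every measurable [F]. *)
Lemma measurable_Rint_snd F : measurable_fun setT F ->
  measurable_fun setT (fun x => \int[m2]_y F (x, y)).
Proof.
move=> mF; apply: measurableT_comp => //=.
have mEF : measurable_fun setT (EFin \o F) by exact/measurable_EFinP.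
rewrite (_ : (fun x => _) =
    fubini_F m2 (EFin \o F)^\+%E \- fubini_F m2 (EFin \o F)^\-%E)%E; last first.
  apply/funext => x; rewrite integralE; congr (_ - _)%E; apply: eq_integral => y _; by rewrite !unlock.
apply: emeasurable_funB; apply: measurable_fun_fubini_tonelli_F => //.
- exact: measurable_funepos.
- exact: measurable_funeneg.
Qed.

Lemma prod_L1_fst F : L1 (m1 \x m2)%E F -> L1 m1 (fun x => \int[m2]_y F (x, y)).
Proof.
move=> Fi; have mF := L1_measurable Fi.
have := integrable_fubini_F Fi => h.
have mR := measurable_Rint_snd mF.
apply: L1I => //.
apply: le_lt_trans (proj2 (integrableP _ _ _ h)).
apply: ge0_le_integral => //.
- by apply/measurable_EFinP; apply: measurableT_comp.
- by apply: measurableT_comp => //; exact: (measurable_int _ h).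
- move=> x _; rewrite /fubini_F /= /Rintegral.
  by case: (\int[m2]_y _)%E => //=; rewrite ?normr0 leey.
Qed.

(** Almost every section is integrable, and there the real inner integral agrees with the extended
    one; the sections on which [fine] returns a default value are negligible. *)
Lemma Rfubini F : L1 (m1 \x m2)%E F ->
  \int[m1]_x \int[m2]_y F (x, y) = \int[m2]_y \int[m1]_x F (x, y).
Proof.
move=> Fi; have mF := L1_measurable Fi.
have := Fubini Fi => /= E.
have a1 := ae_integrable1 Fi; have a2 := ae_integrable2 Fi.
have h1 := integrable_fubini_F Fi.
have -> : \int[m1]_x \int[m2]_y F (x, y) =
    fine (\int[m1]_x (fubini_F m2 (EFin \o F) x))%E.
  congr fine; apply: ae_eq_integral => //.
  - by apply/measurable_EFinP; exact: measurable_Rint_snd.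
  - exact: (measurable_int _ h1).
  - apply: filterS a1 => x ix _ /=.
    by rewrite RintegralE//.
rewrite E.
congr fine; apply: ae_eq_integral => //.
- exact: (measurable_fubini_G Fi).
- apply/measurable_EFinP/measurableT_comp => //=.
  have mEF : measurable_fun setT (EFin \o F) by exact/measurable_EFinP.
  rewrite (_ : (fun y => _) =
      fubini_G m1 (EFin \o F)^\+%E \- fubini_G m1 (EFin \o F)^\-%E)%E; last first.
    apply/funext => x; rewrite integralE; congr (_ - _)%E; apply: eq_integral => y _; by rewrite !unlock.
  apply: emeasurable_funB; apply: measurable_fun_fubini_tonelli_G => //.
  + exact: measurable_funepos.
  + exact: measurable_funeneg.
- apply: filterS a2 => x ix _ /=.
  by rewrite RintegralE//.
Qed.

End fubini_real.

(** * Borel sets and Lebesgue measure on R^n *)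

Definition hbox (R : realType) (n : nat) (a b : 'rV[R]_n) : set (Rn R n) :=
  [set x | forall i, a ord0 i <= x ord0 i < b ord0 i].

Section borel.
Context (R : realType) (n : nat).
Implicit Types (a b x y : 'rV[R]_n) (U : set 'rV[R]_n).

Lemma open_Rn_measurable U : open U -> measurable (U : set (Rn R n)).
Proof. by move=> oU; apply: sub_sigma_algebra. Qed.

Lemma continuous_Rn_measurable (f : 'rV[R]_n -> R) : continuous f ->
  measurable_fun setT (f : Rn R n -> R).
Proof.
move=> /continuousP cf; apply: (measurability _ (RGenOpens.measurableE R)).
move=> _ [_ [a [b ->] <-]]; rewrite setTI; apply: open_Rn_measurable.
exact/cf/interval_open.
Qed.

Lemma coord_measurable i : measurable_fun setT (fun x : Rn R n => x ord0 i).
Proof. by apply: continuous_Rn_measurable; exact: coord_continuous. Qed.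

Lemma hboxE a b : hbox a b =
  \bigcap_(i in [set: 'I_n]) ((fun x : Rn R n => x ord0 i) @^-1` `[a ord0 i, b ord0 i[%classic).
Proof.
apply/seteqP; split => x /= h i.
- by move=> _; rewrite /preimage /= in_itv /= h.
- by have := h i I; rewrite /preimage /= in_itv.
Qed.

Lemma hbox_measurable a b : measurable (hbox a b).
Proof.
rewrite hboxE; apply: fin_bigcap_measurable => // i _.
by rewrite -[X in measurable X]setTI; exact: coord_measurable.
Qed.

Lemma ball_coordP x (e : R) y : 0 < e ->
  ball x e y <-> forall i, `|x ord0 i - y ord0 i| < e.
Proof.
move=> e0; split; first by move=> [_ h] i; exact: h.
by move=> h; split => // i j; rewrite (ord1 i); exact: h.
Qed.

Let rbox (q : {ffun 'I_n -> rat} * {ffun 'I_n -> rat}) : set (Rn R n) :=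
  hbox (\row_i ratr (q.1 i)) (\row_i ratr (q.2 i)).

(** Each point of [U] lies in a box with rational corners inside [U], and there are countably many
    such boxes: [q] enumerates them all through [pickle], [P] selects those contained in [U]. *)
Lemma open_hbox_cover U : open U ->
  exists (q : nat -> 'rV[R]_n * 'rV[R]_n) (P : set nat),
    (forall k, P k -> hbox (q k).1 (q k).2 `<=` U) /\
    (U : set (Rn R n)) = \bigcup_(k in P) hbox (q k).1 (q k).2.
Proof.
move=> oU.
have cov x : U x -> exists q, rbox q x /\ rbox q `<=` U.
  move=> Ux; have /nbhs_ballP[e /= e0 eU] := open_nbhs_nbhs (conj oU Ux).
  have [p hp] : exists p : {ffun 'I_n -> rat}, forall i,
      x ord0 i - e < ratr (p i) < x ord0 i.
    have /choice[f hf] : forall i : 'I_n, exists p : rat, x ord0 i - e < ratr p < x ord0 i.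
      move=> i; have /rat_in_itvoo[p] : x ord0 i - e < x ord0 i by rewrite gtrBl.
      by rewrite in_itv /= => pi; exists p.
    by exists [ffun i => f i] => i; rewrite ffunE.
  have [r hr] : exists p : {ffun 'I_n -> rat}, forall i,
      x ord0 i < ratr (p i) < x ord0 i + e.
    have /choice[f hf] : forall i : 'I_n, exists p : rat, x ord0 i < ratr p < x ord0 i + e.
      move=> i; have /rat_in_itvoo[p'] : x ord0 i < x ord0 i + e by rewrite ltrDl.
      by rewrite in_itv /= => pi; exists p'.
    by exists [ffun i => f i] => i; rewrite ffunE.
  exists (p, r); split => [i|y hy].
    by rewrite !mxE /=; have := hp i; have := hr i; lra.
  apply: eU; apply/ball_coordP => // i.
  have := hy i; rewrite !mxE /= => /andP[h1 h2].
  by rewrite ltr_norml; have := hp i; have := hr i; lra.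
(* A number that encodes no pair of corners gets a default box; this is harmless, since [P] keeps a
   box only when it lies in [U]. *)
pose q0 k : {ffun 'I_n -> rat} * {ffun 'I_n -> rat} :=
  odflt ([ffun=> 0], [ffun=> 0]) (unpickle k).
exists (fun k => (\row_i ratr ((q0 k).1 i), \row_i ratr ((q0 k).2 i))).
exists [set k | rbox (q0 k) `<=` U]; split => //=.
apply/seteqP; split => [x Ux|x [k /= kU] hx]; last exact: (kU _ hx).
have [q [qx qU]] := cov _ Ux.
by exists (pickle q); rewrite /= /q0 pickleK.
Qed.

Definition hboxes := [set A | exists a b, A = hbox a b].

Lemma Rn_measurableE : @measurable _ (Rn R n) = <<s hboxes >>.
Proof.
apply/seteqP; split; apply: smallest_sub.
- exact: smallest_sigma_algebra.
- move=> U oU; have [q [P [_ ->]]] := open_hbox_cover oU.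
  rewrite bigcup_mkcond.
  apply: (@sigma_algebra_bigcup _ setT).
  move=> k; case: ifP => _; last exact: sigma_algebra0.
  by apply: sub_sigma_algebra; exists (q k).1, (q k).2.
- exact: sigma_algebra_measurable.
- by move=> _ [a [b ->]]; exact: hbox_measurable.
Qed.

Lemma hboxes_setI_closed : setI_closed hboxes.
Proof.
move=> _ _ [a [b ->]] [a' [b' ->]].
exists (\row_i Num.max (a ord0 i) (a' ord0 i)), (\row_i Num.min (b ord0 i) (b' ord0 i)).
apply/seteqP; split => x /=.
- by move=> [h h'] i; rewrite !mxE ge_max lt_min; have /andP[-> ->] := h i;
    have /andP[-> ->] := h' i.
- move=> h; split=> i; have := h i; rewrite !mxE ge_max lt_min;
  by move=> /andP[/andP[h1 h2] /andP[h3 h4]]; apply/andP.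
Qed.

Lemma Rn_measurable_funP d (X : measurableType d) (F : X -> Rn R n) :
  (forall i, measurable_fun setT (fun x : X => (F x : 'rV[R]_n) ord0 i)) -> measurable_fun setT F.
Proof.
move=> cF; apply: (measurability _ Rn_measurableE) => _ [_ [a [b ->]] <-].
rewrite setTI hboxE preimage_bigcap; apply: fin_bigcap_measurable => // i _.
rewrite -[X in measurable X]setTI -comp_preimage.
exact: cF.
Qed.

Lemma sub_Rn_measurable :
  measurable_fun setT (fun z : Rn R n * Rn R n => (z.1 - z.2 : 'rV[R]_n) : Rn R n).
Proof.
apply: Rn_measurable_funP => i.
rewrite (_ : (fun _ => _) = (fun z : Rn R n * Rn R n => z.1 ord0 i - z.2 ord0 i)).
  apply: measurable_funB.
  - exact: (measurableT_comp (coord_measurable i) measurable_fst).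
  - exact: (measurableT_comp (coord_measurable i) measurable_snd).
by apply/funext => z; rewrite !mxE.
Qed.

Lemma add_Rn_measurable (c : 'rV[R]_n) :
  measurable_fun setT (fun x : Rn R n => (x + c : 'rV[R]_n) : Rn R n).
Proof.
apply: Rn_measurable_funP => i.
rewrite (_ : (fun _ => _) = (fun z : Rn R n => z ord0 i + c ord0 i)).
  by apply: measurable_funD => //; exact: coord_measurable.
by apply/funext => z; rewrite !mxE.
Qed.

Lemma opp_Rn_measurable :
  measurable_fun setT (fun x : Rn R n => (- x : 'rV[R]_n) : Rn R n).
Proof.
apply: Rn_measurable_funP => i.
rewrite (_ : (fun _ => _) = (fun z : Rn R n => - z ord0 i)).
  by apply: measurableT_comp => //; exact: coord_measurable.
by apply/funext => z; rewrite !mxE.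
Qed.

Lemma dotv_measurable (y : 'rV[R]_n) : measurable_fun setT (fun x : Rn R n => dotv x y).
Proof.
rewrite /dotv; apply: measurable_sum => i.
by apply: measurable_funM => //; exact: coord_measurable.
Qed.

Lemma dotv2_measurable :
  measurable_fun setT (fun z : Rn R n * Rn R n => dotv z.1 z.2).
Proof.
rewrite /dotv; apply: measurable_sum => i; apply: measurable_funM.
  - exact: (measurableT_comp (coord_measurable i) measurable_fst).
  - exact: (measurableT_comp (coord_measurable i) measurable_snd).
Qed.

Lemma dotvv_measurable : measurable_fun setT (fun x : Rn R n => dotv x x).
Proof.
rewrite /dotv; apply: measurable_sum => i.
by apply: measurable_funM => //; exact: coord_measurable.
Qed.

Lemma measurable_fun_sub (f : Rn R n -> R) : measurable_fun setT f ->
  measurable_fun setT (fun z : Rn R n * Rn R n => f (z.1 - z.2 : 'rV[R]_n)).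
Proof. by move=> mf; exact: (measurableT_comp mf sub_Rn_measurable). Qed.

End borel.

(** * Lebesgue measure: uniqueness, translations and reflection *)

Definition ocbox (R : realType) (n : nat) (a b : 'rV[R]_n) : set (Rn R n) :=
  [set x | forall i, a ord0 i < x ord0 i <= b ord0 i].

Section lebesgue.
Context (R : realType) (n : nat).
Implicit Types (a b : 'rV[R]_n).

Lemma Rn_measure_unique (m1 m2 : {measure set (Rn R n) -> \bar R}) :
  (forall a b, m1 (hbox a b) = m2 (hbox a b)) ->
  (forall k : nat, (m1 (hbox (const_mx (- k%:R)%R) (const_mx k%:R)) < +oo)%E) ->
  forall A, measurable A -> m1 A = m2 A.
Proof.
move=> m12 m1oo; apply: (@measure_unique _ _ _ (@hboxes R n)
  (fun k => hbox (const_mx (- k%:R)) (const_mx k%:R))) => //.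
- exact: Rn_measurableE.
- exact: hboxes_setI_closed.
- by move=> k; do 2 eexists; reflexivity.
- apply/seteqP; split => // x _.
  have [k hk] : exists k : nat, forall i, `|x ord0 i| < k%:R.
    exists (Num.truncn (\sum_i `|x ord0 i|)).+1 => i.
    apply: le_lt_trans (truncnS_gt _).
    by rewrite (bigD1 i) //= lerDl sumr_ge0.
  exists k => // i; rewrite !mxE; have := hk i.
  by rewrite ltr_norml => /andP[/ltW -> ->].
- by move=> _ [a [b ->]].
Qed.

Variable mu : {measure set (Rn R n) -> \bar R}.
Hypothesis mu_leb : is_lebesgue mu.

Lemma hbox_empty a b i : b ord0 i <= a ord0 i -> hbox a b = set0.
Proof.
by move=> ba; apply/seteqP; split => // x /(_ i) /andP[h1 h2]; lra.
Qed.

Lemma is_lebesgueE a b : mu (hbox a b) =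
  if [forall i, a ord0 i <= b ord0 i] then (\prod_(i < n) (b ord0 i - a ord0 i))%:E else 0%E.
Proof.
have [h|] := pselect (forall i, a ord0 i <= b ord0 i).
  by rewrite (introT forallP h) mu_leb.
move=> ab; rewrite (introF forallP ab).
move: ab => /existsNP [i /negP]; rewrite -ltNge => /ltW ba.
by rewrite (hbox_empty ba) measure0.
Qed.

Lemma mu_hbox_fin a b : (mu (hbox a b) < +oo)%E.
Proof. by rewrite is_lebesgueE; case: ifP => _; rewrite ltry. Qed.

Lemma mu_sigma_finite : sigma_finite setT mu.
Proof.
have [q [P [_ TE]]] := open_hbox_cover (@openT 'rV[R]_n).
exists (fun k => if k \in P then hbox (q k).1 (q k).2 else set0).
  by rewrite {1}TE bigcup_mkcond.
move=> k; case: ifP => _; last by rewrite measure0; split.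
by split; [exact: hbox_measurable|exact: mu_hbox_fin].
Qed.

Let addc_mfun c : {mfun Rn R n >-> Rn R n} :=
  HB.pack (fun x : Rn R n => (x + c : 'rV[R]_n) : Rn R n)
    (isMeasurableFun.Build _ _ _ _ _ (@add_Rn_measurable R n c)).

Let opp_mfun : {mfun Rn R n >-> Rn R n} :=
  HB.pack (fun x : Rn R n => (- x : 'rV[R]_n) : Rn R n)
    (isMeasurableFun.Build _ _ _ _ _ (@opp_Rn_measurable R n)).

Lemma mu_translation c A : measurable A ->
  mu ((fun x : Rn R n => (x + c : 'rV[R]_n) : Rn R n) @^-1` A) = mu A.
Proof.
have E a b : (addc_mfun c : Rn R n -> Rn R n) @^-1` hbox a b = hbox (a - c) (b - c).
  apply/seteqP; split => x h i; have := h i; rewrite !mxE /=;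
    by move=> /andP[h1 h2]; apply/andP; split; lra.
have P a b : pushforward mu (addc_mfun c) (hbox a b) = mu (hbox (a - c) (b - c)).
  by rewrite -E.
have Pf a b : (pushforward mu (addc_mfun c) (hbox a b) < +oo)%E by rewrite P mu_hbox_fin.
move: A; apply: (Rn_measure_unique (m1 := pushforward mu (addc_mfun c)) (m2 := mu)).
- move=> a b; transitivity (mu (hbox (a - c) (b - c))); first exact: P.
  rewrite !is_lebesgueE.
  have -> : [forall i, (a - c) ord0 i <= (b - c) ord0 i] = [forall i, a ord0 i <= b ord0 i].
    by apply: eq_forallb => i; rewrite !mxE lerD2r.
  by case: ifP => // _; congr EFin; apply: eq_bigr => i _; rewrite !mxE; ring.
- by move=> k; exact: Pf.
Qed.

Lemma ocboxE a b : ocbox a b =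
  \bigcap_(i in [set: 'I_n]) ((fun x : Rn R n => x ord0 i) @^-1` `]a ord0 i, b ord0 i]%classic).
Proof.
apply/seteqP; split => x /= h i.
- by move=> _; rewrite /preimage /= in_itv /= h.
- by have := h i I; rewrite /preimage /= in_itv.
Qed.

Lemma ocbox_measurable a b : measurable (ocbox a b).
Proof.
rewrite ocboxE; apply: fin_bigcap_measurable => // i _.
by rewrite -[X in measurable X]setTI; exact: coord_measurable.
Qed.

(** Reflection exchanges the two kinds of half-open boxes, so the left-open ones must be measured
    too. The box lies inside [a, b + e[ and contains [a + e, b[; the two volumes are the values of
    one polynomial [q] at e and - e, and continuity at 0 squeezes the measure. *)
Lemma mu_ocbox a b : (forall i, a ord0 i < b ord0 i) ->
  mu (ocbox a b) = (\prod_(i < n) (b ord0 i - a ord0 i))%:E.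
Proof.
move=> ab.
pose q : {poly R} := \prod_(i < n) ('X + (b ord0 i - a ord0 i)%:P).
have qE e : q.[e] = \prod_(i < n) (e + (b ord0 i - a ord0 i)).
  by rewrite horner_prod; apply: eq_bigr => i _; rewrite hornerD hornerX hornerC.
have up e : 0 < e -> (mu (ocbox a b) <= q.[e]%:E)%E.
  move=> e0; have -> : q.[e]%:E = mu (hbox a (b + const_mx e)).
    rewrite qE mu_leb; last by move=> i; rewrite !mxE; have := ab i; lra.
    by congr EFin; apply: eq_bigr => i _; rewrite !mxE; ring.
  apply: le_measure; rewrite ?inE; [exact: ocbox_measurable|exact: hbox_measurable|].
  by move=> x h i; rewrite !mxE; have /andP[h1 h2] := h i; apply/andP; split; lra.
have fin : mu (ocbox a b) \is a fin_num.
  by rewrite ge0_fin_numE//; apply: le_lt_trans (up 1 ltr01) _; rewrite ltry.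
have lo : \forall e \near (0:R)^'+, q.[- e] <= fine (mu (ocbox a b)).
  have : \forall e \near (0:R)^'+, forall i, e < b ord0 i - a ord0 i.
    apply: filter_forall => i; apply: nbhs_right_lt; have := ab i; lra.
  move=> H; near=> e.
  have e0 : 0 < e by near: e; exact: nbhs_right_gt.
  have eab : forall i, e < b ord0 i - a ord0 i by near: e.
  rewrite -lee_fin fineK//.
  have -> : q.[- e]%:E = mu (hbox (a + const_mx e) b).
    rewrite qE mu_leb; last by move=> i; rewrite !mxE; have := eab i; lra.
    by congr EFin; apply: eq_bigr => i _; rewrite !mxE; ring.
  apply: le_measure; rewrite ?inE; [exact: hbox_measurable|exact: ocbox_measurable|].
  by move=> x h i; have := h i; rewrite !mxE => /andP[h1 h2]; apply/andP; split; lra.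
have c1 : q.[e] @[e --> (0:R)^'+] --> q.[0].
  by apply: cvg_at_right_filter; exact: continuous_horner.
have c2 : q.[- e] @[e --> (0:R)^'+] --> q.[0].
  apply: cvg_at_right_filter.
  rewrite -[X in _ --> q.[X]](oppr0).
  by apply: continuous_comp; [exact: opp_continuous|exact: continuous_horner].
rewrite -(fineK fin); congr EFin.
have -> : \prod_(i < n) (b ord0 i - a ord0 i) = q.[0].
  by rewrite qE; apply: eq_bigr => i _; rewrite add0r.
apply/eqP; rewrite eq_le; apply/andP; split.
- apply: (cvgr_to_ge c1); near=> e.
  rewrite -lee_fin fineK//; apply: up; near: e; exact: nbhs_right_gt.
- exact: (cvgr_to_le c2).
Unshelve. all: by end_near. Qed.

Lemma mu_reflection A : measurable A ->
  mu ((fun x : Rn R n => (- x : 'rV[R]_n) : Rn R n) @^-1` A) = mu A.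
Proof.
have E a b : (opp_mfun : Rn R n -> Rn R n) @^-1` hbox a b = ocbox (- b) (- a).
  apply/seteqP; split => x h i; have := h i; rewrite !mxE /=;
    by move=> /andP[h1 h2]; apply/andP; split; lra.
have mE a b : mu (ocbox (- b) (- a)) = mu (hbox a b).
  have [ab|] := pselect (forall i, a ord0 i < b ord0 i).
    rewrite mu_ocbox; last by move=> i; rewrite !mxE ltrN2.
    rewrite mu_leb; last by move=> i; exact: ltW.
    by congr EFin; apply: eq_bigr => i _; rewrite !mxE; ring.
  move=> /existsNP [i /negP]; rewrite -leNgt => ba.
  rewrite (hbox_empty ba) (_ : ocbox _ _ = set0)//.
  by apply/seteqP; split => // x /(_ i); rewrite !mxE => /andP[h1 h2]; lra.
have P a b : pushforward mu opp_mfun (hbox a b) = mu (hbox a b).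
  by rewrite -mE -E.
have Pf a b : (pushforward mu opp_mfun (hbox a b) < +oo)%E by rewrite P mu_hbox_fin.
move: A; apply: (Rn_measure_unique (m1 := pushforward mu opp_mfun) (m2 := mu)).
- exact: P.
- by move=> k; exact: Pf.
Qed.

Lemma ge0_integral_translation (f : Rn R n -> \bar R) (c : 'rV[R]_n) :
  measurable_fun setT f -> (forall x, (0 <= f x)%E) ->
  (\int[mu]_x f ((x + c)%R : 'rV[R]_n) = \int[mu]_x f x)%E.
Proof.
move=> mf f0.
have := @ge0_integral_pushforward _ _ _ _ _ _ (@add_Rn_measurable R n c) mu setT f
  measurableT mf (fun x _ => f0 x).
rewrite preimage_setT => <-.
apply: (@eq_measure_integral _ _ _ setT mu (pushforward mu (addc_mfun c))) => A mA _.
exact: mu_translation.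
Qed.

Lemma ge0_integral_reflection (f : Rn R n -> \bar R) :
  measurable_fun setT f -> (forall x, (0 <= f x)%E) ->
  (\int[mu]_x f ((- x)%R : 'rV[R]_n) = \int[mu]_x f x)%E.
Proof.
move=> mf f0.
have := @ge0_integral_pushforward _ _ _ _ _ _ (@opp_Rn_measurable R n) mu setT f
  measurableT mf (fun x _ => f0 x).
rewrite preimage_setT => <-.
apply: (@eq_measure_integral _ _ _ setT mu (pushforward mu opp_mfun)) => A mA _.
exact: mu_reflection.
Qed.

(** Positive and negative parts have the form [h (f x)] with [h] nonnegative, so an invariance known
    for nonnegative integrands passes to signed ones. *)
Let Rint_split (f g : Rn R n -> R) : measurable_fun setT f -> measurable_fun setT g ->
  (forall h : R -> \bar R, measurable_fun setT h -> (forall r : R, 0 <= h r)%E ->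
    (\int[mu]_x h (f x) = \int[mu]_x h (g x))%E) ->
  \int[mu]_x f x = \int[mu]_x g x.
Proof.
move=> mf mg H; congr fine; rewrite integralE [RHS]integralE; congr (_ - _)%E.
- under eq_integral do rewrite funeposE.
  under [RHS]eq_integral do rewrite funeposE.
  apply: (H (fun r => maxe r%:E 0%E)).
  + by apply: measurable_maxe => //; exact/measurable_EFinP.
  + by move=> x; rewrite le_max lexx orbT.
- under eq_integral do rewrite funenegE.
  under [RHS]eq_integral do rewrite funenegE.
  apply: (H (fun r => maxe (- r%:E)%E 0%E)).
  + apply: measurable_maxe => //; apply: measurableT_comp => //; exact/measurable_EFinP.
  + by move=> x; rewrite le_max lexx orbT.
Qed.

Lemma Rint_translation (f : Rn R n -> R) (c : 'rV[R]_n) : measurable_fun setT f ->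
  \int[mu]_x f (x + c : 'rV[R]_n) = \int[mu]_x f x.
Proof.
move=> mf; apply: Rint_split => //.
  exact: (measurableT_comp mf (@add_Rn_measurable R n c)).
move=> h mh h0; apply: (@ge0_integral_translation (h \o f)) => // [|x].
  exact: measurableT_comp.
exact: h0.
Qed.

Lemma Rint_reflection (f : Rn R n -> R) : measurable_fun setT f ->
  \int[mu]_x f (- x : 'rV[R]_n) = \int[mu]_x f x.
Proof.
move=> mf; apply: Rint_split => //.
  exact: (measurableT_comp mf (@opp_Rn_measurable R n)).
move=> h mh h0; apply: (@ge0_integral_reflection (h \o f)) => // [|x].
  exact: measurableT_comp.
exact: h0.
Qed.

Lemma L1_translation (f : Rn R n -> R) (c : 'rV[R]_n) : L1 mu f ->
  L1 mu (fun x : Rn R n => f (x + c : 'rV[R]_n)).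
Proof.
move=> fi; have mf := L1_measurable fi; apply: L1I.
  exact: (measurableT_comp mf (@add_Rn_measurable R n c)).
rewrite (@ge0_integral_translation (fun x => `|f x|%:E)) => //.
- exact: L1_lty.
- by apply/measurable_EFinP/measurableT_comp.
Qed.

End lebesgue.

(** The theorem speaks of a bare measure, while Fubini and Tonelli want a bundled sigma-finite one.
    The bundle is rebuilt on the same set function, so that it can be substituted for [mu]. *)
Lemma sigma_finite_is_lebesgue (R : realType) (n : nat)
    (mu : {measure set (Rn R n) -> \bar R}) : is_lebesgue mu ->
  exists nu : {sigma_finite_measure set (Rn R n) -> \bar R},
    (nu : {measure set (Rn R n) -> \bar R}) = mu.
Proof.
move=> /mu_sigma_finite; case: mu => m [c1 c2] sf.
pose nu0 : {measure set (Rn R n) -> \bar R} := Measure.Pack (Measure.Class c2).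
pose nu1 : {sfinite_measure set (Rn R n) -> \bar R} := HB.pack m c1 c2
  (isSFinite.Build _ _ _ _ (sfinite_measure_sigma_finite (sf : sigma_finite setT nu0))).
pose nu : {sigma_finite_measure set (Rn R n) -> \bar R} := HB.pack m nu1
  (isSigmaFinite.Build _ _ _ m sf).
by exists nu.
Qed.

(** * Measures with a density, and integrals of products over the coordinates *)

Section density.
Context d (T : measurableType d) (R : realType).
Variable mu : {measure set T -> \bar R}.
Import HBNNSimple.

(** The integral formula holds for indicators by definition, for simple functions by linearity and
    for nonnegative measurable functions by monotone convergence. *)
Lemma density_measure (W : T -> R) : measurable_fun setT W -> (forall x, 0 <= W x) ->
  exists nu : {measure set T -> \bar R},
    (forall A, nu A = \int[mu]_(x in A) (W x)%:E)%E /\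
    (forall f : T -> \bar R, measurable_fun setT f -> (forall x, 0 <= f x)%E ->
      \int[nu]_x f x = \int[mu]_x (f x * (W x)%:E))%E.
Proof.
move=> mW W0; pose m A := (\int[mu]_(x in A) (W x)%:E)%E.
have m0 : m set0 = 0%E by rewrite /m integral_set0.
have mge0 A : (0 <= m A)%E by apply: integral_ge0 => x _; rewrite lee_fin.
have msa : semi_sigma_additive m.
  move=> A mA tA mUA; rewrite /m ge0_integral_bigcup//.
  - apply: is_cvg_ereal_nneg_natsum_cond => k _ _; exact: mge0.
  - by apply: measurable_funTS; exact/measurable_EFinP.
  - by move=> x _; rewrite lee_fin.
pose nu : {measure set T -> \bar R} := HB.pack m (isMeasure.Build _ _ _ m m0 mge0 msa).
exists nu; split => // f mf f0.
pose h := nnsfun_approx measurableT mf.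
have -> : (\int[nu]_x f x = lim (\int[nu]_x (EFin \o h k) x @[k --> \oo]))%E.
  have fE x : f x = (lim ((EFin \o h k) x @[k --> \oo]))%E.
    by apply/esym/cvg_lim => //; exact: cvg_nnsfun_approx.
  under eq_integral do rewrite fE.
  apply: monotone_convergence => //.
  - by move=> k; apply/measurable_EFinP; exact/measurable_funP.
  - by move=> k x _ //=; rewrite lee_fin.
  - by move=> x _ a b ab; rewrite lee_fin; exact/lefP/nd_nnsfun_approx.
have -> : (\int[mu]_x (f x * (W x)%:E) =
    lim (\int[mu]_x ((EFin \o h k) x * (W x)%:E) @[k --> \oo]))%E.
  have fE x : (f x * (W x)%:E = (lim ((EFin \o h k) x * (W x)%:E @[k --> \oo])))%E.
    by apply/esym/cvg_lim => //; apply: cvgeZr => //; exact: cvg_nnsfun_approx.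
  under eq_integral do rewrite fE.
  apply: monotone_convergence => //.
  - move=> k; apply: emeasurable_funM; last exact/measurable_EFinP.
    by apply/measurable_EFinP; exact/measurable_funP.
  - by move=> k x _ /=; rewrite mule_ge0// lee_fin.
  - move=> x _ a b ab /=; rewrite lee_wpmul2r ?lee_fin//.
    exact/lefP/nd_nnsfun_approx.
congr (lim _); apply/funext => s; apply/propext; rewrite /fmap /= .
suff E k : (\int[nu]_x (h k x)%:E = \int[mu]_x ((h k x)%:E * (W x)%:E))%E.
  by under eq_fun do rewrite E.
transitivity (\int[nu]_x
   (\sum_(y \in range (h k)) (y * \1_(h k @^-1` [set y]) x)%:E))%E.
  by apply: eq_integral => t tE; rewrite /= fimfunE -fsumEFin.
rewrite ge0_integral_fsum//; last 2 first.
  - by move=> r; apply/measurable_EFinP; exact: measurable_funM.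
  - by move=> r x _; exact: nnfun_muleindic_ge0.
transitivity (\int[mu]_x (\sum_(y \in range (h k))
    (y * \1_(h k @^-1` [set y]) x)%:E * (W x)%:E))%E; last first.
  apply: eq_integral => x xE.
  rewrite -ge0_mule_fsuml => [|y]; last exact: nnfun_muleindic_ge0.
  by rewrite fsumEFin // -(fimfunE _ x).
rewrite ge0_integral_fsum//; last 2 first.
  - move=> y; apply: emeasurable_funM; last exact/measurable_EFinP.
    by apply/measurable_EFinP; exact: measurable_funM.
  - by move=> r x _; rewrite mule_ge0 ?lee_fin// -?lee_fin nnfun_muleindic_ge0.
apply: eq_fsbigr => r rhn.
under eq_integral do rewrite EFinM.
rewrite integralZl_indic_nnsfun//.
under [RHS]eq_integral do rewrite EFinM -muleA.
have mi : measurable_fun setT (fun x => ((\1_(h k @^-1` [set r]) x)%:E * (W x)%:E)%E).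
  apply: emeasurable_funM; last exact/measurable_EFinP.
  by apply/measurable_EFinP.
(* A simple function of the approximation is nonnegative, so the level set of a negative value is
   empty. *)
have [r0|r0] := ltP r 0.
  have -> : h k @^-1` [set r] = set0.
    apply/seteqP; split => // x /= xr; move: r0; rewrite -xr ltNge.
    by rewrite fun_ge0.
  under eq_integral do rewrite indic0.
  under [RHS]eq_integral do rewrite indic0 mul0e mule0.
  by rewrite !integral0 mule0.
rewrite ge0_integralZl//; last by move=> x _; rewrite mule_ge0 ?lee_fin.
congr (_ * _)%E; rewrite integral_indic// setIT /= /m.
rewrite [LHS]integral_mkcond; apply: eq_integral => x _.
rewrite patchE indicE; case: ifPn => _; first by rewrite mul1e.
by rewrite mul0e.
Qed.

End density.

Section product_integral.
Context (R : realType) (n : nat).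
Variable mu : {sigma_finite_measure set (Rn R n) -> \bar R}.
Hypothesis mu_leb : is_lebesgue mu.
Local Notation leb := (@lebesgue_measure R).

Let prodf (f : 'I_n -> R -> R) (x : Rn R n) := \prod_i f i (x ord0 i).

Let good (f : R -> R) (c : R) := [/\ measurable_fun setT f, (forall t, 0 <= f t),
  0 < c & (\int[leb]_t (f t)%:E = c%:E)%E].

Let meas_prodf (f : 'I_n -> R -> R) : (forall i, measurable_fun setT (f i)) ->
  measurable_fun setT (prodf f).
Proof.
move=> mf; apply: measurable_prod => i _.
exact: (measurableT_comp (mf i) (@coord_measurable R n i)).
Qed.

(** The measure is known only through volumes of boxes, not as a product. Induction on the number
    [k] of coordinates whose factor is arbitrary, the others carrying indicators of intervals. The
    other factors define a density [W]; the image of that measure under coordinate [j] is, by the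
    induction hypothesis with an interval in slot [j], the multiple [C] of length on intervals,
    hence on all Borel sets, and any admissible factor may be integrated against it. *)
Let prod_claim k (f : 'I_n -> R -> R) (c : 'I_n -> R) :
  (forall i, good (f i) (c i)) ->
  (forall i : 'I_n, (k <= i)%N -> exists a b : R, a < b /\ f i = \1_(`]a, b]%classic)) ->
  (\int[mu]_x (prodf f x)%:E = (\prod_i c i)%:E)%E.
Proof.
elim: k f c => [|k IH] f c gf itv.
  have /choice[a] : forall i, exists a, exists b : R, a < b /\ f i = \1_(`]a, b]%classic).
    by move=> i; exact: itv.
  move=> /choice[b ab].
  pose A : 'rV[R]_n := \row_i a i; pose B : 'rV[R]_n := \row_i b i.
  have -> : (fun x => (prodf f x)%:E) = (fun x => (\1_(ocbox A B) x)%:E).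
    apply/funext => x; congr EFin; rewrite /prodf indicE.
    have [h|h] := pselect (ocbox A B x).
      rewrite mem_set//= big1// => i _; rewrite (ab i).2 indicE mem_set//=.
      by have := h i; rewrite !mxE in_itv.
    rewrite memNset//=; move: h => /existsNP [i hi].
    rewrite (bigD1 i)//= (ab i).2 indicE memNset ?mul0r//=.
    by move: hi; rewrite !mxE in_itv.
  rewrite integral_indic//; last exact: ocbox_measurable.
  rewrite setIT mu_ocbox//; last by move=> i; rewrite !mxE (ab i).1.
  congr EFin; apply: eq_bigr => i _; rewrite !mxE.
  have [_ _ _] := gf i; rewrite (ab i).2 integral_indic//= setIT lebesgue_measure_itv /=.
  by rewrite lte_fin (ab i).1 => -[].
have [nk|kn] := leqP n k.
  apply: IH => // i ki; have := ltn_ord i.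
  by rewrite ltnNge (leq_trans nk ki).
pose j := Ordinal kn.
pose fj (g : R -> R) i := if i == j then g else f i.
pose W (x : Rn R n) := \prod_(i | i != j) f i (x ord0 i).
have mfi i : measurable_fun setT (f i) by have [] := gf i.
have fi0 i t : 0 <= f i t by have [] := gf i.
have mW : measurable_fun setT (W : Rn R n -> R).
  have : measurable_fun setT (prodf (fj (fun=> 1))).
    by apply: meas_prodf => i; rewrite /fj; case: ifP.
  congr (measurable_fun _ _); apply/funext => x; rewrite /prodf /W (bigD1 j)//=.
  rewrite /fj eqxx mul1r; apply: eq_bigr => i /negbTE ij.
  by rewrite ij.
have W0 x : 0 <= W x by apply: prodr_ge0.
have [nu [nuE nui]] := @density_measure _ (Rn R n) R mu W mW W0.
have mj : measurable_fun setT (fun x : Rn R n => x ord0 j : measurableTypeR R).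
  by move=> mD A mA; exact: (@coord_measurable R n j mD A mA).
pose coordj (x : Rn R n) : measurableTypeR R := x ord0 j.
pose C := \prod_(i | i != j) c i.
have C0 : 0 < C by apply: prodr_gt0 => i _; have [] := gf i.
have Ci0 : 0 <= C^-1 by rewrite invr_ge0 ltW.
pose pnu0 : {measure set (measurableTypeR R) -> \bar R} := pushforward nu coordj.
pose pnu := pnu0 mj.
have nuI a b : a < b -> pnu `]a, b]%classic = (C * (b - a))%:E.
  move=> ab; rewrite /pnu /= /pushforward nuE.
  pose I1 : R -> R := \1_(`]a, b]%classic).
  have gI : good I1 (b - a).
    split.
    - by apply: measurable_indic.
    - by move=> t; rewrite /I1 indicE.
    - by rewrite subr_gt0.
    - by rewrite /I1 integral_indic//= setIT lebesgue_measure_itv /= lte_fin ab EFinB.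
  have := IH (fj I1) (fun i => if i == j then b - a else c i).
  have -> : \prod_i (if i == j then b - a else c i) = C * (b - a).
    rewrite (bigD1 j)//= eqxx mulrC; congr (_ * _).
    by apply: eq_bigr => i /negbTE ->.
  move=> <-.
  - rewrite integral_mkcond; apply: eq_integral => x _.
    rewrite patchE /prodf (bigD1 j)//= /fj eqxx.
    have -> : \prod_(i < n | i != j) (if i == j then I1 else f i) (x ord0 i) = W x.
      by apply: eq_bigr => i /negbTE ->.
    rewrite /I1 indicE.
    have [h|h] := pselect (`]a, b]%classic (x ord0 j)).
      by rewrite !mem_set// mul1r.
    by rewrite !memNset// mul0r.
  - by move=> i; rewrite /fj; case: ifP => // _; exact: gf.
  - move=> i; rewrite leq_eqVlt => /predU1P[ki|ki].
      exists a, b; split => //; rewrite /fj.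
      by have -> : i == j by apply/eqP/val_inj.
    have ij : i == j = false by apply/eqP => ij; move: ki; rewrite ij ltnn.
    by rewrite /fj ij; exact: itv.
have nuL A : measurable A -> leb A = mscale (NngNum Ci0) pnu A.
  apply: lebesgue_measure_unique => _ [[a b]] _ <- /=.
  have [ab|ba] := ltP a b.
    by rewrite /mscale /= nuI// lebesgue_measure_itv /= lte_fin ab -EFinM mulKf ?gt_eqF.
  by rewrite set_itv_ge -?leNgt// /mscale !measure0 mule0.
have [mfj fj0 cj0 Ej] := gf j.
have E1 : (\int[leb]_t (f j t)%:E = (C^-1)%:E * \int[pnu]_t (f j t)%:E)%E.
  rewrite (@eq_measure_integral _ _ _ setT (mscale (NngNum Ci0) pnu) leb); last first.
    by move=> A mA _; exact: nuL.
  rewrite ge0_integral_mscale//; first by apply/measurable_EFinP.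
  by move=> t _; rewrite lee_fin.
have E2 : (\int[mu]_x (prodf f x)%:E = \int[pnu]_t (f j t)%:E)%E.
  rewrite /pnu ge0_integral_pushforward//; last 2 first.
  - exact/measurable_EFinP.
  - by move=> t _; rewrite lee_fin.
  rewrite preimage_setT nui /=.
  - by apply: eq_integral => x _; rewrite -EFinM; congr EFin; rewrite /prodf (bigD1 j).
  - by apply/measurable_EFinP; exact: (measurableT_comp mfj (@coord_measurable R n j)).
  - by move=> x; rewrite lee_fin.
rewrite E2 (bigD1 j)//= -/C mulrC EFinM -Ej E1 muleA -EFinM divff ?gt_eqF//.
by rewrite mul1e.
Qed.

Lemma ge0_integral_prod (f : R -> R) (c : R) : measurable_fun setT f ->
  (forall t, 0 <= f t) -> 0 < c -> (\int[leb]_t (f t)%:E = c%:E)%E ->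
  (\int[mu]_x (\prod_i f (x ord0 i))%:E = (c ^+ n)%:E)%E.
Proof.
move=> mf f0 c0 fc.
have := @prod_claim n (fun=> f) (fun=> c).
rewrite prodr_const card_ord; apply => // i ni.
by have := ltn_ord i; rewrite ltnNge ni.
Qed.

End product_integral.

(** * Gaussians and the cosine transform *)

Section derivative_rules.
Context {R : realType}.
Implicit Types (f g : R -> R) (t a b : R).

(** The rules are stated so that a derivative is built as one nested term; [deq] then leaves a
    single algebraic identity between the derivative found and the one wanted. *)
Lemma deq t f a b : is_derive t 1 f a -> a = b -> is_derive t 1 f b.
Proof. by move=> fa <-. Qed.

Lemma dcst t a : is_derive t 1 (fun=> a) (0 : R).
Proof. exact: is_derive_cst. Qed.

Lemma did t : is_derive t 1 (fun u : R => u) (1 : R).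
Proof. exact: is_derive_id. Qed.

Lemma dadd t f g a b : is_derive t 1 f a -> is_derive t 1 g b ->
  is_derive t 1 (fun u => f u + g u) (a + b).
Proof. by move=> fa gb; exact: is_deriveD. Qed.

Lemma dopp t f a : is_derive t 1 f a -> is_derive t 1 (fun u => - f u) (- a).
Proof. by move=> fa; exact: is_deriveN. Qed.

Lemma dmul t f g a b : is_derive t 1 f a -> is_derive t 1 g b ->
  is_derive t 1 (fun u => f u * g u) (a * g t + f t * b).
Proof.
move=> fa gb; have := is_deriveM fa gb.
by rewrite /GRing.scale /= addrC [g t * a]mulrC.
Qed.

Lemma dcomp t f g a b : is_derive (g t) 1 f a -> is_derive t 1 g b ->
  is_derive t 1 (fun u => f (g u)) (a * b).
Proof. by move=> fa gb; exact: (@is_derive1_comp _ f g). Qed.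

Lemma dexp t f a : is_derive t 1 f a -> is_derive t 1 (fun u => expR (f u)) (expR (f t) * a).
Proof. by move=> fa; exact: dcomp. Qed.

Lemma dcos t f a : is_derive t 1 f a -> is_derive t 1 (fun u => cos (f u)) (- sin (f t) * a).
Proof. by move=> fa; exact: dcomp. Qed.

Lemma dsin t f a : is_derive t 1 f a -> is_derive t 1 (fun u => sin (f u)) (cos (f t) * a).
Proof. by move=> fa; exact: dcomp. Qed.

Lemma is_derive_continuous f t a : is_derive t 1 f a -> {for t, continuous f}.
Proof. by move=> [fd _]; apply: differentiable_continuous; apply/derivable1_diffP. Qed.

Lemma is_derive_cvg_seq f t a (h : nat -> R) : is_derive t 1 f a ->
  (forall k, h k != 0) -> h @ \oo --> (0 : R) ->
  (f (t + h k) - f t) / h k @[k --> \oo] --> a.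
Proof.
move=> [fd fa] h0 hc.
have := fd; rewrite /derivable => /cvg_ex[l fl].
have fl' := fl; move: fl' => /cvgr_dnbhsP/(_ h (conj h0 hc)).
have <- : l = a by rewrite -fa; apply/esym/cvg_lim.
apply: cvg_trans; apply: near_eq_cvg; apply: nearW => k.
by rewrite /GRing.scale /= mulr1 mulrC [h k + t]addrC.
Qed.

(** One term of the exponential series: y^k / k! <= e^y. The bounds of polynomials against Gaussians
    below rest on it. *)
Lemma pow_expRN (k : nat) (y : R) : 0 <= y -> y ^+ k * expR (- y) <= k`!%:R.
Proof.
move=> y0; case: k => [|k].
  by rewrite expr0 mul1r fact0 -expR0 ler_expR oppr_le0.
have f0 : 0 < k.+1`!%:R :> R by rewrite ltr0n fact_gt0.
rewrite expRN ler_pdivrMr ?expR_gt0// mulrC -ler_pdivrMr//.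
by rewrite (le_trans _ (expR_ge1Dxn k y0))// lerDr.
Qed.

End derivative_rules.

Section dotv.
Context {R : realType} {n : nat}.
Implicit Types (x y z v : 'rV[R]_n) (t : R).

Lemma dotvC x y : dotv x y = dotv y x.
Proof. by apply: eq_bigr => i _; rewrite mulrC. Qed.

Lemma dotvDl x y z : dotv (x + y) z = dotv x z + dotv y z.
Proof. by rewrite /dotv -big_split /=; apply: eq_bigr => i _; rewrite mxE mulrDl. Qed.

Lemma dotvZl t x y : dotv (t *: x) y = t * dotv x y.
Proof. by rewrite /dotv mulr_sumr; apply: eq_bigr => i _; rewrite mxE mulrA. Qed.

Lemma dotvNl x y : dotv (- x) y = - dotv x y.
Proof. by rewrite -scaleN1r dotvZl mulN1r. Qed.

Lemma dotvDr x y z : dotv z (x + y) = dotv z x + dotv z y.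
Proof. by rewrite dotvC dotvDl !(dotvC z). Qed.

Lemma dotvZr t x y : dotv x (t *: y) = t * dotv x y.
Proof. by rewrite dotvC dotvZl dotvC. Qed.

Lemma dotvNr x y : dotv x (- y) = - dotv x y.
Proof. by rewrite dotvC dotvNl dotvC. Qed.

Lemma dotv_ge0 x : 0 <= dotv x x.
Proof. by apply: sumr_ge0 => i _; rewrite -expr2 sqr_ge0. Qed.

Lemma dotv_line x v t :
  dotv (x + t *: v) (x + t *: v) = dotv x x + 2 * t * dotv x v + t ^+ 2 * dotv v v.
Proof. by rewrite !(dotvDl, dotvDr, dotvZl, dotvZr) (dotvC v x); ring. Qed.

Lemma dotv_le x y : `|dotv x y| <= (dotv x x + dotv y y) / 2.
Proof.
have h z : - dotv x z <= (dotv x x + dotv z z) / 2.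
  have := dotv_ge0 (x + z); rewrite !(dotvDl, dotvDr) (dotvC z x); lra.
rewrite ler_norml; apply/andP; split; first by have := h y; lra.
by have := h (- y); rewrite !dotvNr !dotvNl; lra.
Qed.

Lemma coord_sqr_le x (i : 'I_n) : x ord0 i ^+ 2 <= dotv x x.
Proof.
rewrite /dotv (bigD1 i)//= -expr2 lerDl; apply: sumr_ge0 => j _.
by rewrite -expr2 sqr_ge0.
Qed.

Lemma dotv_basis x i : dotv x (basis_vec R i) = x ord0 i.
Proof.
rewrite /dotv (bigD1 i)//= mxE !eqxx mulr1 big1 ?addr0// => j ji.
by rewrite mxE (negbTE ji) andbF mulr0.
Qed.

(** The difference of |x + t v|^2 and |x + 2 t v|^2 / 2 is |x|^2 / 2 - t^2 |v|^2, and the second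
    square is nonnegative. *)
Lemma dotv_shift_ge x v t : `|t| <= 1 ->
  dotv x x / 2 - dotv v v <= dotv (x + t *: v) (x + t *: v).
Proof.
move=> t1; rewrite dotv_line.
have := dotv_ge0 (x + (2 * t) *: v); rewrite dotv_line.
have t21 : t ^+ 2 <= 1 by rewrite -real_normK ?num_real// expr_le1.
have := ler_wpM2r (dotv_ge0 v) t21.
rewrite exprMn mul1r => h1 h2.
have -> : 2 * t * dotv x v = (2 * (2 * t) * dotv x v) / 2 by field.
lra.
Qed.

End dotv.

(** * Integration by parts and the heat kernel *)

Section heat.
Context (R : realType) (n : nat).
Variable mu : {sigma_finite_measure set (Rn R n) -> \bar R}.
Hypothesis mu_leb : is_lebesgue mu.
Implicit Types (x y xi v : 'rV[R]_n) (t l : R).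

(** Translation invariance makes the integral of every difference quotient vanish; the mean value
    theorem bounds the quotients by [G], and dominated convergence passes to the derivative. All
    integrations by parts below go through this fact. *)
Lemma Rint_dirder0 (F dF G : Rn R n -> R) v :
  (forall x : 'rV[R]_n, is_derive (0:R) 1 (fun t : R => F (x + t *: v)) (dF x)) ->
  L1 mu F -> measurable_fun setT dF -> L1 mu G ->
  (forall (x : 'rV[R]_n) t, `|t| <= 1 -> `|dF (x + t *: v)| <= G x) ->
  \int[mu]_x dF x = 0.
Proof.
move=> dFE Fi mdF Gi dFG.
have dFt x t : is_derive t 1 (fun u : R => F (x + u *: v)) (dF (x + t *: v)).
  have := dFE (x + t *: v) => H.
  have -> : (fun u : R => F (x + u *: v)) =
      (fun u : R => (fun w : R => F ((x + t *: v) + w *: v)) (u - t)).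
    by apply/funext => u; congr F; rewrite -addrA -scalerDl [t + _]addrC subrK.
  have dsub : is_derive t 1 (fun u : R => u - t) (1 : R).
    by rewrite -[X in is_derive _ _ _ X]addr0; apply: dadd (did _) (dcst _ _).
  have := @dcomp _ t (fun w : R => F ((x + t *: v) + w *: v)) (fun u => u - t) _ 1 _ dsub.
  by rewrite subrr => /(_ _ H); rewrite mulr1.
pose h (k : nat) : R := k.+1%:R^-1.
have h0 k : 0 < h k by rewrite invr_gt0.
have h1 k : h k <= 1 by rewrite invf_le1 ?ler1n.
have hc : h @ \oo --> (0 : R) by exact: cvg_harmonic.
pose f (k : nat) (x : Rn R n) : R := (F ((x : 'rV[R]_n) + h k *: v) - F x) / h k.
have mF := L1_measurable Fi.
have mFt c : measurable_fun setT (fun x : Rn R n => F ((x : 'rV[R]_n) + c)).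
  exact: (measurableT_comp mF (@add_Rn_measurable R n c)).
have Fti c : L1 mu (fun x : Rn R n => F ((x : 'rV[R]_n) + c)) by exact: L1_translation.
have mf k : measurable_fun setT (f k).
  by apply: measurable_funM => //; apply: measurable_funB.
have fc x : f ^~ x @ \oo --> dF x.
  have := is_derive_cvg_seq (dFE x) (fun k => lt0r_neq0 (h0 k)) hc.
  by rewrite /f /= scale0r addr0; under eq_fun do rewrite add0r.
have fG k x : `|f k x| <= G x.
  have [c cI] := @MVT R (fun u : R => F (x + u *: v)) (fun t => dF (x + t *: v)) 0 (h k) (h0 k)
    (fun t _ => dFt x t) (continuous_subspaceT (fun t => is_derive_continuous (dFt x t))).
  rewrite scale0r addr0 subr0 /f => ->.
  rewrite mulfK ?gt_eqF//; apply: dFG.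
  move: cI; rewrite in_itv/= => /andP[c0 c1].
  by rewrite ger0_norm ?ltW// (lt_le_trans c1).
have [_] := Rint_dct mf fc Gi fG.
have -> : (fun k => \int[mu]_x f k x) = (fun=> 0).
  apply/funext => k; rewrite /f.
  transitivity (\int[mu]_x ((h k)^-1 * (F ((x : 'rV[R]_n) + h k *: v) - F x))).
    by apply: eq_RintegralT => x; rewrite mulrC.
  rewrite RintZT; last exact: L1B.
  by rewrite RintBT// Rint_translation// subrr mulr0.
by move=> H; apply/esym; apply: (cvg_unique _ _ H) => //; exact: cvg_cst.
Qed.

(** The root inside the [n]-th power stands for the half-integer exponent - n / 2 of 4 pi l. *)
Definition heat l (x : 'rV[R]_n) : R :=
  (Num.sqrt (4 * pi * l)) ^- n * expR (- dotv x x / (4 * l)).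

Lemma heat_ge0 l x : 0 <= heat l x.
Proof. by rewrite mulr_ge0 ?expR_ge0// invr_ge0 exprn_ge0// sqrtr_ge0. Qed.

Lemma heatN l x : heat l (- x) = heat l x.
Proof. by rewrite /heat dotvNl dotvNr opprK. Qed.

Lemma heat_measurable l : measurable_fun setT (heat l : Rn R n -> R).
Proof.
apply: measurable_funM => //; apply: measurableT_comp => //.
apply: measurable_funM => //; apply: measurableT_comp => //.
exact: dotvv_measurable.
Qed.

(** The heat kernel is the product over the coordinates of the centred normal density of variance 2
    l. *)
Lemma Rint_heatE l : 0 < l -> (\int[mu]_x (heat l x)%:E = 1)%E.
Proof.
move=> l0; pose s : R := Num.sqrt (2 * l).
have s0 : s != 0 by rewrite gt_eqF// sqrtr_gt0 mulr_gt0.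
have s2 : s ^+ 2 = 2 * l by rewrite sqr_sqrtr// mulr_ge0// ltW.
have := @ge0_integral_prod R n mu mu_leb (normal_pdf 0 s) 1.
rewrite expr1n => <- //.
- apply: eq_integral => x _; congr EFin.
  rewrite /heat /normal_pdf (negbTE s0) /normal_peak /normal_fun s2 big_split /=.
  rewrite prodr_const card_ord exprVn; congr (_ * _).
    by congr ((Num.sqrt _) ^- n); rewrite -mulr_natr; ring.
  rewrite -expR_sum; congr expR.
  rewrite /dotv mulNr mulr_suml -sumrN; apply: eq_bigr => i _.
  by rewrite subr0 -mulr_natr; field; rewrite gt_eqF.
- exact: measurable_normal_pdf.
- by move=> t; exact: normal_pdf_ge0.
- exact: integral_normal_pdf.
Qed.

Lemma heat_L1 l : 0 < l -> L1 mu (heat l).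
Proof.
move=> l0; apply: L1I; first exact: heat_measurable.
under eq_integral do rewrite ger0_norm ?heat_ge0//.
by rewrite Rint_heatE// ltry.
Qed.

Lemma Rint_heat l : 0 < l -> \int[mu]_x heat l x = 1.
Proof. by move=> l0; rewrite /Rintegral Rint_heatE. Qed.

End heat.

Definition lapsym (R : realType) (n : nat) (xi : 'rV[R]_n) : R := 4 * pi ^+ 2 * dotv xi xi.

(* Every kernel below is even, so that the cosine transform is its Fourier transform. *)
Definition ct (R : realType) (n : nat) (mu : {measure set (Rn R n) -> \bar R})
    (f : 'rV[R]_n -> R) (xi : 'rV[R]_n) : R :=
  \int[mu]_x (f x * cos (2 * pi * dotv x xi)).

Definition st (R : realType) (n : nat) (mu : {measure set (Rn R n) -> \bar R})
    (f : 'rV[R]_n -> R) (xi : 'rV[R]_n) : R :=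
  \int[mu]_x (f x * sin (2 * pi * dotv x xi)).

Section derive_integral.
Context d (T : measurableType d) (R : realType) (mu : {measure set T -> \bar R}).

Lemma is_derive_Rint (f df : R -> T -> R) (G : T -> R) (t : R) :
  (forall (u : R) (x : T), is_derive u (1 : R) (fun w : R => f w x) (df u x)) ->
  (forall u : R, L1 mu (f u)) ->
  L1 mu G -> (forall (u : R) x, `|df u x| <= G x) ->
  is_derive t (1 : R) (fun u : R => \int[mu]_x f u x) (\int[mu]_x df t x).
Proof.
move=> fE fi Gi fG.
have dE u x : partial1of2 f u x = df u x.
  by rewrite partial1of2E; exact: derive_val.
have tI : `]t - 1, t + 1[%classic t by rewrite /= in_itv /=; lra.
have H := @cvg_differentiation_under_integral R _ T mu f setT measurableT t (t - 1) (t + 1) tI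
  (fun u _ => fi u) (fun u x _ _ => @ex_derive _ _ _ _ _ _ _ (fE u x)) G
  (fun x => le_trans (normr_ge0 _) (fG t x)) Gi.
have {}H : h^-1 *: (((fun u => \int[mu]_x f u x) \o shift t) (h *: (1:R)) -
    (\int[mu]_x f t x)) @[h --> (0:R)^'] --> \int[mu]_x df t x.
  rewrite -(eq_RintegralT mu (dE t)).
  apply: cvg_trans (H _); last by move=> u x _ _; rewrite dE.
  apply: near_eq_cvg; apply: nearW => h.
  by rewrite /= /GRing.scale /= mulr1.
split; first by apply/cvg_ex; eexists; exact: H.
by apply/cvg_lim.
Qed.

End derive_integral.

Section gaussian.
Context (R : realType) (n : nat).
Variable mu : {sigma_finite_measure set (Rn R n) -> \bar R}.
Hypothesis mu_leb : is_lebesgue mu.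
Implicit Types (x y xi v : 'rV[R]_n) (t l c : R).

Lemma heatE l x : 0 < l ->
  expR (- dotv x x / (4 * l)) = Num.sqrt (4 * pi * l) ^+ n * heat l x.
Proof.
move=> l0; rewrite /heat mulrA divff ?mul1r// expf_neq0// gt_eqF//.
by rewrite sqrtr_gt0 !mulr_gt0// pi_gt0.
Qed.

Lemma gauss_measurable c : measurable_fun setT (fun x : Rn R n => expR (- dotv x x / c)).
Proof.
apply: measurableT_comp => //; apply: measurable_funM => //.
by apply: measurableT_comp => //; exact: dotvv_measurable.
Qed.

Lemma gauss_L1 c : 0 < c -> L1 mu (fun x => expR (- dotv x x / c)).
Proof.
move=> c0; have c40 : 0 < c / 4 by rewrite divr_gt0.
apply: (L1_le (g := fun x : Rn R n => Num.sqrt (4 * pi * (c / 4)) ^+ n * heat (c / 4) x)).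
- exact: gauss_measurable.
- by move=> x; rewrite -heatE// [4 * (c / 4)]mulrC divfK.
- by apply: L1Z; exact: heat_L1.
Qed.

(** Half of the Gaussian decay is kept as a heat kernel at twice the time; the other half is left
    free to absorb polynomial factors. *)
Lemma heat_split l x : 0 < l ->
  heat l x = Num.sqrt 2 ^+ n * heat (2 * l) x * expR (- (dotv x x / (8 * l))).
Proof.
move=> l0; rewrite /heat.
have -> : 4 * pi * (2 * l) = 2 * (4 * pi * l) :> R by ring.
rewrite [Num.sqrt (2 * _)]sqrtrM// exprMn.
have s20 : Num.sqrt 2 ^+ n != 0 :> R by rewrite expf_neq0// gt_eqF// sqrtr_gt0.
have -> : expR (- dotv x x / (4 * l)) =
    expR (- dotv x x / (4 * (2 * l))) * expR (- (dotv x x / (8 * l))).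
  by rewrite -expRD; congr expR; field; lra.
by rewrite [(_ ^+ n * _ ^+ n)^-1]invfM -!mulrA mulVKf.
Qed.

Lemma heat_poly_bound k l x : 0 < l ->
  dotv x x ^+ k * heat l x <= k`!%:R * (8 * l) ^+ k * Num.sqrt 2 ^+ n * heat (2 * l) x.
Proof.
move=> l0; have l80 : 0 < 8 * l by rewrite mulr_gt0.
have y0 : 0 <= dotv x x / (8 * l) by rewrite divr_ge0 ?dotv_ge0// ltW.
have -> : dotv x x ^+ k * heat l x = (8 * l) ^+ k * (Num.sqrt 2 ^+ n * heat (2 * l) x) *
    ((dotv x x / (8 * l)) ^+ k * expR (- (dotv x x / (8 * l)))).
  rewrite heat_split// expr_div_n.
  have L0 : (8 * l) ^+ k != 0 by rewrite expf_neq0// gt_eqF.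
  have aux (r A H E L : R) : L != 0 -> r * (A * H * E) = L * (A * H) * (r / L * E).
    by move=> ?; field.
  exact: aux.
have := pow_expRN k y0.
set K := (X in X * _ <= _); set Ex := expR _ => h.
rewrite (_ : _ * _ * Num.sqrt 2 ^+ n * _ = (8 * l) ^+ k * (Num.sqrt 2 ^+ n * heat (2 * l) x) * k`!%:R); last by ring.
apply: ler_wpM2l => //.
by rewrite mulr_ge0 ?exprn_ge0 ?mulr_ge0 ?exprn_ge0 ?sqrtr_ge0 ?heat_ge0// ltW.
Qed.

Lemma gauss_shift c x v t : 0 < c -> `|t| <= 1 ->
  expR (- dotv (x + t *: v) (x + t *: v) / c) <=
  expR (dotv v v / c) * expR (- dotv x x / (2 * c)).
Proof.
move=> c0 t1; rewrite -expRD ler_expR.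
have := dotv_shift_ge x v t1.
have -> : dotv v v / c + - dotv x x / (2 * c) = - (dotv x x / 2 - dotv v v) / c.
  by field; lra.
by move=> h; rewrite ler_pM2r ?invr_gt0// lerN2.
Qed.

Lemma Rint_dirder0_gauss (F dF : Rn R n -> R) v (C c : R) : 0 < c ->
  (forall x : 'rV[R]_n, is_derive (0:R) 1 (fun t : R => F (x + t *: v)) (dF x)) ->
  measurable_fun setT F -> measurable_fun setT dF ->
  (forall x, `|F x| <= C * expR (- dotv x x / c)) ->
  (forall x, `|dF x| <= C * expR (- dotv x x / c)) ->
  \int[mu]_x dF x = 0.
Proof.
move=> c0 dFE mF mdF Fb dFb.
have C0 : 0 <= C.
  have := le_trans (normr_ge0 _) (Fb 0).
  by rewrite pmulr_lge0// expR_gt0.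
apply: (Rint_dirder0 mu_leb dFE _ mdF
  (G := fun x : Rn R n => C * expR (dotv v v / c) * expR (- dotv x x / (2 * c)))).
- apply: (L1_le (g := fun x : Rn R n => C * expR (- dotv x x / c))) => //.
    by move=> x; rewrite (le_trans (Fb x))// ler_norm.
  by apply: L1Z; exact: gauss_L1.
- by apply: L1Z; apply: gauss_L1; rewrite mulr_gt0.
- move=> x t t1; rewrite (le_trans (dFb _))// -mulrA ler_wpM2l//.
  exact: gauss_shift.
Qed.

Lemma dline x v (t : R) : is_derive t 1 (fun u : R => dotv (x + u *: v) (x + u *: v))
   (2 * dotv (x + t *: v) v).
Proof.
rewrite (_ : (fun u : R => _) = (fun u : R => dotv x x + (2 * dotv x v) * u + dotv v v * (u * u))).
  apply: (deq (dadd (dadd (dcst t _) (dmul (dcst t _) (did t)))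
    (dmul (dcst t _) (dmul (did t) (did t))))).
  by rewrite dotvDl dotvZl; ring.
by apply/funext => u; rewrite dotv_line; ring.
Qed.

Lemma dline1 x v y (t : R) : is_derive t 1 (fun u : R => dotv (x + u *: v) y) (dotv v y).
Proof.
rewrite (_ : (fun u : R => _) = (fun u : R => dotv x y + dotv v y * u)).
  by apply: (deq (dadd (dcst t _) (dmul (dcst t _) (did t)))); ring.
by apply/funext => u; rewrite dotvDl dotvZl mulrC.
Qed.

Lemma cos_dot_measurable xi : measurable_fun setT (fun x : Rn R n => cos (2 * pi * dotv x xi)).
Proof.
apply: (@measurableT_comp _ _ _ _ _ _ cos).
  by apply: continuous_measurable_fun; exact: continuous_cos.
by apply: measurable_funM => //; exact: dotv_measurable.
Qed.

Lemma sin_dot_measurable xi : measurable_fun setT (fun x : Rn R n => sin (2 * pi * dotv x xi)).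
Proof.
apply: (@measurableT_comp _ _ _ _ _ _ sin).
  by apply: continuous_measurable_fun; exact: continuous_sin.
by apply: measurable_funM => //; exact: dotv_measurable.
Qed.

Lemma L1_cos (f : 'rV[R]_n -> R) xi : L1 mu f ->
  L1 mu (fun x => f x * cos (2 * pi * dotv x xi)).
Proof.
by move=> fi; apply: (L1M fi (cos_dot_measurable xi)) => x; exact: cos_max.
Qed.

Lemma L1_sin (f : 'rV[R]_n -> R) xi : L1 mu f ->
  L1 mu (fun x => f x * sin (2 * pi * dotv x xi)).
Proof.
by move=> fi; apply: (L1M fi (sin_dot_measurable xi)) => x; exact: sin_max.
Qed.

(** Along the ray t xi the transform [G] solves G' = - 8 pi^2 l t |xi|^2 G with G(0) = 1. Hence G(t)
    exp(A t^2), with A = 4 pi^2 l |xi|^2, is constant, and t = 1 gives the formula. *)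
Lemma ct_heat l xi : 0 < l -> ct mu (heat l) xi = expR (- (l * lapsym xi)).
Proof.
move=> l0; have l40 : 0 < 4 * l by rewrite mulr_gt0.
have pi20 : 0 <= 2 * pi :> R by rewrite mulr_ge0// pi_ge0.
pose f (t : R) (x : Rn R n) := heat l x * cos (2 * pi * dotv x (t *: xi)).
pose df (t : R) (x : Rn R n) := - (2 * pi) * (heat l x * (dotv x xi * sin (2 * pi * dotv x (t *: xi)))).
pose dom (x : Rn R n) := 2 * pi * ((8 * l * Num.sqrt 2 ^+ n) * heat (2 * l) x + dotv xi xi * heat l x).
have dotb (x : 'rV[R]_n) : heat l x * `|dotv x xi| <=
    (8 * l * Num.sqrt 2 ^+ n) * heat (2 * l) x + dotv xi xi * heat l x.
  have := heat_poly_bound 1 x l0; rewrite mul1r !expr1 => h.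
  apply: le_trans (_ : heat l x * (dotv x x + dotv xi xi) <= _).
    rewrite ler_wpM2l ?heat_ge0// (le_trans (dotv_le _ _))//.
    by have := dotv_ge0 x; have := dotv_ge0 xi; lra.
  by rewrite mulrDr [heat l x * dotv x x]mulrC [heat l x * dotv xi xi]mulrC lerD2r.
have domi : L1 mu dom.
  apply: L1Z; apply: L1D; apply: L1Z; apply: heat_L1 => //.
  by rewrite mulr_gt0.
have dfdom t x : `|df t x| <= dom x.
  rewrite /df /dom normrM normrN (ger0_norm pi20) ler_wpM2l//.
  rewrite normrM (ger0_norm (heat_ge0 l x)) normrM (le_trans _ (dotb x))//.
  rewrite ler_wpM2l ?heat_ge0// -[leRHS]mulr1 ler_wpM2l ?normr_ge0//.
  exact: sin_max.
have dfE t x : is_derive t 1 (f ^~ x) (df t x).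
  have -> : f ^~ x = fun u => heat l x * cos (2 * pi * (u * dotv x xi)).
    by apply/funext => u; rewrite /f dotvZr.
  apply: (deq (dmul (dcst t _) (dcos (dmul (dcst t _) (dmul (did t) (dcst t _)))))).
  by rewrite /df dotvZr; ring.
have fi t : L1 mu (f t) by apply: L1_cos; exact: heat_L1.
pose G t := \int[mu]_x f t x.
pose D t := - (8 * pi ^+ 2 * l * t * dotv xi xi) * G t.
have mdx : measurable_fun setT (fun x : Rn R n => dotv x xi) by exact: dotv_measurable.
(* Integration by parts along [xi] turns the derivative in [t] back into [G]. *)
have GE t : is_derive t 1 G (D t).
  have := @is_derive_Rint _ _ _ mu f df dom t dfE fi domi dfdom.
  rewrite -/G; congr (is_derive _ _ _ _).
  (* [dF] is the derivative along [xi] of [F0], the heat kernel times a sine, so its integral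
     vanishes. *)
  pose dF (x : Rn R n) := (4 * pi * l)^-1 * df t x + 2 * pi * t * dotv xi xi * f t x.
  have pl0 : 0 < 4 * pi * l by rewrite !mulr_gt0// pi_gt0.
  have mdf : measurable_fun setT (df t).
    apply: measurable_funM => //; apply: measurable_funM; first exact: heat_measurable.
    by apply: measurable_funM => //; exact: sin_dot_measurable.
  have dfi : L1 mu (df t).
    apply: (L1_le mdf _ domi) => x.
    by rewrite (le_trans (dfdom t x))// ler_norm.
  suff : \int[mu]_x dF x = 0.
    rewrite RintDT; [|exact: L1Z|by apply: L1Z; exact: fi].
    rewrite (RintZT _ dfi) (RintZT _ (fi t)) -/(G t) => E.
    apply/eqP; rewrite /D -subr_eq0; apply/eqP.
    transitivity (4 * pi * l * ((4 * pi * l)^-1 * (\int[mu]_x df t x) +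
       2 * pi * t * dotv xi xi * G t)); last by rewrite E mulr0.
    by rewrite mulrDr mulVKf ?gt_eqF// mulNr opprK; congr (_ + _); ring.
  pose c0 : R := (Num.sqrt (4 * pi * l)) ^- n.
  have c00 : 0 <= c0 by rewrite invr_ge0 exprn_ge0// sqrtr_ge0.
  pose C := (8 * l + dotv xi xi) / (4 * l) + `|2 * pi * t * dotv xi xi|.
  have C1 : 1 <= C.
    have -> : C = 2 + (dotv xi xi / (4 * l) + `|2 * pi * t * dotv xi xi|).
      by rewrite /C mulrDl addrA; congr (_ + _ + _); field; lra.
    apply: le_trans (_ : 2 <= _); first by rewrite ler1n.
    by rewrite lerDl addr_ge0// divr_ge0 ?dotv_ge0// ltW.
  have heb (x : 'rV[R]_n) : heat l x <= c0 * expR (- dotv x x / (8 * l)).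
    rewrite ler_wpM2l// ler_expR ler_wnM2l ?oppr_le0 ?dotv_ge0// lef_pV2 ?posrE//; lra.
  have hxb (x : 'rV[R]_n) : dotv x x * heat l x <= 8 * l * (c0 * expR (- dotv x x / (8 * l))).
    have y0 : 0 <= dotv x x / (8 * l) by rewrite divr_ge0 ?dotv_ge0// mulr_ge0// ltW.
    have := pow_expRN 1 y0; rewrite expr1 => h.
    have -> : dotv x x * heat l x = 8 * l * (c0 * expR (- dotv x x / (8 * l))) *
        (dotv x x / (8 * l) * expR (- (dotv x x / (8 * l)))).
      rewrite /heat -/c0 (_ : - dotv x x / (4 * l) = - dotv x x / (8 * l) + - (dotv x x / (8 * l))); last by field; lra.
      by rewrite expRD; field; lra.
    rewrite -[leRHS]mulr1 ler_wpM2l// mulr_ge0 ?mulr_ge0 ?expR_ge0//; exact: ltW.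
  have fb (x : Rn R n) : `|f t x| <= heat l x.
    rewrite normrM (ger0_norm (heat_ge0 l x)) -[leRHS]mulr1 ler_wpM2l ?heat_ge0//.
    exact: cos_max.
  have dfb (x : Rn R n) : `|df t x| <= 2 * pi * (heat l x * ((dotv x x + dotv xi xi) / 2)).
    rewrite /df normrM normrN (ger0_norm pi20) ler_wpM2l// normrM (ger0_norm (heat_ge0 l x)) normrM.
    rewrite ler_wpM2l ?heat_ge0// -[leRHS]mulr1 ler_pM ?normr_ge0// ?dotv_le//.
    exact: sin_max.
  pose F0 (x : Rn R n) := heat l x * sin (2 * pi * dotv x (t *: xi)).
  have dF0 (x : 'rV[R]_n) : is_derive (0:R) 1 (fun u : R => F0 (x + u *: xi)) (dF x).
    apply: (deq (dmul (dmul (dcst 0 _) (dexp (dmul (dopp (dline x xi 0)) (dcst 0 _))))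
      (dsin (dmul (dcst 0 _) (dline1 x xi (t *: xi) 0))))).
    rewrite /dF /f /df /heat scale0r addr0 !dotvZr.
    have := lt0r_neq0 l0; have := lt0r_neq0 (pi_gt0 R).
    move: (cos _) (sin _) (expR _) (_ ^- n) => C2 S0 E K.
    move: (dotv x xi) (dotv x x) (dotv xi xi) (pi : R) => a d b q q0 ln0.
    by field; rewrite q0 ln0.
  apply: (Rint_dirder0_gauss (C := C * c0) (c := 8 * l) _ dF0).
  - by rewrite mulr_gt0.
  - by apply: measurable_funM; [exact: heat_measurable|exact: sin_dot_measurable].
  - apply: measurable_funD; apply: measurable_funM => //.
    by apply: measurable_funM; [exact: heat_measurable|exact: cos_dot_measurable].
  - move=> x; rewrite normrM (ger0_norm (heat_ge0 l x)).
    apply: le_trans (_ : heat l x <= _).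
      by rewrite -[leRHS]mulr1 ler_wpM2l ?heat_ge0//; exact: sin_max.
    by rewrite (le_trans (heb x))// -mulrA -[leLHS]mul1r ler_wpM2r// mulr_ge0// expR_ge0.
  - move=> x; rewrite (le_trans (ler_normD _ _))//.
    have -> : C * c0 * expR (- dotv x x / (8 * l)) =
      (8 * l * (c0 * expR (- dotv x x / (8 * l))) + dotv xi xi * (c0 * expR (- dotv x x / (8 * l)))) / (4 * l)
      + `|2 * pi * t * dotv xi xi| * (c0 * expR (- dotv x x / (8 * l))).
      by rewrite /C; field; lra.
    apply: lerD.
    + rewrite normrM ger0_norm ?invr_ge0 ?(ltW pl0)//.
      apply: le_trans (_ : (4 * pi * l)^-1 * (2 * pi * (heat l x * ((dotv x x + dotv xi xi) / 2))) <= _).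
        by rewrite ler_wpM2l ?invr_ge0 ?(ltW pl0).
      have -> : (4 * pi * l)^-1 * (2 * pi * (heat l x * ((dotv x x + dotv xi xi) / 2))) =
         (dotv x x * heat l x + dotv xi xi * heat l x) / (4 * l).
        by move: (pi : R) (lt0r_neq0 (pi_gt0 R)) (lt0r_neq0 l0) => q q0 ln0; field; rewrite q0 ln0.
      rewrite ler_wpM2r ?invr_ge0 ?(ltW l40)// lerD// ler_wpM2l ?dotv_ge0//.
    + rewrite normrM ler_wpM2l ?normr_ge0//.
      by rewrite (le_trans (fb x)).
pose A := 4 * pi ^+ 2 * l * dotv xi xi.
pose H t := G t * expR (A * (t * t)).
have dH t : is_derive t 1 H 0.
  apply: (deq (dmul (GE t) (dexp (dmul (dcst t _) (dmul (did t) (did t)))))).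
  by rewrite /D /A; ring.
have : H 1 = H 0 by exact: is_derive_0_is_cst.
have G0 : G 0 = 1.
  rewrite -(Rint_heat mu_leb l0); apply: eq_RintegralT => x.
  by rewrite /f scale0r dotvC -(scale0r (0:'rV[R]_n)) dotvZl mul0r mulr0 cos0 mulr1.
rewrite /H G0 !mulr0 mul1r expR0 !mulr1 => E.
have -> : ct mu (heat l) xi = G 1.
  by apply: eq_RintegralT => x; rewrite /f scale1r.
rewrite expRN (_ : l * lapsym xi = A); last by rewrite /lapsym /A; ring.
by rewrite -[LHS](mulfK (lt0r_neq0 (expR_gt0 A))) E mul1r.
Qed.

End gaussian.

(** * Convolution *)

Section convolution.
Context (R : realType) (n : nat).
Variable mu : {sigma_finite_measure set (Rn R n) -> \bar R}.
Hypothesis mu_leb : is_lebesgue mu.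
Implicit Types (x y xi : 'rV[R]_n) (k v w f g : 'rV[R]_n -> R).

Notation even f := (forall x : 'rV[R]_n, f (- x) = f x).

Lemma Rint_shift f y : measurable_fun setT (f : Rn R n -> R) ->
  \int[mu]_x f (x - y) = \int[mu]_x f x.
Proof. by move=> mf; exact: (Rint_translation mu_leb (- y) mf). Qed.

Lemma Rint_flip f x : measurable_fun setT (f : Rn R n -> R) ->
  \int[mu]_y f (x - y) = \int[mu]_y f y.
Proof.
move=> mf; rewrite -(Rint_reflection mu_leb mf).
have mf' : measurable_fun setT (fun y : Rn R n => f (- (y : 'rV[R]_n))).
  exact: (measurableT_comp mf (@opp_Rn_measurable R n)).
rewrite -(Rint_translation mu_leb (- x) mf').
by apply: eq_RintegralT => y; rewrite opprD opprK addrC.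
Qed.

Lemma measurable_shift f y : measurable_fun setT (f : Rn R n -> R) ->
  measurable_fun setT (fun x : Rn R n => f ((x : 'rV[R]_n) - y)).
Proof. by move=> mf; exact: (measurableT_comp mf (@add_Rn_measurable R n (- y))). Qed.

Lemma measurable_flip f x : measurable_fun setT (f : Rn R n -> R) ->
  measurable_fun setT (fun y : Rn R n => f (x - (y : 'rV[R]_n))).
Proof.
move=> mf.
have mf' : measurable_fun setT (fun y : Rn R n => f (- (y : 'rV[R]_n))).
  exact: (measurableT_comp mf (@opp_Rn_measurable R n)).
have := measurableT_comp mf' (@add_Rn_measurable R n (- x)).
by apply: eq_measurable_fun => y _ /=; rewrite opprD opprK addrC.
Qed.

Lemma ge0_int_shift f y : measurable_fun setT (f : Rn R n -> R) ->
  (\int[mu]_x `|f (x - y)%R|%:E = \int[mu]_x `|f x|%:E)%E.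
Proof.
move=> mf; apply: (@ge0_integral_translation _ _ _ mu_leb (fun x => `|f x|%:E) (- y)) => //.
by apply/measurable_EFinP/measurableT_comp.
Qed.

Lemma ge0_int_flip f x : measurable_fun setT (f : Rn R n -> R) ->
  (\int[mu]_y `|f (x - y)%R|%:E = \int[mu]_y `|f y|%:E)%E.
Proof.
move=> mf.
have mf' : measurable_fun setT (fun y : Rn R n => f (- (y : 'rV[R]_n))).
  exact: (measurableT_comp mf (@opp_Rn_measurable R n)).
rewrite -(@ge0_integral_reflection _ _ _ mu_leb (fun y => `|f y|%:E)) => //; last first.
  by apply/measurable_EFinP/measurableT_comp.
rewrite -(ge0_int_shift x mf').
by apply: eq_integral => y _; rewrite opprB.
Qed.

Lemma L1_flip f x : L1 mu f -> L1 mu (fun y : Rn R n => f (x - (y : 'rV[R]_n))).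
Proof.
move=> fi; have mf := L1_measurable fi; apply: L1I; first exact: measurable_flip.
by rewrite ge0_int_flip//; exact: L1_lty.
Qed.

Lemma kernel_measurable k : measurable_fun setT (k : Rn R n -> R) ->
  measurable_fun setT (fun z : Rn R n * Rn R n => k ((z.1 : 'rV[R]_n) - z.2)).
Proof. exact: measurable_fun_sub. Qed.

Lemma fst_measurable v : measurable_fun setT (v : Rn R n -> R) ->
  measurable_fun setT (fun z : Rn R n * Rn R n => v z.1).
Proof. by move=> mv; exact: (measurableT_comp mv measurable_fst). Qed.

Lemma snd_measurable v : measurable_fun setT (v : Rn R n -> R) ->
  measurable_fun setT (fun z : Rn R n * Rn R n => v z.2).
Proof. by move=> mv; exact: (measurableT_comp mv measurable_snd). Qed.

Lemma kernel_L1_snd k v : L1 mu k -> L1 mu v ->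
  L1 (mu \x mu)%E (fun z : Rn R n * Rn R n => k ((z.1 : 'rV[R]_n) - z.2) * v z.2).
Proof.
move=> ki vi; have mk := L1_measurable ki; have mv := L1_measurable vi.
apply: prod_L1P2.
  by apply: measurable_funM; [exact: kernel_measurable|exact: snd_measurable].
have -> : (fun y : Rn R n => \int[mu]_x `|k ((x, y).1 - (x, y).2) * v (x, y).2|%:E)%E =
    (fun y : Rn R n => (\int[mu]_x `|k x|%:E) * `|v y|%:E)%E.
  apply/funext => y /=.
  under eq_integral do rewrite normrM EFinM.
  rewrite ge0_integralZr//; first by rewrite ge0_int_shift.
  by apply/measurable_EFinP/measurableT_comp => //; exact: measurable_shift.
rewrite ge0_integralZl//.
- by rewrite lte_mul_pinfty//; [exact: integral_ge0|rewrite ge0_fin_numE ?integral_ge0//; exact: L1_lty|exact: L1_lty].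
- by apply/measurable_EFinP/measurableT_comp.
- exact: integral_ge0.
Qed.

Lemma kernel_L1_fst k v : L1 mu k -> L1 mu v ->
  L1 (mu \x mu)%E (fun z : Rn R n * Rn R n => k ((z.1 : 'rV[R]_n) - z.2) * v z.1).
Proof.
move=> ki vi; have mk := L1_measurable ki; have mv := L1_measurable vi.
apply: prod_L1P1.
  by apply: measurable_funM; [exact: kernel_measurable|exact: fst_measurable].
have -> : (fun x : Rn R n => \int[mu]_y `|k ((x, y).1 - (x, y).2) * v (x, y).1|%:E)%E =
    (fun x : Rn R n => (\int[mu]_x `|k x|%:E) * `|v x|%:E)%E.
  apply/funext => x /=.
  under eq_integral do rewrite normrM EFinM.
  rewrite ge0_integralZr//; first by rewrite ge0_int_flip.
  by apply/measurable_EFinP/measurableT_comp => //; exact: measurable_flip.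
rewrite ge0_integralZl//.
- by rewrite lte_mul_pinfty//; [exact: integral_ge0|rewrite ge0_fin_numE ?integral_ge0//; exact: L1_lty|exact: L1_lty].
- by apply/measurable_EFinP/measurableT_comp.
- exact: integral_ge0.
Qed.

Lemma conv_measurable k v : measurable_fun setT (k : Rn R n -> R) ->
  measurable_fun setT (v : Rn R n -> R) -> measurable_fun setT (conv mu k v : Rn R n -> R).
Proof.
move=> mk mv; apply: (@measurable_Rint_snd _ _ _ _ _ mu
  (fun z : Rn R n * Rn R n => k ((z.1 : 'rV[R]_n) - z.2) * v z.2)).
by apply: measurable_funM; [exact: kernel_measurable|exact: snd_measurable].
Qed.

Lemma conv_L1 k v : L1 mu k -> L1 mu v -> L1 mu (conv mu k v).
Proof. by move=> ki vi; exact: (prod_L1_fst (kernel_L1_snd ki vi)). Qed.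

Lemma even_st0 f xi : even f -> L1 mu f -> st mu f xi = 0.
Proof.
move=> ef fi; have mfs := L1_measurable (L1_sin xi fi).
have := Rint_reflection mu_leb mfs.
rewrite (_ : \int[mu]_x _ = (-1) * st mu f xi); last first.
  rewrite /st -RintZT; last exact: L1_sin.
  by apply: eq_RintegralT => x; rewrite ef dotvNl mulrN sinN mulrN mulN1r.
by rewrite mulN1r -/(st mu f xi) => h; lra.
Qed.

Let phase_L1 k v (c : Rn R n -> R) : L1 mu k -> L1 mu v -> measurable_fun setT c ->
  (forall x, `|c x| <= 1) ->
  L1 (mu \x mu)%E (fun z : Rn R n * Rn R n => k ((z.1 : 'rV[R]_n) - z.2) * v z.2 * c z.1).
Proof.
move=> ki vi mc c1; apply: (L1M (kernel_L1_snd ki vi) (fst_measurable mc)) => z.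
exact: c1.
Qed.

Lemma ct_shift k y xi : L1 mu k ->
  \int[mu]_x (k (x - y) * cos (2 * pi * dotv x xi)) =
  cos (2 * pi * dotv y xi) * ct mu k xi - sin (2 * pi * dotv y xi) * st mu k xi.
Proof.
move=> ki; have mk := L1_measurable ki.
have L1c := L1_cos xi ki; have L1s := L1_sin xi ki.
rewrite /ct /st -!RintZT// -RintBT; [|exact: L1Z|exact: L1Z].
rewrite -(Rint_translation mu_leb y); last first.
  by apply: measurable_funM; [exact: measurable_shift|exact: cos_dot_measurable].
apply: eq_RintegralT => x; rewrite addrK dotvDl mulrDr cosD; ring.
Qed.

Lemma st_shift k y xi : L1 mu k ->
  \int[mu]_x (k (x - y) * sin (2 * pi * dotv x xi)) =
  cos (2 * pi * dotv y xi) * st mu k xi + sin (2 * pi * dotv y xi) * ct mu k xi.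
Proof.
move=> ki; have mk := L1_measurable ki.
have L1c := L1_cos xi ki; have L1s := L1_sin xi ki.
rewrite /ct /st -!RintZT// -RintDT; [|exact: L1Z|exact: L1Z].
rewrite -(Rint_translation mu_leb y); last first.
  by apply: measurable_funM; [exact: measurable_shift|exact: sin_dot_measurable].
apply: eq_RintegralT => x; rewrite addrK dotvDl mulrDr sinD; ring.
Qed.

(** Fubini and the addition formula give ct k ct v - st k st v; evenness of [v] removes the second
    product. *)
Lemma ct_conv k v xi : even v -> L1 mu k -> L1 mu v ->
  ct mu (conv mu k v) xi = ct mu k xi * ct mu v xi.
Proof.
move=> ev ki vi; have mk := L1_measurable ki; have mv := L1_measurable vi.
have Fi := phase_L1 ki vi (@cos_dot_measurable R n xi) (fun x => cos_max _).
have st0 := even_st0 xi ev vi.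
transitivity (\int[mu]_x \int[mu]_y (k (x - y) * v y * cos (2 * pi * dotv x xi))).
  apply: ae_eq_RintT.
  - apply: measurable_funM; [exact: conv_measurable|exact: cos_dot_measurable].
  - apply: (@measurable_Rint_snd _ _ _ _ _ mu
      (fun z : Rn R n * Rn R n => k ((z.1 : 'rV[R]_n) - z.2) * v z.2 * cos (2 * pi * dotv z.1 xi))).
    exact: L1_measurable Fi.
  - apply: filterS (ae_integrable1 (kernel_L1_snd ki vi)) => x h _.
    by rewrite RintegralZr.
have -> := Rfubini Fi.
transitivity (\int[mu]_y (ct mu k xi * (v y * cos (2 * pi * dotv y xi)) -
    st mu k xi * (v y * sin (2 * pi * dotv y xi)))).
  apply: eq_RintegralT => y /=.
  transitivity (\int[mu]_x (v y * (k (x - y) * cos (2 * pi * dotv x xi)))).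
    by apply: eq_RintegralT => x; ring.
  rewrite RintZT; last first.
    by apply: L1_cos; exact: (L1_translation mu_leb (- y) ki).
  by rewrite ct_shift//; ring.
rewrite RintBT; [|exact/L1Z/L1_cos|exact/L1Z/L1_sin].
rewrite !RintZT; [|exact: L1_sin|exact: L1_cos].
by rewrite -/(st mu v xi) st0 mulr0 subr0.
Qed.

Lemma conv_even k v : even k -> even v -> measurable_fun setT (k : Rn R n -> R) ->
  measurable_fun setT (v : Rn R n -> R) -> even (conv mu k v).
Proof.
move=> ek ev mk mv x.
have mF : measurable_fun setT (fun y : Rn R n => k (x - (y : 'rV[R]_n)) * v y).
  by apply: measurable_funM => //; exact: measurable_flip.
rewrite /conv -[RHS](Rint_reflection mu_leb mF).
by apply: eq_RintegralT => y; rewrite ev -ek; congr (k _ * _); rewrite opprD !opprK.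
Qed.

Lemma norm_conv_le k v (M : R) : L1 mu k -> measurable_fun setT (v : Rn R n -> R) ->
  (forall x, `|v x| <= M) -> forall x, `|conv mu k v x| <= M * \int[mu]_x `|k x|.
Proof.
move=> ki mv vM x; have kf := L1_flip x ki.
have kn : L1 mu (fun y : Rn R n => `|k (x - (y : 'rV[R]_n))|) by exact: L1_norm.
have -> : M * \int[mu]_x `|k x| = \int[mu]_y (M * `|k (x - y)|).
  rewrite RintZT//; congr (_ * _).
  have mnk : measurable_fun setT (fun y : Rn R n => `|k y|).
    exact: (L1_measurable (L1_norm ki)).
  by rewrite (Rint_flip x mnk).
apply: norm_Rint_le; [exact: (L1M kf mv vM)|exact: L1Z|].
by move=> y; rewrite normrM mulrC ler_wpM2r.
Qed.

End convolution.

(** * Young's inequality and duality for convolutions *)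

Section young.
Context (R : realType) (n : nat).
Variable mu : {sigma_finite_measure set (Rn R n) -> \bar R}.
Hypothesis mu_leb : is_lebesgue mu.
Implicit Types (x y xi : 'rV[R]_n) (k v w f g : 'rV[R]_n -> R) (p : R).

Notation even f := (forall x : 'rV[R]_n, f (- x) = f x).

Lemma powR_measurable p v : measurable_fun setT (v : Rn R n -> R) ->
  measurable_fun setT (fun x : Rn R n => `|v x| `^ p).
Proof.
move=> mv; apply: (@measurableT_comp _ _ _ _ _ _ (fun t : R => t `^ p)).
  exact: measurable_powR.
exact: measurableT_comp.
Qed.

Lemma le_1powR p (t : R) : 1 <= p -> 0 <= t -> t <= 1 + t `^ p.
Proof.
move=> p1 t0; have [t1|t1] := leP t 1; first by rewrite (le_trans t1)// lerDl powR_ge0.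
apply: le_trans (_ : t `^ p <= _); last by rewrite lerDr.
by rewrite -[leLHS]powRr1// ler_powR// ltW.
Qed.

(** For t > c it says t^(1 - p) <= c^(1 - p). Integrated against |k| and optimised in the free
    parameter [c], it takes the place of Hölder's inequality. *)
Lemma le_young p (t c : R) : 1 <= p -> 0 <= t -> 0 < c -> t <= t `^ p * c `^ (1 - p) + c.
Proof.
move=> p1 t0 c0; have [tc|ct] := leP t c.
  by rewrite (le_trans tc)// lerDr mulr_ge0 ?powR_ge0.
have t00 : 0 < t by exact: lt_trans c0 ct.
apply: le_trans (_ : t `^ p * c `^ (1 - p) <= _); last by rewrite lerDl ltW.
have tE : t = t `^ p * t `^ (1 - p).
  by rewrite -powRD ?subrKC ?powRr1 ?ltW//; apply/implyP => _; rewrite gt_eqF.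
rewrite {1}tE ler_wpM2l ?powR_ge0// -opprB !powRN lef_pV2 ?posrE ?powR_gt0//.
by apply: ge0_ler_powR; rewrite ?nnegrE ?subr_ge0//; exact: ltW.
Qed.

Section kernel.
Variables (p : R) (k v : 'rV[R]_n -> R).
Hypotheses (p1 : 1 <= p) (ki : L1 mu k) (mv : measurable_fun setT (v : Rn R n -> R)).
Hypothesis vp : L1 mu (fun x => `|v x| `^ p).

Let I x : R := \int[mu]_y (`|k (x - y)| * `|v y| `^ p).

Lemma conv_ae_L1 : {ae mu, forall x : Rn R n,
  L1 mu (fun y : Rn R n => k ((x : 'rV[R]_n) - y) * v y) /\
  L1 mu (fun y : Rn R n => `|k ((x : 'rV[R]_n) - y)| * `|v y| `^ p)}.
Proof.
have kn := L1_norm ki; have mk := L1_measurable ki.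
apply: filterS (ae_integrable1 (kernel_L1_snd mu_leb kn vp)) => x h.
split; last exact: h.
apply: (L1_le (g := fun y : Rn R n => `|k ((x : 'rV[R]_n) - y)| + `|k ((x : 'rV[R]_n) - y)| * `|v y| `^ p)).
- by apply: measurable_funM => //; exact: measurable_flip.
- move=> y; rewrite normrM.
  apply: le_trans (_ : `|k (x - y)| * (1 + `|v y| `^ p) <= _).
    by rewrite ler_wpM2l// le_1powR.
  by rewrite mulrDr mulr1 ler_norm.
- by apply: L1D => //; exact: (L1_flip mu_leb x kn).
Qed.

Let A := \int[mu]_x `|k x|.

(** By [le_young], |k * v| is at most I c^(1 - p) + A c for every c > 0; the choice c = I^(1/p)
    turns this into (1 + A) I^(1/p). *)
Let conv_point x : L1 mu (fun y : Rn R n => k ((x : 'rV[R]_n) - y) * v y) ->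
  L1 mu (fun y : Rn R n => `|k ((x : 'rV[R]_n) - y)| * `|v y| `^ p) ->
  `|conv mu k v x| `^ p <= (1 + A) `^ p * I x.
Proof.
move=> h1 h2; have kn := L1_norm ki.
have p0 : p != 0 by rewrite gt_eqF// (lt_le_trans ltr01).
have A0 : 0 <= A by apply: Rintegral_ge0.
have I0 : 0 <= I x by apply: Rintegral_ge0 => y _; rewrite mulr_ge0// powR_ge0.
have key c : 0 < c -> `|conv mu k v x| <= I x * c `^ (1 - p) + c * A.
  move=> c0.
  have -> : I x * c `^ (1 - p) + c * A = \int[mu]_y (c `^ (1 - p) *
      (`|k (x - y)| * `|v y| `^ p) + c * `|k (x - y)|).
    rewrite RintDT; [|exact: L1Z|exact/L1Z/(L1_flip mu_leb x kn)].
    rewrite !RintZT//; [|exact: (L1_flip mu_leb x kn)].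
    by rewrite mulrC (Rint_flip mu_leb x (L1_measurable kn)).
  apply: norm_Rint_le => //.
    by apply: L1D; apply: L1Z => //; exact: (L1_flip mu_leb x kn).
  move=> y; rewrite normrM.
  apply: le_trans (_ : `|k (x - y)| * (`|v y| `^ p * c `^ (1 - p) + c) <= _).
    by rewrite ler_wpM2l// le_young.
  by rewrite le_eqVlt; apply/orP; left; apply/eqP; ring.
(* For I = 0 the optimal [c] would not be positive; arbitrarily small values of [c] show that the
   convolution vanishes. *)
have [I00|I00] := eqVneq (I x) 0.
  rewrite I00 mulr0.
  suff -> : conv mu k v x = 0 by rewrite normr0 powR0.
  apply/eqP; rewrite -normr_le0; apply/ler_addgt0Pr => e e0.
  have A10 : 0 < 1 + A by rewrite ltr_wpDr.
  have := key (e / (1 + A)) (divr_gt0 e0 A10).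
  rewrite I00 mul0r !add0r => h; rewrite (le_trans h)//.
  by rewrite mulrAC ler_pdivrMr// ler_wpM2l ?ltW// ltrDr.
have Ip : 0 < I x by rewrite lt_neqAle eq_sym I00.
have c0 : 0 < I x `^ p^-1 by rewrite powR_gt0.
have := key _ c0.
have -> : I x * (I x `^ p^-1) `^ (1 - p) = I x `^ p^-1.
  rewrite -{1}[I x]powRr1 ?ltW// -powRrM -powRD; last by rewrite I00 implybT.
  by congr (_ `^ _); field.
rewrite -{1}[I x `^ _]mulr1 -mulrDr => h.
have -> : (1 + A) `^ p * I x = (I x `^ p^-1 * (1 + A)) `^ p.
  by rewrite powRM ?powR_ge0 ?addr_ge0// -powRrM mulVf// powRr1 ?ltW// mulrC.
by apply: ge0_ler_powR; rewrite ?nnegrE ?mulr_ge0 ?powR_ge0 ?addr_ge0// (le_trans _ p1).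
Qed.

(** Integrating the pointwise bound gives the factor (1 + A)^p A in place of the sharp A^p, enough
    for a constant whose value is left open. *)
Lemma young : L1 mu (fun x => `|conv mu k v x| `^ p) /\
  \int[mu]_x (`|conv mu k v x| `^ p) <=
  (1 + \int[mu]_x `|k x|) `^ p * \int[mu]_x `|k x| * \int[mu]_x (`|v x| `^ p).
Proof.
have kn := L1_norm ki; have mk := L1_measurable ki.
have A0 : 0 <= A by apply: Rintegral_ge0.
have KL := kernel_L1_snd mu_leb kn vp.
have IL1 : L1 mu I := prod_L1_fst KL.
have EI : \int[mu]_x I x = A * \int[mu]_x (`|v x| `^ p).
  rewrite /I (Rfubini KL) -RintZT//; apply: eq_RintegralT => y /=.
  have ks : L1 mu (fun x : Rn R n => `|k ((x : 'rV[R]_n) - y)|).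
    exact: (L1_translation mu_leb (- y) kn).
  transitivity (\int[mu]_x (`|v y| `^ p * `|k (x - y)|)).
    by apply: eq_RintegralT => x; rewrite mulrC.
  by rewrite RintZT// (Rint_shift mu_leb y (L1_measurable kn)) mulrC.
rewrite -mulrA -EI -RintZT//.
apply: ge0_ae_le_Rint.
- by apply: powR_measurable; exact: conv_measurable.
- by move=> x; exact: powR_ge0.
- by apply: filterS conv_ae_L1 => x [h1 h2]; exact: conv_point.
- exact: L1Z.
Qed.

(* [|v w| <= (1 + |v|^p) |w|] makes the double integrand integrable. *)
Lemma conv_duality w (M : R) : even k -> L1 mu w -> (forall x, `|w x| <= M) ->
  \int[mu]_x (conv mu k v x * w x) = \int[mu]_x (v x * conv mu k w x).
Proof.
move=> ek wi wM; have kn := L1_norm ki; have mk := L1_measurable ki.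
have mw := L1_measurable wi.
pose F (z : Rn R n * Rn R n) := k ((z.1 : 'rV[R]_n) - z.2) * v z.2 * w z.1.
have mF : measurable_fun setT F.
  apply: measurable_funM; last exact: fst_measurable.
  by apply: measurable_funM; [exact: kernel_measurable|exact: snd_measurable].
have Fi : L1 (mu \x mu)%E F.
  have h1 := kernel_L1_fst mu_leb kn (L1_norm wi).
  have h2 := kernel_L1_snd mu_leb kn vp.
  apply: (L1_le mF _ (L1D h1 (L1Z M h2))) => z; rewrite /F !normrM.
  rewrite (le_trans _ (ler_norm _))//.
  apply: le_trans (_ : `|k ((z.1 : 'rV[R]_n) - z.2)| * (1 + `|v z.2| `^ p) * `|w z.1| <= _).
    by rewrite ler_wpM2r// ler_wpM2l// le_1powR.
  by rewrite mulrDr mulr1 mulrDl lerD2l mulrC ler_wpM2r// mulr_ge0// powR_ge0.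
have h := conv_ae_L1.
transitivity (\int[mu]_x \int[mu]_y F (x, y)).
  apply: ae_eq_RintT.
  - by apply: measurable_funM => //; exact: conv_measurable.
  - exact: measurable_Rint_snd.
  - by apply: filterS h => x [h1 _] _; rewrite /F /= RintegralZr.
rewrite (Rfubini Fi); apply: eq_RintegralT => y.
rewrite /conv -RintZT; last first.
  exact: (L1M (L1_flip mu_leb y ki) mw wM).
by apply: eq_RintegralT => x; rewrite /F /= -(ek (y - x)) opprB; ring.
Qed.

End kernel.

End young.

(** * Fourier inversion *)

Section boxes.
Context (R : realType) (n : nat).
Variable mu : {sigma_finite_measure set (Rn R n) -> \bar R}.
Hypothesis mu_leb : is_lebesgue mu.
Implicit Types (x y xi a b : 'rV[R]_n) (h : 'rV[R]_n -> R).

(** The Borel sets [A] such that [h] integrates to 0 over A intersected with Q form a Dynkin system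
    containing the boxes, hence are all Borel sets. *)
Let box_ae_eq0 h a b : mu.-integrable (hbox a b) (EFin \o h) ->
  (forall a' b', hbox a' b' `<=` hbox a b -> (\int[mu]_(x in hbox a' b') (h x)%:E = 0)%E) ->
  {ae mu, forall x : Rn R n, hbox a b x -> h x = 0}.
Proof.
set Q := hbox a b => hi h0.
have mQ : measurable Q by exact: hbox_measurable.
have key : forall A, measurable A -> (\int[mu]_(x in A `&` Q) (h x)%:E = 0)%E.
  move=> A mA; have : <<s @hboxes R n >> A by rewrite -Rn_measurableE.
  apply: (dynkin_induction (P := fun A => \int[mu]_(x in A `&` Q) (h x)%:E = 0)%E).
  - exact: Rn_measurableE.
  - exact: hboxes_setI_closed.
  - by rewrite setTI; exact: h0.
  - move=> B [a' [b' ->]].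
    have [a2 [b2 E]] : hboxes (hbox a' b' `&` Q).
      by apply: hboxes_setI_closed; do 2 eexists; reflexivity.
    by rewrite E; apply: h0; rewrite -E; exact: subIsetr.
  - move=> S mS S0.
    have mSQ : measurable (S `&` Q) by exact: measurableI.
    have mCQ : measurable (~` S `&` Q) by apply: measurableI => //; exact: measurableC.
    have QE : Q = (S `&` Q) `|` (~` S `&` Q) by rewrite -setIUl setUCr setTI.
    have : (\int[mu]_(x in Q) (h x)%:E = 0)%E by exact: h0.
    rewrite {1}QE integral_setU//.
    + by rewrite S0 add0e.
    + by rewrite -QE; exact: measurable_int hi.
    + apply/disj_set2P; rewrite setIACA setICr set0I//.
  - move=> F mF tF F0; rewrite setI_bigcupl.
    rewrite integral_bigcup//.
    + by rewrite eseries0.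
    + by apply: trivIset_setIr.
    + by move=> k; exact: measurableI.
    + apply: (integrableS mQ _ _ hi).
        by apply: bigcup_measurable => k _; exact: measurableI.
      by move=> x [k _ []].
have H : ae_eq mu Q (EFin \o h) (cst 0%E).
  apply: (integral_ae_eq mQ hi) => // E EQ mE.
  by rewrite integral0 -[RHS](key E mE) (setIidl EQ).
by apply: filterS H => x /= Hx Qx; have [] := Hx Qx.
Qed.

(** Countably many boxes cover [O], so their exceptional null sets add up to a null set. *)
Lemma ae_eq0_boxes h (O : set 'rV[R]_n) : open O ->
  (forall a b, hbox a b `<=` O -> mu.-integrable (hbox a b) (EFin \o h)) ->
  (forall a b, hbox a b `<=` O -> (\int[mu]_(x in hbox a b) (h x)%:E = 0)%E) ->
  {ae mu, forall x : Rn R n, O x -> h x = 0}.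
Proof.
move=> oO hi h0; have [q [P [PO OE]]] := open_hbox_cover oO.
have : {ae mu, forall x : Rn R n, forall k, P k -> hbox (q k).1 (q k).2 x -> h x = 0}.
  apply: ae_foralln => k.
  have [Pk|nPk] := pselect (P k); last by apply: aeW => x.
  have h0k a' b' : hbox a' b' `<=` hbox (q k).1 (q k).2 ->
      (\int[mu]_(x in hbox a' b') (h x)%:E = 0)%E.
    by move=> ab; apply: h0; apply: subset_trans ab (PO k Pk).
  by apply: filterS (box_ae_eq0 (hi _ _ (PO k Pk)) h0k) => x Hx _.
apply: filterS => x H Ox.
have [k Pk xk] : (\bigcup_(k in P) hbox (q k).1 (q k).2) x by rewrite -OE.
exact: H Pk xk.
Qed.

(** Inside a large cube the hyperplane is contained in a slab of thickness [d], of volume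
    [d * C]. *)
Lemma mu_face (i : 'I_n) (c : R) : mu [set x : Rn R n | x ord0 i = c] = 0%E.
Proof.
set S := [set x | _].
have mS : measurable S.
  have -> : S = (fun x : Rn R n => x ord0 i) @^-1` [set c] by [].
  by rewrite -[X in measurable X]setTI; exact: coord_measurable.
pose Qk (k : nat) := hbox (const_mx (- k%:R) : 'rV[R]_n) (const_mx k%:R).
have SE : S = \bigcup_k (S `&` Qk k).
  apply/seteqP; split => [x Sx|x [k _ []]//].
  exists (Num.truncn (\sum_j `|x ord0 j|)).+1 => //; split => // j; rewrite !mxE.
  have : `|x ord0 j| < (Num.truncn (\sum_j `|x ord0 j|)).+1%:R.
    rewrite (le_lt_trans _ (truncnS_gt _))//.
    by rewrite (bigD1 j) //= lerDl sumr_ge0.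
  by rewrite ltr_norml => /andP[/ltW -> ->].
have mQk k : measurable (S `&` Qk k) by apply: measurableI => //; exact: hbox_measurable.
apply/negligibleP => //; rewrite SE; apply: negligible_bigcup => k.
apply/negligibleP => //.
apply/eqP; rewrite -measure_le0; apply/lee_addgt0Pr => e e0; rewrite add0e.
pose C := \prod_(j < n | j != i) (k%:R - - k%:R : R).
have C0 : 0 <= C by apply: prodr_ge0 => j _; rewrite opprK addr_ge0.
(* Dividing by [1 + C] rather than [C] covers the degenerate cube, for which [C] may be 0. *)
pose d := e / (1 + C).
have d0 : 0 < d by rewrite divr_gt0// ltr_wpDr.
pose a : 'rV[R]_n := \row_j (if j == i then c else - k%:R).
pose b : 'rV[R]_n := \row_j (if j == i then c + d else k%:R).
apply: le_trans (_ : mu (hbox a b) <= _)%E.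
  apply: le_measure; rewrite ?inE//; first exact: hbox_measurable.
  move=> x [Sx Qx] j; rewrite !mxE; case: eqP => [->|_]; last by have := Qx j; rewrite !mxE.
  by rewrite Sx lexx ltrDl.
rewrite mu_leb; last first.
  by move=> j; rewrite !mxE; case: eqP => _; rewrite ?lerDl ?(ltW d0)// ge0_cp// ?oppr_le0.
rewrite lee_fin (bigD1 i)//= !mxE eqxx addrC addKr.
rewrite (_ : \prod_(j < n | j != i) _ = C); last first.
  by apply: eq_bigr => j /negbTE ji; rewrite !mxE ji.
rewrite /d mulrAC ler_pdivrMr ?ltr_wpDr// ler_wpM2l ?ltW// ltrDr//.
Qed.

Definition ind (A : set (Rn R n)) : 'rV[R]_n -> R := fun x => \1_A x.

Lemma ind_norm A x : `|ind A x| <= 1.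
Proof. by rewrite /ind indicE ger0_norm// lern1 leq_b1. Qed.

(** Away from the null faces a point has positive distance to all of them, and the indicator is
    constant nearby. This is the continuity that an approximate identity needs. *)
Lemma hbox_interior_ae a b : {ae mu, forall x : Rn R n,
  exists2 e : R, 0 < e & forall y, (forall i, `|y ord0 i - x ord0 i| < e) ->
    ind (hbox a b) y = ind (hbox a b) x}.
Proof.
have nf : {ae mu, forall x : Rn R n, forall i, x ord0 i <> a ord0 i /\ x ord0 i <> b ord0 i}.
  have H : forall i, {ae mu, forall x : Rn R n, x ord0 i <> a ord0 i /\ x ord0 i <> b ord0 i}.
    move=> i; apply: filterS2 (_ : {ae mu, forall x : Rn R n, x ord0 i <> a ord0 i})
      (_ : {ae mu, forall x : Rn R n, x ord0 i <> b ord0 i}) => //.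
    - exists [set x : Rn R n | x ord0 i = a ord0 i]; split => //.
      + have -> : [set x : Rn R n | x ord0 i = a ord0 i] = (fun x : Rn R n => x ord0 i) @^-1` [set a ord0 i] by [].
        by rewrite -[X in measurable X]setTI; exact: coord_measurable.
      + exact: mu_face.
      + by move=> x /= /contrapT.
    - exists [set x : Rn R n | x ord0 i = b ord0 i]; split => //.
      + have -> : [set x : Rn R n | x ord0 i = b ord0 i] = (fun x : Rn R n => x ord0 i) @^-1` [set b ord0 i] by [].
        by rewrite -[X in measurable X]setTI; exact: coord_measurable.
      + exact: mu_face.
      + by move=> x /= /contrapT.
  exact: filter_forall H.
apply: filterS nf => x xab.
pose f i := Num.min `|x ord0 i - a ord0 i| `|x ord0 i - b ord0 i|.
have f0 i : 0 < f i.
  have [h1 h2] := xab i.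
  by rewrite lt_min !normr_gt0 !subr_eq0; apply/andP; split; apply/eqP.
pose e := \big[Num.min/(1:R)]_i f i.
exists e; first by apply/lt_bigmin; [exact: ltr01|move=> i _; exact: f0].
move=> y xy.
have ye i : `|y ord0 i - x ord0 i| < f i.
  by apply: lt_le_trans (xy i) _; exact: bigmin_le_cond.
have same i : (a ord0 i <= y ord0 i < b ord0 i) = (a ord0 i <= x ord0 i < b ord0 i).
  have := ye i; rewrite lt_min => /andP[].
  have [h1 h2] := xab i.
  move=> ha hb.
  have aux (u w c : R) : `|w - u| < `|u - c| -> (c <= w) = (c <= u).
    move=> wu; have [cu|uc] := leP c u.
      by move: wu; rewrite (@ger0_norm _ (u - c)) ?subr_ge0// ltr_norml => /andP[? _]; lra.
    by move: wu; rewrite (@ltr0_norm _ (u - c)) ?subr_lt0// ltr_norml => /andP[_ ?]; lra.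
  by rewrite (aux _ _ _ ha) ltNge (aux _ _ _ hb) -ltNge.
rewrite /ind !indicE; congr (_%:R); congr (nat_of_bool _).
apply/idP/idP; rewrite !inE => H i; first by rewrite -same.
by rewrite same.
Qed.

End boxes.

Section product_L1.
Context d1 d2 (T1 : measurableType d1) (T2 : measurableType d2) (R : realType).
Variables (m1 : {sigma_finite_measure set T1 -> \bar R})
          (m2 : {sigma_finite_measure set T2 -> \bar R}).

Lemma prod_fun_L1 (f : T1 -> R) (g : T2 -> R) : L1 m1 f -> L1 m2 g ->
  L1 (m1 \x m2)%E (fun z => f z.1 * g z.2).
Proof.
move=> fi gi; have mf := L1_measurable fi; have mg := L1_measurable gi.
apply: prod_L1P1.
  apply: measurable_funM; first exact: (measurableT_comp mf measurable_fst).
  exact: (measurableT_comp mg measurable_snd).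
under eq_integral do under eq_integral do rewrite normrM EFinM.
have -> : (fun x => \int[m2]_y (`|f (x, y).1|%:E * `|g (x, y).2|%:E))%E =
    (fun x => `|f x|%:E * (\int[m2]_y `|g y|%:E))%E.
  apply/funext => x /=; rewrite ge0_integralZl//.
  by apply/measurable_EFinP/measurableT_comp.
rewrite ge0_integralZr//.
- rewrite lte_mul_pinfty//; [exact: integral_ge0| |exact: L1_lty].
  by rewrite ge0_fin_numE ?integral_ge0//; exact: L1_lty.
- by apply/measurable_EFinP/measurableT_comp.
- exact: integral_ge0.
Qed.

End product_L1.

(** * Approximate identities *)

Section inversion.
Context (R : realType) (n : nat).
Variable mu : {sigma_finite_measure set (Rn R n) -> \bar R}.
Hypothesis mu_leb : is_lebesgue mu.
Implicit Types (x y xi a b : 'rV[R]_n) (f g v : 'rV[R]_n -> R).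

Lemma ind_measurable (A : set (Rn R n)) : measurable A ->
  measurable_fun setT (ind A : Rn R n -> R).
Proof. by move=> mA; exact: measurable_indic. Qed.

Lemma ind_hbox_L1 a b : L1 mu (ind (hbox a b)).
Proof.
apply: L1I; first by apply: ind_measurable; exact: hbox_measurable.
have -> : (\int[mu]_x `|ind (hbox a b) x|%:E = \int[mu]_x (\1_(hbox a b) x)%:E)%E.
  by apply: eq_integral => x _; rewrite /ind ger0_norm// indicE.
rewrite integral_indic//; last exact: hbox_measurable.
by rewrite setIT; exact: mu_hbox_fin.
Qed.

Section approximate_identity.
Variables (k : nat -> 'rV[R]_n -> R) (c : nat -> R).
Hypotheses (k0 : forall j x, 0 <= k j x) (ki : forall j, L1 mu (k j))
  (k1 : forall j, \int[mu]_x k j x = 1)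
  (k2i : forall j, L1 mu (fun x => dotv x x * k j x))
  (k2 : forall j, \int[mu]_x (dotv x x * k j x) <= c j)
  (c0 : c @ \oo --> (0:R)).

(** Chebyshev's inequality: wherever g(y) differs from g(x) one has |x - y|^2 >= e^2, so |g(x) -
    g(y)| <= 2 |x - y|^2 / e^2 everywhere, and the second moments [c] tend to 0. *)
Lemma approx_id_cvg g x (e : R) : measurable_fun setT (g : Rn R n -> R) ->
  (forall y, `|g y| <= 1) -> 0 < e ->
  (forall y, (forall i, `|y ord0 i - x ord0 i| < e) -> g y = g x) ->
  (fun j => conv mu (k j) g x) @ \oo --> g x.
Proof.
move=> mg g1 e0 gx.
have kf j := L1_flip mu_leb x (ki j).
have kg j : L1 mu (fun y : Rn R n => k j (x - (y : 'rV[R]_n)) * g y) by exact: (L1M (kf j) mg g1).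
have bound j : `|g x - conv mu (k j) g x| <= 2 / e ^+ 2 * c j.
  have -> : g x - conv mu (k j) g x = \int[mu]_y (g x * k j (x - y) - k j (x - y) * g y).
    rewrite RintBT//; last by apply: L1Z; exact: kf.
    rewrite RintZT; last exact: kf.
    by rewrite (Rint_flip mu_leb x (L1_measurable (ki j))) k1 mulr1.
  have k2f := L1_flip mu_leb x (k2i j).
  apply: (@le_trans _ _ (\int[mu]_y (2 / e ^+ 2 * (dotv (x - y) (x - y) * k j (x - y))))).
    apply: norm_Rint_le.
    - by apply: L1B => //; apply: L1Z; exact: kf.
    - by apply: L1Z; exact: k2f.
    move=> y; rewrite [g x * _]mulrC -mulrBr normrM ger0_norm//.
    rewrite mulrC [dotv _ _ * _]mulrC mulrA mulrAC [leRHS]mulrC.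
    rewrite mulrC ler_wpM2l//.
    have [h|h] := pselect (forall i, `|(y : 'rV[R]_n) ord0 i - x ord0 i| < e).
      by rewrite gx// subrr normr0 mulr_ge0 ?divr_ge0 ?exprn_ge0 ?dotv_ge0// ltW.
    move: h => /existsNP [i /negP]; rewrite -leNgt => ei.
    apply: (@le_trans _ _ 2).
      by rewrite (le_trans (ler_normB _ _))// [leRHS]mulr2n lerD.
    rewrite mulrAC ler_pdivlMr ?exprn_gt0// ler_wpM2l//.
    rewrite (le_trans _ (coord_sqr_le _ i))// !mxE.
    rewrite -[leRHS]real_normK ?num_real// distrC lerXn2r// nnegrE; exact: ltW.
  rewrite RintZT; last exact: k2f.
  apply: ler_wpM2l; first by rewrite divr_ge0// exprn_ge0// ltW.
  have m2 : measurable_fun setT (fun z : Rn R n => dotv z z * k j z) := L1_measurable (k2i j).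
  by rewrite (Rint_flip mu_leb x m2).
apply/cvgrPdist_le => /= d d0.
have C0 : 0 < 2 / e ^+ 2 by rewrite divr_gt0// exprn_gt0.
have /cvgrPdist_le /(_ (d / (2 / e ^+ 2)) (divr_gt0 d0 C0)) := c0.
apply: filterS => j; rewrite sub0r normrN => cj.
rewrite (le_trans (bound j))// mulrC -ler_pdivlMr//.
by rewrite (le_trans (ler_norm _)).
Qed.

Lemma approx_id_box v a b : L1 mu v ->
  (fun j => \int[mu]_x (v x * conv mu (k j) (ind (hbox a b)) x)) @ \oo -->
  \int[mu]_x (v x * ind (hbox a b) x).
Proof.
move=> vi; have mv := L1_measurable vi.
have mI := ind_measurable (hbox_measurable a b).
have H := @Rint_dct_ae _ (Rn R n) R mu (fun j x => v x * conv mu (k j) (ind (hbox a b)) x)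
  (fun x => v x * ind (hbox a b) x) (fun x => `|v x|).
apply: (proj2 (H _ _ _ (L1_norm vi) _)).
- move=> j; apply: measurable_funM => //.
  by apply: conv_measurable => //; exact: L1_measurable.
- exact: measurable_funM.
- apply: filterS (hbox_interior_ae mu_leb a b) => x [e e0 h].
  apply: cvgM; first exact: cvg_cst.
  by apply: (approx_id_cvg mI _ e0 h) => y; exact: ind_norm.
- move=> j x; rewrite normrM -[leRHS]mulr1 ler_wpM2l//.
  have := @norm_conv_le _ _ _ mu_leb (k j) (ind (hbox a b)) 1 (ki j) mI (@ind_norm _ _ _) x.
  rewrite mul1r (_ : \int[mu]_x _ = 1)// -(k1 j).
  by apply: eq_RintegralT => y; rewrite ger0_norm.
Qed.

End approximate_identity.

End inversion.

(** * Inversion, uniqueness and integrability of the cosine transform *)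

Section fourier_inversion.
Context (R : realType) (n : nat).
Variable mu : {sigma_finite_measure set (Rn R n) -> \bar R}.
Hypothesis mu_leb : is_lebesgue mu.
Implicit Types (x y xi a b : 'rV[R]_n) (N f g : 'rV[R]_n -> R) (l : R).

Lemma lapsym_ge0 xi : 0 <= lapsym xi.
Proof. by rewrite /lapsym !mulr_ge0 ?exprn_ge0 ?pi_ge0 ?dotv_ge0. Qed.

Lemma lapsym_measurable : measurable_fun setT (fun xi : Rn R n => lapsym xi).
Proof. by apply: measurable_funM => //; exact: dotvv_measurable. Qed.

Definition gauss l xi : R := expR (- (l * lapsym xi)).

Lemma gauss_fun_measurable l : measurable_fun setT (gauss l : Rn R n -> R).
Proof.
apply: measurableT_comp => //; apply: measurableT_comp => //.
by apply: measurable_funM => //; exact: lapsym_measurable.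
Qed.

Lemma gauss_ge0 l xi : 0 <= gauss l xi. Proof. exact: expR_ge0. Qed.

Lemma gauss_le1 l xi : 0 <= l -> gauss l xi <= 1.
Proof. by move=> l0; rewrite -[leRHS]expR0 ler_expR oppr_le0 mulr_ge0// lapsym_ge0. Qed.

(** The dual time: exp(- l a), with a = 4 pi^2 |xi|^2, is a multiple of the heat kernel at time
    [l' l], because 1 / (4 l') = 4 pi^2 l. *)
Let l' l : R := (16 * pi ^+ 2 * l)^-1.

Let l'_gt0 l : 0 < l -> 0 < l' l.
Proof. by move=> l0; rewrite invr_gt0 !mulr_gt0 ?exprn_gt0 ?pi_gt0. Qed.

Let gaussE l xi : 0 < l -> gauss l xi = Num.sqrt (4 * pi * l) ^- n * heat (l' l) xi.
Proof.
move=> l0; have p0 := lt0r_neq0 (pi_gt0 R); have ln0 := lt0r_neq0 l0.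
have -> : gauss l xi = expR (- dotv xi xi / (4 * l' l)).
  rewrite /gauss /lapsym /l'; congr expR.
  by move: (pi : R) p0 ln0 => q q0 l0'; field; rewrite q0 l0'.
rewrite heatE ?l'_gt0//; congr (_ * _); rewrite -exprVn; congr (_ ^+ _).
rewrite -sqrtrV ?mulr_ge0 ?pi_ge0 ?ltW//; congr Num.sqrt.
by rewrite /l'; move: (pi : R) p0 ln0 => q q0 l0'; field; rewrite q0 l0'.
Qed.

Lemma gauss_fun_L1 l : 0 < l -> L1 mu (gauss l).
Proof.
move=> l0; rewrite (_ : gauss l = fun x => Num.sqrt (4 * pi * l) ^- n * heat (l' l) x).
  by apply: L1Z; apply: heat_L1 => //; exact: l'_gt0.
by apply/funext => x; exact: gaussE.
Qed.

Lemma ct_gauss l x : 0 < l -> ct mu (gauss l) x = heat l x.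
Proof.
move=> l0; have L0 := l'_gt0 l0.
transitivity (\int[mu]_xi (Num.sqrt (4 * pi * l) ^- n * (heat (l' l) xi * cos (2 * pi * dotv xi x)))).
  by apply: eq_RintegralT => xi; rewrite gaussE//; exact: (esym (mulrA _ _ _)).
rewrite RintZT; last by apply: L1_cos => //; exact: heat_L1.
rewrite -[X in _ * X]/(ct mu (heat (l' l)) x) ct_heat// /heat; congr (_ * expR _).
rewrite /lapsym /l'; have p0 := lt0r_neq0 (pi_gt0 R); have ln0 := lt0r_neq0 l0.
by move: (pi : R) p0 ln0 => q q0 l0'; field; rewrite q0 l0'.
Qed.

Lemma cos_dot2_measurable : measurable_fun setT (fun z : Rn R n * Rn R n => cos (2 * pi * dotv z.1 z.2)).
Proof.
apply: (@measurableT_comp _ _ _ _ _ _ cos); first by apply: continuous_measurable_fun; exact: continuous_cos.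
by apply: measurable_funM => //; exact: dotv2_measurable.
Qed.

Lemma ct_measurable N : measurable_fun setT (N : Rn R n -> R) ->
  measurable_fun setT (ct mu N : Rn R n -> R).
Proof.
move=> mN; apply: (@measurable_Rint_snd _ _ _ _ _ mu
  (fun z : Rn R n * Rn R n => N z.2 * cos (2 * pi * dotv z.2 z.1))).
apply: measurable_funM; first exact: snd_measurable.
have := cos_dot2_measurable; congr measurable_fun.
by apply/funext => z; rewrite dotvC.
Qed.

Lemma ct_norm_le N xi : L1 mu N -> `|ct mu N xi| <= \int[mu]_x `|N x|.
Proof.
move=> Ni; apply: norm_Rint_le; [exact: L1_cos|exact: L1_norm|].
by move=> x; rewrite normrM -[leRHS]mulr1 ler_wpM2l// cos_max.
Qed.

(** The heat kernel is itself the transform of a Gaussian ([ct_gauss]), so Fubini rewrites the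
    regularisation of [N] as its inverse transform damped by that Gaussian. *)
Lemma conv_heatE N l x : 0 < l -> L1 mu N -> (forall xi, st mu N xi = 0) ->
  conv mu (heat l) N x = ct mu (fun xi => gauss l xi * ct mu N xi) x.
Proof.
move=> l0 Ni sN; have mN := L1_measurable Ni.
pose F (z : Rn R n * Rn R n) := N z.1 * gauss l z.2 * cos (2 * pi * (dotv z.2 x - dotv z.1 z.2)).
have Fi : L1 (mu \x mu)%E F.
  apply: (L1M (M := 1) (prod_fun_L1 Ni (gauss_fun_L1 l0))).
    apply: (@measurableT_comp _ _ _ _ _ _ cos); first by apply: continuous_measurable_fun; exact: continuous_cos.
    apply: measurable_funM => //; apply: measurable_funB; last exact: dotv2_measurable.
    exact: (snd_measurable (dotv_measurable x)).
  by move=> z; exact: cos_max.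
transitivity (\int[mu]_y \int[mu]_xi F (y, xi)).
  apply: eq_RintegralT => y; rewrite -ct_gauss// /ct -mulrC -RintZT; last first.
    by apply: L1_cos => //; exact: gauss_fun_L1.
  by apply: eq_RintegralT => xi; rewrite /F /= dotvDr dotvNr (dotvC xi y); ring.
rewrite Rfubini//; apply: eq_RintegralT => xi; rewrite /F /=.
have c1 := L1_cos xi Ni; have s1 := L1_sin xi Ni.
transitivity (\int[mu]_y (gauss l xi * cos (2 * pi * dotv xi x) * (N y * cos (2 * pi * dotv y xi)) +
   gauss l xi * sin (2 * pi * dotv xi x) * (N y * sin (2 * pi * dotv y xi)))).
  apply: eq_RintegralT => y.
  by rewrite mulrBr cosB; ring.
rewrite RintDT; [|exact: L1Z|exact: L1Z].
rewrite !RintZT//.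
have -> : \int[mu]_y (N y * sin (2 * pi * dotv y xi)) = 0 by exact: sN.
rewrite mulr0 addr0 -/(ct mu N xi); ring.
Qed.

Let li (j : nat) : R := j.+1%:R^-1.
Let li0 j : 0 < li j. Proof. by rewrite invr_gt0. Qed.

Let li_cvg : li @ \oo --> (0 : R).
Proof. exact: cvg_harmonic. Qed.

Let heat2_L1 l : 0 < l -> L1 mu (fun x => dotv x x * heat l x) /\
  \int[mu]_x (dotv x x * heat l x) <= 8 * Num.sqrt 2 ^+ n * l.
Proof.
move=> l0; have l20 : 0 < 2 * l by rewrite mulr_gt0.
have h x : `|dotv x x * heat l x| <= 8 * Num.sqrt 2 ^+ n * l * heat (2 * l) x.
  rewrite ger0_norm ?mulr_ge0 ?dotv_ge0 ?heat_ge0//.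
  have := heat_poly_bound 1 x l0; rewrite expr1 (factS 0) fact0 muln1 mul1r.
  by rewrite expr1 => /le_trans; apply; rewrite le_eqVlt; apply/orP; left; apply/eqP; ring.
have bi : L1 mu (fun x => 8 * Num.sqrt 2 ^+ n * l * heat (2 * l) x) by apply: L1Z; exact: heat_L1.
have hi : L1 mu (fun x => dotv x x * heat l x).
  apply: (L1_le _ _ bi).
    by apply: measurable_funM; [exact: dotvv_measurable|exact: heat_measurable].
  by move=> x; rewrite (le_trans (h x))// ler_norm.
split => //; rewrite (le_trans (ler_norm _))// (le_trans (norm_Rint_le hi bi h))//.
by rewrite RintZT; [rewrite Rint_heat// mulr1|exact: heat_L1].
Qed.

(** The pairing of heat * N with the indicator of a box has two limits as the heat time tends to 0.
    Moving the kernel onto the indicator gives the integral of [N] over the box; letting the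
    Gaussian damping disappear gives that of [M]. The two functions thus have equal integrals over
    all boxes. *)
Lemma fourier_inversion N : L1 mu N -> (forall xi, st mu N xi = 0) -> L1 mu (ct mu N) ->
  {ae mu, forall x : Rn R n, N x = ct mu (ct mu N) x}.
Proof.
move=> Ni sN cNi; have mN := L1_measurable Ni.
set M := ct mu (ct mu N).
have mM : measurable_fun setT (M : Rn R n -> R) by apply: ct_measurable; exact: L1_measurable cNi.
pose A := \int[mu]_xi `|ct mu N xi|.
have MA x : `|M x| <= A by exact: ct_norm_le.
have Nn : L1 mu (fun x => `|N x| `^ 1).
  by apply: eq_integrable (L1_norm Ni) => // x _; rewrite /= powRr1.
have MIi a b : L1 mu (fun x => ind (hbox a b) x * M x).
  by apply: (L1M (M := A) (ind_hbox_L1 mu_leb a b)).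
have NIi a b : L1 mu (fun x => N x * ind (hbox a b) x).
  by apply: (L1M Ni (ind_measurable (hbox_measurable a b)) (@ind_norm _ _ _)).
have key a b : \int[mu]_x (N x * ind (hbox a b) x) = \int[mu]_x (ind (hbox a b) x * M x).
  have mI := ind_measurable (hbox_measurable a b).
  have c1 := @approx_id_box R n mu mu_leb (fun j => heat (li j)) (fun j => 8 * Num.sqrt 2 ^+ n * li j)
    (fun j x => heat_ge0 _ x) (fun j => heat_L1 mu_leb (li0 j)) (fun j => Rint_heat mu_leb (li0 j))
    (fun j => proj1 (heat2_L1 (li0 j))) (fun j => proj2 (heat2_L1 (li0 j))).
  have lc : (fun j => 8 * Num.sqrt 2 ^+ n * li j) @ \oo --> (0 : R).
    by rewrite -(mulr0 (8 * Num.sqrt 2 ^+ n)); apply: cvgM; [exact: cvg_cst|exact: li_cvg].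
  have {}c1 := c1 lc N a b Ni.
  have c2 : (fun j => \int[mu]_x (N x * conv mu (heat (li j)) (ind (hbox a b)) x)) @ \oo -->
      \int[mu]_x (ind (hbox a b) x * M x).
    have H := @Rint_dct _ (Rn R n) R mu (fun j x => ind (hbox a b) x * conv mu (heat (li j)) N x)
      (fun x => ind (hbox a b) x * M x) (fun x => `|A * ind (hbox a b) x|).
    have convM x : (fun j => conv mu (heat (li j)) N x) @ \oo --> M x.
      have H2 := @Rint_dct _ (Rn R n) R mu
        (fun j xi => gauss (li j) xi * ct mu N xi * cos (2 * pi * dotv xi x))
        (fun xi => ct mu N xi * cos (2 * pi * dotv xi x)) (fun xi => `|ct mu N xi|).
      have -> : (fun j => conv mu (heat (li j)) N x) =
         (fun j => \int[mu]_xi (gauss (li j) xi * ct mu N xi * cos (2 * pi * dotv xi x))).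
        by apply/funext => j; rewrite conv_heatE.
      apply: (proj2 (H2 _ _ (L1_norm cNi) _)).
      - move=> j; apply: measurable_funM; last exact: cos_dot_measurable.
        by apply: measurable_funM; [exact: gauss_fun_measurable|exact: L1_measurable cNi].
      - move=> xi; apply: cvgM; last exact: cvg_cst.
        rewrite -[X in _ --> X]mul1r; apply: cvgM; last exact: cvg_cst.
        rewrite -[X in _ --> X]expR0 -oppr0 -(mul0r (lapsym xi)).
        apply: continuous_cvg; first exact: continuous_expR.
        by apply: cvgN; apply: cvgM; [exact: li_cvg|exact: cvg_cst].
      - move=> j xi; rewrite !normrM (ger0_norm (gauss_ge0 _ _)).
        rewrite -[leRHS]mul1r -[leRHS]mulr1 ler_pM ?mulr_ge0 ?gauss_ge0 ?cos_max//.
        by rewrite ler_wpM2r// gauss_le1// ltW.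
    apply: (cvg_trans _ (proj2 (H _ _ (L1_norm _) _))).
    - apply: near_eq_cvg; apply: nearW => j /=.
      rewrite -(conv_duality mu_leb (le_refl 1) (heat_L1 mu_leb (li0 j)) mN Nn (@heatN _ _ _)
        (ind_hbox_L1 mu_leb a b) (@ind_norm _ _ _)).
      by apply: eq_RintegralT => x; rewrite mulrC.
    - move=> j; apply: measurable_funM => //; apply: conv_measurable => //; exact: heat_measurable.
    - by move=> x; apply: cvgM; [exact: cvg_cst|exact: convM].
    - by apply: L1Z; exact: ind_hbox_L1.
    - move=> j x; rewrite !normrM mulrC ler_wpM2r// (le_trans _ (ler_norm _))//.
      have gi : L1 mu (fun xi => gauss (li j) xi * ct mu N xi).
        apply: (L1_le _ _ cNi).
          by apply: measurable_funM; [exact: gauss_fun_measurable|exact: L1_measurable cNi].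
        move=> xi; rewrite normrM (ger0_norm (gauss_ge0 _ _)) -[leRHS]mul1r ler_wpM2r//.
        by rewrite gauss_le1// ltW.
      rewrite conv_heatE// (le_trans (ct_norm_le _ gi))//.
      apply: le_trans (ler_norm _) _; apply: norm_Rint_le; [exact: L1_norm|exact: L1_norm|].
      move=> xi; rewrite normr_id normrM (ger0_norm (gauss_ge0 _ _)) -[leRHS]mul1r ler_wpM2r//.
      by rewrite gauss_le1// ltW.
  by rewrite -(cvg_lim _ c1)// (cvg_lim _ c2).
have int_box (h : 'rV[R]_n -> R) a b : L1 mu (fun x => h x * ind (hbox a b) x) ->
  (\int[mu]_(x in hbox a b) (h x)%:E = (\int[mu]_x (h x * ind (hbox a b) x))%:E)%E.
  move=> hi; rewrite RintegralE// [LHS]integral_mkcond.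
  apply: eq_integral => x _; rewrite patchE /ind indicE.
  by case: ifPn; rewrite ?mulr1 ?mulr0.
have H := @ae_eq0_boxes R n mu (fun x => N x - M x) setT openT.
have : {ae mu, forall x : Rn R n, setT x -> N x - M x = 0}; last first.
  by apply: filterS => x /(_ I) /subr0_eq.
apply: H => a b _.
  have : L1 mu (fun x => N x * ind (hbox a b) x - ind (hbox a b) x * M x) by exact: L1B.
  move=> h; apply/(integrable_mkcond _ (hbox_measurable a b)).
  apply: eq_integrable h => // x _; rewrite patchE /= /ind indicE.
  by case: ifPn => _; rewrite ?mulr1 ?mul1r// mulr0 mul0r subr0.
have D : L1 mu (fun x => (N x - M x) * ind (hbox a b) x).
  by apply: eq_integrable (L1B (NIi a b) (MIi a b)) => // x _ /=; congr EFin; ring.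
rewrite int_box//; congr EFin.
transitivity (\int[mu]_x (N x * ind (hbox a b) x - ind (hbox a b) x * M x)).
  by apply: eq_RintegralT => x; ring.
by rewrite RintBT// key subrr.
Qed.

(** The difference has zero transform, which is integrable, so inversion applies and returns 0. *)
Lemma ct_uniqueness f g : L1 mu f -> L1 mu g ->
  (forall xi, ct mu f xi = ct mu g xi) -> (forall xi, st mu f xi = st mu g xi) ->
  {ae mu, forall x : Rn R n, f x = g x}.
Proof.
move=> fi gi cE sE.
have c0 xi : ct mu (fun x => f x - g x) xi = 0.
  rewrite /ct; transitivity (ct mu f xi - ct mu g xi); last by rewrite cE subrr.
  rewrite /ct -RintBT; [|exact: L1_cos|exact: L1_cos].
  by apply: eq_RintegralT => x; rewrite mulrBl.
have s0 xi : st mu (fun x => f x - g x) xi = 0.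
  rewrite /st; transitivity (st mu f xi - st mu g xi); last by rewrite sE subrr.
  rewrite /st -RintBT; [|exact: L1_sin|exact: L1_sin].
  by apply: eq_RintegralT => x; rewrite mulrBl.
have ci : L1 mu (ct mu (fun x => f x - g x)).
  by rewrite (funext c0 : ct mu _ = fun=> 0); exact: integrable0.
have := fourier_inversion (L1B fi gi) s0 ci.
apply: filterS => x E; apply/subr0_eq; rewrite E -[RHS](Rint0 mu).
by apply: eq_RintegralT => y; rewrite c0 mul0r.
Qed.

(** The integral of the transform damped by a Gaussian is the value at 0 of heat * f, at most [M].
    For a nonnegative transform the damping is removed by monotone convergence. *)
Lemma ct_ge0_L1 f (M : R) : L1 mu f -> (forall x, f (- x) = f x) -> (forall x, `|f x| <= M) ->
  (forall xi, 0 <= ct mu f xi) -> L1 mu (ct mu f).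
Proof.
move=> fi ef fM c0; have mf := L1_measurable fi; have mc := ct_measurable mf.
have sf xi : st mu f xi = 0 by exact: even_st0.
have mg j : measurable_fun setT (fun xi : Rn R n => gauss (li j) xi * ct mu f xi).
  by apply: measurable_funM => //; exact: gauss_fun_measurable.
have g0 j xi : 0 <= gauss (li j) xi * ct mu f xi by rewrite mulr_ge0// gauss_ge0.
have mono i j xi : (i <= j)%N -> gauss (li i) xi * ct mu f xi <= gauss (li j) xi * ct mu f xi.
  move=> ij; rewrite ler_wpM2r// ler_expR lerN2 ler_wpM2r ?lapsym_ge0//.
  by rewrite lef_pV2 ?posrE// ler_nat.
have bound j : (\int[mu]_xi (gauss (li j) xi * ct mu f xi)%:E <= M%:E)%E.
  have gi : L1 mu (fun xi => gauss (li j) xi * ct mu f xi).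
    apply: (L1M (M := \int[mu]_x `|f x|) (gauss_fun_L1 (li0 j)) mc) => xi; exact: ct_norm_le.
  rewrite -RintegralE// lee_fin.
  have := conv_heatE 0 (li0 j) fi sf; rewrite /ct.
  rewrite (_ : \int[mu]_x (gauss (li j) x * _ * _) = \int[mu]_xi (gauss (li j) xi * ct mu f xi)); last first.
    by apply: eq_RintegralT => xi; rewrite -[X in _ * cos (_ * X)]/(dotv xi 0) (_ : dotv xi 0 = 0) ?mulr0 ?cos0 ?mulr1// /dotv big1// => i _; rewrite mxE mulr0.
  move=> <-; apply: le_trans (ler_norm _) _.
  apply: le_trans (norm_conv_le mu_leb (heat_L1 mu_leb (li0 j)) mf fM 0) _.
  rewrite (_ : \int[mu]_x _ = 1) ?mulr1// -(Rint_heat mu_leb (li0 j)).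
  by apply: eq_RintegralT => y; rewrite ger0_norm// heat_ge0.
apply: L1I => //.
have -> : (\int[mu]_x `|ct mu f x|%:E = \int[mu]_x (limn (fun j => (gauss (li j) x * ct mu f x)%:E)))%E.
  apply: eq_integral => xi _; apply/esym/cvg_lim => //; rewrite ger0_norm//.
  apply: cvg_EFin; first exact: nearW.
  rewrite -[X in _ --> X]mul1r; apply: cvgM; last exact: cvg_cst.
  rewrite -[X in _ --> X]expR0 -oppr0 -(mul0r (lapsym xi)).
  apply: continuous_cvg; first exact: continuous_expR.
  by apply: cvgN; apply: cvgM; [exact: li_cvg|exact: cvg_cst].
rewrite monotone_convergence//.
- apply: (@le_lt_trans _ _ M%:E); last exact: ltry.
  apply: lime_le; last by apply: nearW => j; exact: bound.
  apply: ereal_nondecreasing_is_cvgn => i j ij.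
  apply: ge0_le_integral => //.
  + by move=> xi _; rewrite lee_fin.
  + by apply/measurable_EFinP; exact: mg.
  + by apply/measurable_EFinP; exact: mg.
  + by move=> xi _; rewrite lee_fin mono.
- by move=> j; apply/measurable_EFinP; exact: mg.
- by move=> j xi _; rewrite lee_fin.
- by move=> xi _ i j ij; rewrite lee_fin mono.
Qed.

End fourier_inversion.

(** * Mixtures of heat kernels *)

Section mellin_weights.
Context {R : realType}.
Local Notation leb := (@lebesgue_measure R).
Implicit Types (t a b c s r : R).

Lemma expabs_L1 c : 0 < c -> L1 leb (fun t => expR (- (c * `|t|))).
Proof.
move=> c0; have ce : continuous (fun t : R => expR (- (c * t))).
  move=> t; apply: (is_derive_continuous (dexp (dopp (dmul (dcst t c) (did t))))).
have cf : continuous (fun t : R => expR (- (c * `|t|))).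
  move=> t; apply: (@continuous_comp _ _ _ (fun u : R => `|u|) (fun u => expR (- (c * u)))).
    exact: norm_continuous.
  exact: ce.
apply: L1I; first exact: continuous_measurable_fun.
under eq_integral do rewrite ger0_norm ?expR_ge0//.
rewrite ge0_symfun_integralT//; last by move=> t; rewrite /= normrN.
rewrite (_ : \int[_]_(x in _) _ = (c^-1)%:E)%E; first by rewrite -EFinM ltry.
transitivity (\int[leb]_(t in `[0%R, +oo[) (expR (- (c * t)))%:E)%E.
  by rewrite set_itvcy; apply: eq_integral => t; rewrite inE/= => t0; rewrite ger0_norm.
have dF t : is_derive t 1 (fun u => - (c^-1 * expR (- (c * u)))) (expR (- (c * t))).
  apply: (deq (dopp (dmul (dcst t c^-1) (dexp (dopp (dmul (dcst t c) (did t))))))).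
  by field; exact: lt0r_neq0.
rewrite (@ge0_continuous_FTC2y _ (fun t => expR (- (c * t))) (fun t => - (c^-1 * expR (- (c * t)))) 0 0).
- by rewrite mulr0 oppr0 expR0 mulr1 EFinN oppeK add0e.
- by move=> t _; exact: expR_ge0.
- exact: continuous_subspaceT.
- rewrite -[X in _ --> X]oppr0; apply: cvgN; rewrite -[X in _ --> X](mulr0 c^-1).
  apply: cvgM; first exact: cvg_cst.
  apply: (cvg_comp (fun u => c * u) (fun u => expR (- u)) _ (@cvgr_expR R)).
  by apply: gt0_cvgMry => //; exact: cvg_id.
- by move=> t _; have [] := dF t.
- by apply: cvg_at_right_filter; exact: is_derive_continuous (dF 0).
- by move=> t _; rewrite derive1E; have [_ ->] := dF t.
Qed.

Lemma ge0_integral_leb_shift (G : R -> R) b : continuous G -> (forall t, 0 <= G t) ->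
  (\int[leb]_t (G (t + b)%R)%:E = \int[leb]_t (G t)%:E)%E.
Proof.
move=> cG G0.
have dF t : is_derive t 1 (fun u : R => u + b) (1 : R).
  by apply: (deq (dadd (did t) (dcst t b))); rewrite addr0.
have dE : derive1 (fun u : R => u + b) = fun=> 1.
  by apply/funext => t; rewrite derive1E; have [_ ->] := dF t.
rewrite [RHS](@increasing_ge0_integration_by_substitutionT _ (fun u : R => u + b))//.
- by apply: eq_integral => t _; rewrite dE /= mulr1.
- by move=> x y; rewrite ltrD2r.
- by rewrite dE => t; exact: cvg_cst.
- by rewrite dE; exact: is_cvg_cst.
- by rewrite dE; exact: is_cvg_cst.
- exact: cvg_addrr_Ny.
- exact: cvg_addrr.
Qed.

Lemma Rint_leb_shift (G : R -> R) b : continuous G -> (forall t, 0 <= G t) ->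
  \int[leb]_t (G (t + b)) = \int[leb]_t G t.
Proof. by move=> cG G0; rewrite /Rintegral ge0_integral_leb_shift. Qed.

Lemma Rint_gt0 (f : R -> R) (m : R) : L1 leb f -> (forall t, 0 <= f t) -> 0 < m ->
  (forall t, 0 <= t <= 1 -> m <= f t) -> 0 < \int[leb]_t f t.
Proof.
move=> fi f0 m0 fm; apply: (lt_le_trans m0); rewrite -lee_fin RintegralE//.
have -> : (m%:E = \int[leb]_t (m * \1_(`[0, 1]%classic) t)%:E)%E.
  under eq_integral do rewrite EFinM.
  rewrite ge0_integralZl//; last by rewrite lee_fin ltW.
    rewrite integral_indic// setIT.
    have := lebesgue_measure_itv `[(0 : R), 1]; rewrite /= lte_fin ltr01 oppr0 adde0 => h.
    by rewrite -[LHS]mule1 -h.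
  exact/measurable_EFinP/measurable_indic.
apply: ge0_le_integral => //.
- by move=> t _; rewrite lee_fin mulr_ge0// ltW.
- by apply/measurable_EFinP; apply: measurable_funM => //; exact: measurable_indic.
- by apply/measurable_EFinP; exact: L1_measurable fi.
- move=> t _; rewrite lee_fin indicE; have [|_] := boolP (t \in _); last by rewrite mulr0.
  by rewrite inE/= in_itv/= mulr1; exact: fm.
Qed.

(* Under [l = e^t] these are the weights [l^s e^-l dl/l] and [(1 - e^(-l b)) l^-s dl/l]. *)
Definition wB s t : R := expR (s * t - expR t).
Definition wK s b t : R := (1 - expR (- (expR t * b))) * expR (- (s * t)).

Lemma wB_ge0 s t : 0 <= wB s t. Proof. exact: expR_ge0. Qed.

Lemma wB_continuous s : continuous (wB s).
Proof.
move=> t; apply: (is_derive_continuous (dexp (dadd (dmul (dcst t s) (did t)) (dopp (dexp (did t)))))).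
Qed.

Lemma wK_continuous s b : continuous (wK s b).
Proof.
move=> t; apply: (is_derive_continuous (dmul (dadd (dcst t 1) (dopp (dexp (dopp (dmul (dexp (did t)) (dcst t b))))))
  (dexp (dopp (dmul (dcst t s) (did t)))))).
Qed.

Lemma wK_ge0 s b t : 0 <= b -> 0 <= wK s b t.
Proof.
by move=> b0; rewrite mulr_ge0 ?expR_ge0// subr_ge0 -expR0 ler_expR oppr_le0 mulr_ge0 ?expR_ge0.
Qed.

(** For t >= 0, (1 + e^t)^M <= 2^M e^(M t), and the double exponential beats e^((M + 4) t) at the
    price (M + 4)!. The four spare powers leave e^((s - 4) t), at most e^(- s t) because s <= 2. For
    t < 0 the factor e^(s t) already decays. *)
Lemma wB_bound s (M : nat) t : 0 < s <= 2 ->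
  wB s t * (1 + expR t) ^+ M <= 2 ^+ M * (M + 4)`!%:R * expR (- (s * `|t|)).
Proof.
move=> /andP[s0 s2]; have e0 := expR_gt0 t.
have F1 : 1 <= (M + 4)`!%:R :> R by rewrite ler1n fact_gt0.
have [t0|t0] := leP 0 t.
  have e1 : 1 <= expR t by rewrite -expR0 ler_expR.
  apply: (@le_trans _ _ (wB s t * (2 ^+ M * expR t ^+ M))).
    rewrite ler_wpM2l ?wB_ge0// -exprMn lerXn2r ?nnegrE; lra.
  have -> : wB s t * (2 ^+ M * expR t ^+ M) =
      2 ^+ M * (expR t ^+ (M + 4) * expR (- expR t)) * expR ((s - 4) * t).
    rewrite /wB exprD expRD mulrBl [expR (s * t - 4 * t)]expRD.
    have -> : expR (- (4 * t)) = (expR t ^+ 4)^-1 by rewrite expRN -expRM_natl.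
    have : expR t ^+ 4 != 0 by rewrite expf_neq0// lt0r_neq0.
    by move: (expR t ^+ 4) => E E0; field.
  rewrite ler_pM ?mulr_ge0 ?exprn_ge0 ?expR_ge0//.
    by rewrite ler_wpM2l ?exprn_ge0// pow_expRN// ltW.
  rewrite ler_expR ger0_norm//; nra.
have e1 : expR t <= 1 by rewrite -expR0 ler_expR ltW.
rewrite mulrC ler_pM ?wB_ge0 ?exprn_ge0 ?addr_ge0 ?expR_ge0//.
  apply: (@le_trans _ _ (2 ^+ M)); first by rewrite lerXn2r ?nnegrE; lra.
  by rewrite ler_peMr// exprn_ge0.
by rewrite ler_expR ltr0_norm// mulrN opprK gerDl oppr_le0 ltW.
Qed.

(** The tail at plus infinity decays like e^(- s t); at minus infinity 1 - e^(- y) <= y leaves e^((1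
    - s) t). The two rates are positive exactly for 0 < s < 1. *)
Lemma wK_bound s b c t : 0 <= b -> c <= s -> c <= 1 - s ->
  wK s b t <= (1 + b) * expR (- (c * `|t|)).
Proof.
move=> b0 cs cs1; have e0 := expR_gt0 t.
have [t0|t0] := leP 0 t.
  rewrite ger0_norm// ler_pM ?expR_ge0//.
  - by rewrite subr_ge0 -expR0 ler_expR oppr_le0 mulr_ge0 ?expR_ge0.
  - have := expR_ge0 (- (expR t * b)); lra.
  - by rewrite ler_expR lerN2 ler_wpM2r.
rewrite ltr0_norm// mulrN opprK.
apply: (@le_trans _ _ (expR t * b * expR (- (s * t)))).
  rewrite ler_wpM2r ?expR_ge0//.
  have := expR_ge1Dx (- (expR t * b)); lra.
rewrite mulrAC -expRD mulrC ler_pM ?expR_ge0//; first by rewrite lerDr.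
by rewrite ler_expR; nra.
Qed.

Lemma wB_L1 s (M : nat) : 0 < s <= 2 -> L1 leb (fun t => wB s t * (1 + expR t) ^+ M).
Proof.
move=> s02; have /andP[s0 s2] := s02.
apply: (@L1_le _ _ R leb _ (fun t : R => 2 ^+ M * (M + 4)`!%:R * expR (- (s * `|t|)))).
- apply: measurable_funM; first exact: continuous_measurable_fun (@wB_continuous s).
  apply: measurable_funX; apply: measurable_funD => //.
- move=> t; rewrite ger0_norm; last by rewrite mulr_ge0 ?wB_ge0// exprn_ge0// addr_ge0 ?expR_ge0.
  by rewrite (le_trans (wB_bound M t s02))// ler_norm.
- by apply: L1Z; exact: expabs_L1.
Qed.

Lemma wB_L10 s : 0 < s <= 2 -> L1 leb (wB s).
Proof. by move=> s02; apply: eq_integrable (wB_L1 0 s02) => // t _; rewrite /= expr0 mulr1. Qed.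

Lemma wK_L1 s b : 0 < s < 1 -> 0 <= b -> L1 leb (wK s b).
Proof.
move=> /andP[s0 s1] b0; pose c := Num.min s (1 - s).
have c0 : 0 < c by rewrite lt_min s0 subr_gt0.
apply: (@L1_le _ _ R leb _ (fun t : R => (1 + b) * expR (- (c * `|t|)))).
- exact: continuous_measurable_fun (@wK_continuous s b).
- move=> t; rewrite ger0_norm ?wK_ge0// (le_trans (@wK_bound _ _ c _ _ _ _))// ?ler_norm//.
    by rewrite ge_min lexx.
  by rewrite ge_min lexx orbT.
- by apply: L1Z; exact: expabs_L1.
Qed.

(** Euler's Gamma function after the substitution l = e^t; [gamK s] is Gamma(1 - s) / s in the same
    variable. They normalise the two mixtures. *)
Definition gam s : R := \int[leb]_t wB s t.
Definition gamK s : R := \int[leb]_t wK s 1 t.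

Lemma gam_gt0 s : 0 < s <= 2 -> 0 < gam s.
Proof.
move=> s02; apply: (Rint_gt0 (m := expR (- expR 1)) (wB_L10 s02)) => [t||t /andP[t0 t1]].
- exact: wB_ge0.
- exact: expR_gt0.
rewrite ler_expR; have : expR t <= expR 1 by rewrite ler_expR.
by move/andP: s02 => [s0 _] h; have := mulr_ge0 (ltW s0) t0; lra.
Qed.

Lemma gamK_gt0 s : 0 < s < 1 -> 0 < gamK s.
Proof.
move=> s01; have /andP[s0 s1] := s01.
apply: (Rint_gt0 (m := (1 - expR (- 1)) * expR (- 1)) (wK_L1 s01 ler01)) => [t||t /andP[t0 t1]].
- exact: wK_ge0.
- by rewrite mulr_gt0 ?expR_gt0// subr_gt0 -[ltRHS]expR0 ltr_expR; lra.
have e1 : 1 <= expR t by rewrite -expR0 ler_expR.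
rewrite ler_pM ?expR_ge0//.
- by rewrite lerD2l lerN2 ler_expR mulr1; lra.
- by rewrite ler_expR; nra.
Qed.

Let powRE a r : 0 < a -> a `^ r = expR (r * ln a).
Proof. by move=> a0; rewrite /powR gt_eqF. Qed.

Let scale_continuous c (G : R -> R) : continuous G -> continuous (fun t => c * G t).
Proof. by move=> cG t; apply: cvgM; [exact: cvg_cst|exact: cG]. Qed.

(** The shift of t by ln(1 + a), that is l -> (1 + a) l, absorbs the factor e^(- l a) into the
    weight. *)
Lemma Rint_wB s a : 0 < s <= 2 -> 0 <= a ->
  \int[leb]_t (wB s t * expR (- (expR t * a))) = (1 + a) `^ (- s) * gam s.
Proof.
move=> s02 a0; have a1 : 0 < 1 + a by lra.
rewrite -RintZT; last exact: wB_L10.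
rewrite -(@Rint_leb_shift (fun t => (1 + a) `^ (- s) * wB s t) (ln (1 + a))).
- apply: eq_RintegralT => t; rewrite powRE// /wB -!expRD [in RHS](expRD t) lnK ?posrE//.
  by congr expR; ring.
- by apply: scale_continuous; exact: wB_continuous.
- by move=> t; rewrite mulr_ge0 ?powR_ge0 ?wB_ge0.
Qed.

Lemma Rint_wK s b : 0 < s < 1 -> 0 <= b -> \int[leb]_t wK s b t = b `^ s * gamK s.
Proof.
move=> s01 b0; have /andP[s0 s1] := s01; move: b0; rewrite le_eqVlt => /predU1P[<-|b0].
  rewrite powR0 ?gt_eqF// mul0r -[RHS](Rint0 leb).
  by apply: eq_RintegralT => t; rewrite /wK mulr0 oppr0 expR0 subrr mul0r.
rewrite -RintZT; last exact: wK_L1.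
rewrite -(@Rint_leb_shift (fun t => b `^ s * wK s 1 t) (ln b)).
- apply: eq_RintegralT => t; rewrite powRE// /wK mulr1 mulrCA -expRD expRD lnK ?posrE//.
  by congr (_ * expR _); ring.
- by apply: scale_continuous; exact: wK_continuous.
- by move=> t; rewrite mulr_ge0 ?powR_ge0 ?wK_ge0.
Qed.

(** (1 - e^(- l)) e^(- l a) = (1 - e^(- l (1 + a))) - (1 - e^(- l a)), and each bracket is
    integrated by [Rint_wK]. *)
Lemma Rint_wK_exp s a : 0 < s < 1 -> 0 <= a ->
  \int[leb]_t (wK s 1 t * expR (- (expR t * a))) = ((1 + a) `^ s - a `^ s) * gamK s.
Proof.
move=> s01 a0; have a1 : 0 <= 1 + a by lra.
rewrite mulrBl -!Rint_wK// -RintBT; [|exact: wK_L1|exact: wK_L1].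
apply: eq_RintegralT => t; rewrite /wK mulr1 mulrDr mulr1 opprD expRD; ring.
Qed.

End mellin_weights.

(** * Mixtures over the heat time, and the two kernels obtained from them *)

Section mixtures.
Context (R : realType) (n : nat).
Variable mu : {sigma_finite_measure set (Rn R n) -> \bar R}.
Hypothesis mu_leb : is_lebesgue mu.
Local Notation leb := (@lebesgue_measure R).
Implicit Types (x y xi : 'rV[R]_n) (s a l : R).

Section mixture.
Variables (G : R -> 'rV[R]_n -> R) (W : R -> R).
Hypothesis mG : measurable_fun setT (fun z : measurableTypeR R * Rn R n => G z.1 z.2).
Hypothesis Wi : L1 leb W.
Hypothesis GW : forall t, (\int[mu]_x `|G t x|%:E <= (W t)%:E)%E.

Definition mix x : R := \int[leb]_t G t x.

Lemma mix_prod_L1 : L1 (leb \x mu)%E (fun z : measurableTypeR R * Rn R n => G z.1 z.2).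
Proof.
apply: prod_L1P1 => //.
have Wn t : (W t)%:E = `|(W t)%:E|%E.
  by rewrite gee0_abs//; apply: le_trans (GW t); apply: integral_ge0.
apply: le_lt_trans (L1_lty Wi).
apply: ge0_le_integral => //.
- by move=> t _; apply: integral_ge0.
- have mF : measurable_fun setT (fun z : measurableTypeR R * Rn R n => `|G z.1 z.2|%:E).
    by apply/measurable_EFinP; exact: measurableT_comp.
  by apply: (@measurable_fun_fubini_tonelli_F _ _ _ _ _ mu
    (fun z : measurableTypeR R * Rn R n => `|G z.1 z.2|%:E)%E).
- by apply/measurable_EFinP; apply: measurableT_comp => //; exact: L1_measurable Wi.
- by move=> t _; rewrite /= (le_trans (GW t))// Wn.
Qed.

Let swap_L1 : L1 (mu \x leb)%E (fun z : Rn R n * measurableTypeR R => G z.2 z.1).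
Proof.
apply: prod_L1P2 => /=.
  exact: (measurableT_comp mG (@measurable_swap _ _ _ _)).
have := mix_prod_L1; have mF := mix_prod_L1 => /integrable12ltyP; apply.
exact: measurable_int mix_prod_L1.
Qed.

Lemma mix_L1 : L1 mu mix.
Proof. exact: (prod_L1_fst swap_L1). Qed.

Lemma mix_Rint (m : 'rV[R]_n -> R) (M : R) : measurable_fun setT (m : Rn R n -> R) ->
  (forall x, `|m x| <= M) ->
  \int[mu]_x (mix x * m x) = \int[leb]_t \int[mu]_x (G t x * m x).
Proof.
move=> mm mM.
have mm' : measurable_fun setT (fun z : Rn R n * measurableTypeR R => m z.1).
  exact: (measurableT_comp mm measurable_fst).
have Fi : L1 (mu \x leb)%E (fun z : Rn R n * measurableTypeR R => G z.2 z.1 * m z.1).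
  by apply: (L1M swap_L1 mm' (M := M)) => z; exact: mM.
rewrite -(Rfubini Fi) /=.
apply: ae_eq_RintT.
- by apply: measurable_funM => //; exact: L1_measurable mix_L1.
- exact: (L1_measurable (prod_L1_fst Fi)).
apply: filterS (ae_integrable1 swap_L1) => x hx _.
rewrite /mix mulrC -RintZT; last exact: hx.
by apply: eq_RintegralT => t; rewrite mulrC.
Qed.

Lemma mix_fst_L1 (m : 'rV[R]_n -> R) (M : R) : measurable_fun setT (m : Rn R n -> R) ->
  (forall x, `|m x| <= M) -> L1 leb (fun t => \int[mu]_x (G t x * m x)).
Proof.
move=> mm mM.
have mm' : measurable_fun setT (fun z : measurableTypeR R * Rn R n => m z.2).
  exact: (measurableT_comp mm measurable_snd).
have Fi : L1 (leb \x mu)%E (fun z : measurableTypeR R * Rn R n => G z.1 z.2 * m z.2).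
  by apply: (L1M mix_prod_L1 mm' (M := M)) => z; exact: mM.
exact: (prod_L1_fst Fi).
Qed.

Lemma ct_mix xi : ct mu mix xi = \int[leb]_t ct mu (G t) xi.
Proof. exact: (mix_Rint (@cos_dot_measurable R n xi) (fun x => cos_max _)). Qed.

End mixture.

Lemma heat_exp_measurable :
  measurable_fun setT (fun z : measurableTypeR R * Rn R n => heat (expR z.1) z.2).
Proof.
have c1 : continuous (fun t : R => 4 * pi * expR t : R).
  by move=> t; apply: cvgM; [exact: cvg_cst|exact: continuous_expR].
have c2 : continuous (fun t : R => Num.sqrt (4 * pi * expR t) : R).
  by move=> t; apply: (@continuous_comp _ _ _ (fun t : R => 4 * pi * expR t : R) (@Num.sqrt R));
    [exact: c1|exact: sqrt_continuous].
have c3 : continuous (fun t : R => Num.sqrt (4 * pi * expR t) ^+ n : R).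
  by move=> t; apply: (@continuous_comp _ _ _ (fun t : R => Num.sqrt (4 * pi * expR t) : R) (fun y : R => y ^+ n));
    [exact: c2|exact: exprn_continuous].
have c4 : continuous (fun t : R => Num.sqrt (4 * pi * expR t) ^- n : R).
  move=> t; apply: (@cvgV R R _ _ (fun t : R => Num.sqrt (4 * pi * expR t) ^+ n : R)); last exact: c3.
  by rewrite expf_neq0// gt_eqF// sqrtr_gt0 !mulr_gt0 ?pi_gt0 ?expR_gt0.
have c5 : continuous (fun t : R => 4 * expR t : R).
  by move=> t; apply: cvgM; [exact: cvg_cst|exact: continuous_expR].
have c6 : continuous (fun t : R => (4 * expR t)^-1 : R).
  move=> t; apply: (@cvgV R R _ _ (fun t : R => 4 * expR t : R)); last exact: c5.
  by rewrite gt_eqF// mulr_gt0 ?expR_gt0.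
rewrite /heat; apply: measurable_funM.
  apply: (measurableT_comp (f := fun t : R => Num.sqrt (4 * pi * expR t) ^- n : R)) => //.
  exact: continuous_measurable_fun.
apply: measurableT_comp => //; apply: measurable_funM.
  apply: measurableT_comp => //.
  exact: (measurableT_comp (@dotvv_measurable R n) measurable_snd).
apply: (measurableT_comp (f := fun t : R => (4 * expR t)^-1 : R)) => //.
exact: continuous_measurable_fun.
Qed.

Section heat_mixture.
Variable w : R -> R.
Hypotheses (w0 : forall t, 0 <= w t) (wc : continuous w) (wi : L1 leb w).

Let G t x := w t * heat (expR t) x.

Lemma heat_mix_measurable :
  measurable_fun setT (fun z : measurableTypeR R * Rn R n => G z.1 z.2).
Proof.
apply: measurable_funM; last exact: heat_exp_measurable.
by apply: (measurableT_comp (f := w)) => //; exact: continuous_measurable_fun.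
Qed.

Lemma heat_mix_le t : (\int[mu]_x `|G t x|%:E <= (w t)%:E)%E.
Proof.
under eq_integral do rewrite ger0_norm ?mulr_ge0 ?heat_ge0// EFinM.
rewrite ge0_integralZl//.
- by rewrite Rint_heatE ?expR_gt0// mule1.
- by apply/measurable_EFinP; exact: heat_measurable.
- by move=> x _; rewrite lee_fin heat_ge0.
- by rewrite lee_fin.
Qed.

Lemma heat_mix_L1 : L1 mu (mix G).
Proof. exact: (mix_L1 heat_mix_measurable wi heat_mix_le). Qed.

Lemma heat_mixN x : mix G (- x) = mix G x.
Proof. by apply: eq_RintegralT => t; rewrite /G heatN. Qed.

Lemma ct_heat_mix xi : ct mu (mix G) xi = \int[leb]_t (w t * expR (- (expR t * lapsym xi))).
Proof.
rewrite (ct_mix heat_mix_measurable wi heat_mix_le); apply: eq_RintegralT => t.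
rewrite -(ct_heat mu_leb) ?expR_gt0// /ct -RintZT; last first.
  by apply: L1_cos; apply: heat_L1 => //; exact: expR_gt0.
by apply: eq_RintegralT => x; exact: (esym (mulrA _ _ _)).
Qed.

End heat_mixture.

Definition bessel s x : R := (gam s)^-1 * mix (fun t x => wB s t * heat (expR t) x) x.
Definition fracker s x : R := (gamK s)^-1 * mix (fun t x => wK s 1 t * heat (expR t) x) x.

(** Exponents up to 2 are covered, because 2 - s and 2 - 2 s will occur besides s. *)
Lemma bessel_L1 s : 0 < s <= 2 -> L1 mu (bessel s).
Proof.
by move=> s02; apply: L1Z; apply: heat_mix_L1 => [t||]; [exact: wB_ge0|exact: wB_continuous|exact: wB_L10].
Qed.

Lemma besselN s x : bessel s (- x) = bessel s x.
Proof. by rewrite /bessel heat_mixN. Qed.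

Lemma ct_scale c f xi : L1 mu f -> ct mu (fun x => c * f x) xi = c * ct mu f xi.
Proof.
move=> fi; rewrite /ct -RintZT; last exact: L1_cos.
by apply: eq_RintegralT => x; rewrite mulrA.
Qed.

Lemma ct_bessel s xi : 0 < s <= 2 -> ct mu (bessel s) xi = (1 + lapsym xi) `^ (- s).
Proof.
move=> s02; rewrite ct_scale; last first.
  by apply: heat_mix_L1 => [t||]; [exact: wB_ge0|exact: wB_continuous|exact: wB_L10].
rewrite ct_heat_mix => [|t||]; [|exact: wB_ge0|exact: wB_continuous|exact: wB_L10].
rewrite Rint_wB ?lapsym_ge0// mulrCA mulVf ?mulr1//.
by rewrite gt_eqF// gam_gt0.
Qed.

Let wK0 s t : 0 <= wK s 1 t :> R. Proof. exact: wK_ge0. Qed.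

Lemma fracker_L1 s : 0 < s < 1 -> L1 mu (fracker s).
Proof.
by move=> s01; apply: L1Z; apply: heat_mix_L1 => [t||]; [exact: wK0|exact: wK_continuous|exact: wK_L1].
Qed.

Lemma frackerN s x : fracker s (- x) = fracker s x.
Proof. by rewrite /fracker heat_mixN. Qed.

Lemma ct_fracker s xi : 0 < s < 1 ->
  ct mu (fracker s) xi = (1 + lapsym xi) `^ s - lapsym xi `^ s.
Proof.
move=> s01; rewrite ct_scale; last first.
  by apply: heat_mix_L1 => [t||]; [exact: wK0|exact: wK_continuous|exact: wK_L1].
rewrite ct_heat_mix => [|t||]; [|exact: wK0|exact: wK_continuous|exact: wK_L1].
rewrite Rint_wK_exp ?lapsym_ge0// mulrCA mulVf ?mulr1//.
by rewrite gt_eqF// gamK_gt0.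
Qed.

End mixtures.

(** * The truncated Bessel kernel and its remainder *)

Section cutoff.
Context {R : realType}.
Implicit Types (t u y a b r : R).

(** A quadratic error bound settles differentiability at the point where two pieces of a definition
    meet. *)
Lemma is_derive_quadratic (f : R -> R) t (a C : R) : 0 <= C ->
  (forall h, `|f (t + h) - f t - a * h| <= C * h ^+ 2) -> is_derive t 1 f a.
Proof.
move=> C0 H.
have L : h^-1 *: ((f \o shift t) (h *: (1 : R)) - f t) @[h --> (0 : R)^'] --> a.
  have C1 : 0 < C + 1 by lra.
  apply/cvgrPdist_le => /= e e0; near=> h.
  have h0 : h != 0 by near: h; exact: nbhs_dnbhs_neq.
  rewrite /= /GRing.scale /= mulr1 distrC [h + t]addrC.
  rewrite (_ : _ - a = h^-1 * (f (t + h) - f t - a * h)); last by field.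
  have hn0 : 0 < `|h| by rewrite normr_gt0.
  rewrite normrM normfV ler_pdivrMl// (le_trans (H h))// -real_normK ?num_real//.
  have he : `|h| <= e / (C + 1) by near: h; apply: dnbhs0_le; rewrite divr_gt0.
  rewrite ler_pdivlMr// in he; rewrite expr2 mulrCA ler_wpM2l ?(ltW hn0)//.
  by apply: le_trans he; rewrite mulrDr mulr1 mulrC lerDl ltW.
split; first by apply/cvg_ex; eexists; exact: L.
by apply/cvg_lim.
Unshelve. all: by end_near. Qed.

Definition pos (m : nat) t : R := Num.max t 0 ^+ m.

Lemma pos_ge0 m t : 0 <= pos m t.
Proof. by rewrite exprn_ge0// le_max lexx orbT. Qed.

Lemma posS m t : t * pos m.+1 t = pos m.+2 t.
Proof. by rewrite /pos maxEle; case: ifP => _; rewrite ?exprS//; rewrite !mul0r mulr0. Qed.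

(** Only the square needs a look at the junction 0; higher powers follow from [posS] and the product
    rule. *)
Lemma dpos m t : is_derive t 1 (pos m.+2) (m.+2%:R * pos m.+1 t).
Proof.
elim: m => [|m IH].
  apply: (is_derive_quadratic ler01) => h; rewrite /pos expr1 !maxEle.
  by rewrite ler_norml; case: (leP (t + h) 0) => ?; case: (leP t 0) => ?; apply/andP; split; nra.
rewrite (_ : pos m.+3 = fun u => u * pos m.+2 u); last by apply/funext => u; rewrite posS.
apply: (deq (dmul (did t) IH)).
by rewrite mul1r (mulrCA t) posS -[m.+3]addn1 natrD; ring.
Qed.

Lemma pos_continuous m : continuous (pos m.+1).
Proof.
move=> t; case: m => [|m]; last exact: is_derive_continuous (dpos m t).
rewrite (_ : pos 1 = fun u => (u + `|u|) / 2); last first.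
  by apply/funext => u; rewrite /pos expr1 maxEle; case: leP => u0; [rewrite ler0_norm//|rewrite gtr0_norm//]; lra.
apply: cvgM; last exact: cvg_cst.
by apply: cvgD; [exact: cvg_id|exact: norm_continuous].
Qed.

(* The derivative of [kap0] is [630 y^4 (1 - y)_+^4], normalised so that
   [kap0] climbs from 0 at 0 to 1 at 1, with four vanishing derivatives at both ends. *)
Definition kap0 y : R := 1 - (126 * pos 5 (1 - y) - 420 * pos 6 (1 - y) + 540 * pos 7 (1 - y)
  - 315 * pos 8 (1 - y) + 70 * pos 9 (1 - y)).
Definition kap1 y : R := 630 * y ^+ 4 * pos 4 (1 - y).
Definition kap2 y : R := 2520 * (y ^+ 3 * pos 4 (1 - y) - y ^+ 4 * pos 3 (1 - y)).
Definition kap3 y : R := 2520 * (3 * y ^+ 2 * pos 4 (1 - y) - 8 * y ^+ 3 * pos 3 (1 - y)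
  + 3 * y ^+ 4 * pos 2 (1 - y)).
Definition kap4 y : R := 2520 * (6 * y * pos 4 (1 - y) - 36 * y ^+ 2 * pos 3 (1 - y)
  + 36 * y ^+ 3 * pos 2 (1 - y) - 6 * y ^+ 4 * pos 1 (1 - y)).

Let dpos1 m y : is_derive y 1 (fun u => pos m.+2 (1 - u)) (- (m.+2%:R * pos m.+1 (1 - y))).
Proof.
have d1 : is_derive y 1 (fun u : R => 1 - u) (- 1 : R).
  by apply: (deq (dadd (dcst y 1) (dopp (did y)))); rewrite add0r.
by apply: (deq (@dcomp _ y (pos m.+2) (fun u => 1 - u) _ _ (dpos m (1 - y)) d1)); rewrite mulrN1.
Qed.

Let dpow (m : nat) y : is_derive y 1 (fun u => u ^+ m.+1) (m.+1%:R * y ^+ m).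
Proof.
elim: m => [|m IH].
  by rewrite (_ : (fun u : R => u ^+ 1) = id)//; apply: (deq (did y)); rewrite expr0 mulr1.
rewrite (_ : (fun u => _) = fun u => u * u ^+ m.+1); last by apply/funext => u; rewrite exprS.
by apply: (deq (dmul (did y) IH)); rewrite -[m.+2]addn1 natrD exprS; ring.
Qed.

Let pos_shift m y : pos m.+2 (1 - y) = pos m.+1 (1 - y) - y * pos m.+1 (1 - y).
Proof. by rewrite -posS; ring. Qed.

Lemma dkap0 y : is_derive y 1 kap0 (kap1 y).
Proof.
apply: (deq (dadd (dcst y 1) (dopp (dadd (dadd (dadd (dadd
  (dmul (dcst y 126) (dpos1 3 y)) (dopp (dmul (dcst y 420) (dpos1 4 y))))
  (dmul (dcst y 540) (dpos1 5 y))) (dopp (dmul (dcst y 315) (dpos1 6 y))))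
  (dmul (dcst y 70) (dpos1 7 y)))))).
rewrite /kap1 !pos_shift; ring.
Qed.

Lemma dkap1 y : is_derive y 1 kap1 (kap2 y).
Proof.
by apply: (deq (dmul (dmul (dcst y 630) (dpow 3 y)) (dpos1 2 y))); rewrite /kap2; ring.
Qed.

Lemma dkap2 y : is_derive y 1 kap2 (kap3 y).
Proof.
apply: (deq (dmul (dcst y 2520) (dadd (dmul (dpow 2 y) (dpos1 2 y))
  (dopp (dmul (dpow 3 y) (dpos1 1 y)))))); rewrite /kap3; ring.
Qed.

Lemma dkap3 y : is_derive y 1 kap3 (kap4 y).
Proof.
apply: (deq (dmul (dcst y 2520) (dadd (dadd (dmul (dmul (dcst y 3) (dpow 1 y)) (dpos1 2 y))
  (dopp (dmul (dmul (dcst y 8) (dpow 2 y)) (dpos1 1 y))))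
  (dmul (dmul (dcst y 3) (dpow 3 y)) (dpos1 0 y))))); rewrite /kap4; ring.
Qed.

Lemma kap4_continuous : continuous kap4.
Proof.
have cp m : continuous (fun y => pos m.+1 (1 - y)).
  move=> y; apply: (@continuous_comp _ _ _ (fun u : R => 1 - u) (pos m.+1)); last exact: pos_continuous.
  by apply: cvgB; [exact: cvg_cst|exact: cvg_id].
have cm c m : continuous (fun y : R => c * y ^+ m).
  by move=> y; apply: cvgM; [exact: cvg_cst|exact: exprn_continuous].
move=> y; apply: cvgM; first exact: cvg_cst.
apply: cvgB; last by apply: cvgM; [exact: cm|exact: cp].
apply: cvgD; last by apply: cvgM; [exact: cm|exact: cp].
apply: cvgB; last by apply: cvgM; [exact: cm|exact: cp].
by apply: cvgM; [exact: (cm 6 1%N)|exact: cp].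
Qed.

Let pos_le m y (i j : nat) : (j <= i)%N -> 0 <= y -> y ^+ i * pos m.+1 (1 - y) <= y ^+ j.
Proof.
move=> ji y0; have [y1|y1] := leP 1 y.
  by rewrite {1}/pos (max_idPr _) ?subr_le0// expr0n /= mulr0 exprn_ge0.
have h1 : y ^+ i <= y ^+ j by apply: ler_wiXn2l => //; exact: ltW.
have h2 : pos m.+1 (1 - y) <= 1.
  have y1' := ltW y1.
  by rewrite /pos (max_idPl _) ?subr_ge0// exprn_ile1 ?subr_ge0// gerBl.
by apply: le_trans h1; rewrite -[leRHS]mulr1 ler_wpM2l// exprn_ge0.
Qed.

Let pos_ge m y (i : nat) : 0 <= y -> 0 <= y ^+ i * pos m.+1 (1 - y).
Proof. by move=> y0; apply: mulr_ge0; [exact: exprn_ge0|exact: pos_ge0]. Qed.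

(** 84 = 6 + 36 + 36 + 6 is the sum of the coefficients of [kap4]. The same constant serves the
    lower derivatives: the j-th one is at most [kapC] times y^(4 - j), and this order of vanishing
    at 0 later compensates the powers of 1 / l. *)
Definition kapC : R := 2520 * 84.

Lemma kapC_ge0 : 0 <= kapC.
Proof. by apply: mulr_ge0; exact: ler0n. Qed.

Lemma kap4_le y : 0 <= y -> `|kap4 y| <= kapC.
Proof.
move=> y0; rewrite ler_norml /kap4 /kapC -!mulrA.
have := (@pos_le 3 y 1 0 isT y0, @pos_le 2 y 2 0 isT y0, @pos_le 1 y 3 0 isT y0, @pos_le 0 y 4 0 isT y0).
have := (@pos_ge 3 y 1 y0, @pos_ge 2 y 2 y0, @pos_ge 1 y 3 y0, @pos_ge 0 y 4 y0).
rewrite !expr0 expr1; move=> [[[? ?] ?] ?] [[[? ?] ?] ?]; apply/andP; split; lra.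
Qed.

Lemma kap3_le y : 0 <= y -> `|kap3 y| <= kapC * y.
Proof.
move=> y0; rewrite ler_norml /kap3 /kapC -!mulrA.
have := (@pos_le 3 y 2 1 isT y0, @pos_le 2 y 3 1 isT y0, @pos_le 1 y 4 1 isT y0).
have := (@pos_ge 3 y 2 y0, @pos_ge 2 y 3 y0, @pos_ge 1 y 4 y0).
rewrite !expr1; move=> [[? ?] ?] [[? ?] ?]; apply/andP; split; lra.
Qed.

Lemma kap2_le y : 0 <= y -> `|kap2 y| <= kapC * y ^+ 2.
Proof.
move=> y0; rewrite ler_norml /kap2 /kapC -!mulrA.
have := (@pos_le 3 y 3 2 isT y0, @pos_le 2 y 4 2 isT y0).
have := (@pos_ge 3 y 3 y0, @pos_ge 2 y 4 y0).
move=> [? ?] [? ?]; apply/andP; split; lra.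
Qed.

Lemma kap1_le y : 0 <= y -> `|kap1 y| <= kapC * y ^+ 3.
Proof.
move=> y0; rewrite ler_norml /kap1 /kapC -!mulrA.
have := @pos_le 3 y 4 3 isT y0; have := @pos_ge 3 y 4 y0.
move=> ? ?; apply/andP; split; lra.
Qed.

Lemma kap0_le y : 0 <= y -> `|kap0 y| <= kapC * y ^+ 4.
Proof.
rewrite le_eqVlt => /predU1P[<-|y0].
  by rewrite /kap0 /pos subr0 (max_idPl _)// !expr1n expr0n /= mulr0 normr_le0; apply/eqP; ring.
have := @MVT_segment R kap0 kap1 0 y (ltW y0).
case=> [t _|| t].
- exact: dkap0.
- by apply: continuous_subspaceT => t; exact: is_derive_continuous (dkap0 t).
rewrite in_itv /= => /andP[t0 ty]; have -> : kap0 0 = 0.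
  by rewrite /kap0 /pos subr0 (max_idPl _)// !expr1n; ring.
rewrite !subr0 => ->; rewrite normrM (gtr0_norm y0) [y ^+ 4]exprSr mulrA.
have y0' := ltW y0; rewrite ler_wpM2r//.
apply: le_trans (kap1_le t0) _; apply: (ler_wpM2l kapC_ge0).
by apply: lerXn2r => //; rewrite nnegrE.
Qed.

Lemma kap0_1 y : 1 <= y -> kap0 y = 1.
Proof. by move=> y1; rewrite /kap0 /pos (max_idPr _) ?subr_le0// !expr0n /=; ring. Qed.

End cutoff.

(** * The Laplacian of a radial function and its transform *)

Section radial_laplacian.
Context (R : realType) (n : nat).
Variable mu : {sigma_finite_measure set (Rn R n) -> \bar R}.
Hypothesis mu_leb : is_lebesgue mu.
Implicit Types (x y xi : 'rV[R]_n) (r t : R).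

Variables (phi phi1 phi2 : R -> R) (C c : R).
Hypothesis c0 : 0 < c.
Hypothesis phi'E : forall r, is_derive r 1 phi (phi1 r).
Hypothesis phi1'E : forall r, is_derive r 1 phi1 (phi2 r).
Hypothesis phi2_cont : continuous phi2.
Hypothesis phi_le : forall r, 0 <= r -> `|phi r| <= C * expR (- r / c).
Hypothesis phi1_le : forall r, 0 <= r -> `|phi1 r| <= C * expR (- r / c).
Hypothesis phi2_le : forall r, 0 <= r -> `|phi2 r| <= C * expR (- r / c).

(** The Laplacian of phi(|x|^2): its second partial in direction i is 2 phi1 + 4 x_i^2 phi2. *)
Definition radlap x : R := 2 * n%:R * phi1 (dotv x x) + 4 * dotv x x * phi2 (dotv x x).

Let phi_cont : continuous phi. Proof. by move=> r; exact: is_derive_continuous (phi'E r). Qed.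
Let phi1_cont : continuous phi1. Proof. by move=> r; exact: is_derive_continuous (phi1'E r). Qed.

Lemma radial_measurable (f : R -> R) : continuous f ->
  measurable_fun setT (fun x : Rn R n => f (dotv x x)).
Proof.
move=> cf; apply: (measurableT_comp (f := f)); first exact: continuous_measurable_fun.
exact: dotvv_measurable.
Qed.

Let C0 : 0 <= C.
Proof.
by have := le_trans (normr_ge0 _) (phi_le (lexx 0)); rewrite pmulr_lge0// expR_gt0.
Qed.

Let poly_le r : 0 <= r -> (1 + r) * expR (- r / c) <= (1 + 2 * c) * expR (- r / (2 * c)).
Proof.
move=> r0; have cn0 := lt0r_neq0 c0.
have -> : - r / c = - (r / (2 * c)) + - (r / (2 * c)) by field.
have -> : - r / (2 * c) = - (r / (2 * c)) by rewrite mulNr.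
set z := r / (2 * c); have z0 : 0 <= z by rewrite divr_ge0// mulr_ge0// ltW.
have rE : r = 2 * c * z by rewrite /z; field.
rewrite expRD mulrA ler_wpM2r ?expR_ge0// rE mulrDl mul1r lerD//.
  by rewrite -expR0 ler_expR oppr_le0.
have c2 : 0 <= 2 * c by rewrite mulr_ge0// ltW.
rewrite -mulrA -[leRHS]mulr1 ler_wpM2l//.
by have := pow_expRN 1 z0; rewrite expr1.
Qed.

Lemma radial_L1 : L1 mu (fun x => phi (dotv x x)).
Proof.
apply: (@L1_le _ _ R mu _ (fun x => C * expR (- dotv x x / c))).
- exact: radial_measurable.
- by move=> x; rewrite (le_trans (phi_le (dotv_ge0 x)))// ler_norm.
- by apply: L1Z; exact: gauss_L1.
Qed.

Lemma radlap_measurable : measurable_fun setT (radlap : Rn R n -> R).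
Proof.
apply: measurable_funD; apply: measurable_funM => //.
- exact: radial_measurable.
- by apply: measurable_funM => //; exact: dotvv_measurable.
- exact: radial_measurable.
Qed.

Lemma radlap_L1 : L1 mu radlap.
Proof.
apply: (@L1_le _ _ R mu _ (fun x => (2 * n%:R + 4) * C * (1 + 2 * c) * expR (- dotv x x / (2 * c)))).
- exact: radlap_measurable.
- move=> x; have r0 := dotv_ge0 x; rewrite /radlap (le_trans _ (ler_norm _))//.
  apply: (@le_trans _ _ ((2 * n%:R + 4) * C * ((1 + dotv x x) * expR (- dotv x x / c)))); last first.
    by rewrite -[leRHS]mulrA ler_wpM2l ?poly_le// mulr_ge0// addr_ge0// mulr_ge0.
  have n0 : 0 <= 2 * n%:R :> R by rewrite mulr_ge0.
  have r4 : 0 <= 4 * dotv x x by rewrite mulr_ge0.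
  apply: le_trans (ler_normD _ _) _; rewrite normrM (ger0_norm n0) normrM (ger0_norm r4).
  have p1 := phi1_le r0; have p2 := phi2_le r0; have e0 := expR_ge0 (- dotv x x / c).
  set E := C * expR _ in p1 p2; have E0 : 0 <= E by rewrite mulr_ge0.
  apply: (@le_trans _ _ (2 * n%:R * E + 4 * dotv x x * E)).
    by apply: lerD; apply: ler_wpM2l.
  rewrite (_ : _ * C * _ = (2 * n%:R + 4) * (1 + dotv x x) * E); last by rewrite /E; ring.
  rewrite -mulrDl ler_wpM2r//.
  have := mulr_ge0 (ler0n R n) r0; lra.
- by apply: L1Z; apply: (gauss_L1 mu_leb); rewrite mulr_gt0.
Qed.

(** Green's identity: [F] is (d_i phi) cos - phi (d_i cos). Its i-th derivative [dF] has no
    first-order products left, integrates to 0, and summed over i gives the symbol of the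
    Laplacian. *)
Let F (i : 'I_n) xi x := 2 * dotv x (basis_vec R i) * phi1 (dotv x x) * cos (2 * pi * dotv x xi)
  + 2 * pi * xi ord0 i * phi (dotv x x) * sin (2 * pi * dotv x xi).
Let dF (i : 'I_n) xi x := (2 * phi1 (dotv x x) + 4 * x ord0 i ^+ 2 * phi2 (dotv x x)) * cos (2 * pi * dotv x xi)
  + (2 * pi * xi ord0 i) ^+ 2 * phi (dotv x x) * cos (2 * pi * dotv x xi).

Let dFE i xi x : is_derive (0 : R) 1 (fun t : R => F i xi (x + t *: basis_vec R i)) (dF i xi x).
Proof.
set e := basis_vec R i.
have ee : dotv e e = 1 by rewrite /e dotv_basis mxE !eqxx.
have exi : dotv e xi = xi ord0 i by rewrite dotvC dotv_basis.
have x0 : x + (0 : R) *: e = x by rewrite scale0r addr0.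
have dr : is_derive (0 : R) 1 (fun t : R => dotv (x + t *: e) (x + t *: e)) (2 * x ord0 i).
  by apply: (deq (dline x e 0)); rewrite x0 dotv_basis.
have de : is_derive (0 : R) 1 (fun t : R => dotv (x + t *: e) e) (1 : R).
  by apply: (deq (dline1 x e e 0)).
have dx : is_derive (0 : R) 1 (fun t : R => 2 * pi * dotv (x + t *: e) xi) (2 * pi * xi ord0 i).
  by apply: (deq (dmul (dcst 0 (2 * pi)) (dline1 x e xi 0))); rewrite exi mul0r add0r.
have dp : is_derive (0 : R) 1 (fun t : R => phi (dotv (x + t *: e) (x + t *: e))) (phi1 (dotv x x) * (2 * x ord0 i)).
  have h := phi'E (dotv (x + (0 : R) *: e) (x + (0 : R) *: e)).
  apply: (deq (@dcomp _ 0 phi (fun t : R => dotv (x + t *: e) (x + t *: e)) _ _ h dr)).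
  by rewrite x0.
have dp1 : is_derive (0 : R) 1 (fun t : R => phi1 (dotv (x + t *: e) (x + t *: e))) (phi2 (dotv x x) * (2 * x ord0 i)).
  have h := phi1'E (dotv (x + (0 : R) *: e) (x + (0 : R) *: e)).
  apply: (deq (@dcomp _ 0 phi1 (fun t : R => dotv (x + t *: e) (x + t *: e)) _ _ h dr)).
  by rewrite x0.
apply: (deq (dadd (dmul (dmul (dmul (dcst 0 2) de) dp1) (dcos dx))
  (dmul (dmul (dcst 0 (2 * pi * xi ord0 i)) dp) (dsin dx)))).
rewrite x0 /dF /e dotv_basis; ring.
Qed.

Let D (i : 'I_n) xi : R := (4 + `|2 * pi * xi ord0 i| + (2 * pi * xi ord0 i) ^+ 2) * C * (1 + 2 * c).

Let coord_le x i : `|x ord0 i| <= 1 + dotv x x.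
Proof.
have := coord_sqr_le x i; have := sqr_ge0 (`|x ord0 i| - 1).
by rewrite -[x ord0 i ^+ 2]real_normK ?num_real// => ? ?; have := sqr_ge0 `|x ord0 i|; nra.
Qed.

Let E_le i xi x (A : R) : 0 <= A -> A <= (4 + `|2 * pi * xi ord0 i| + (2 * pi * xi ord0 i) ^+ 2) * (1 + dotv x x) ->
  A * (C * expR (- dotv x x / c)) <= D i xi * expR (- dotv x x / (2 * c)).
Proof.
move=> A0 AE; have r0 := dotv_ge0 x.
set k := 4 + _ + _ in AE *.
have k0 : 0 <= k by rewrite !addr_ge0// sqr_ge0.
apply: (@le_trans _ _ (k * C * ((1 + dotv x x) * expR (- dotv x x / c)))).
  rewrite (_ : k * C * _ = k * (1 + dotv x x) * (C * expR (- dotv x x / c))); last by ring.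
  by rewrite ler_wpM2r// mulr_ge0// expR_ge0.
by rewrite /D -[leRHS]mulrA ler_wpM2l ?poly_le// mulr_ge0.
Qed.

Let F_le i xi x : `|F i xi x| <= D i xi * expR (- dotv x x / (2 * c)).
Proof.
have r0 := dotv_ge0 x; have p1 := phi1_le r0; have p := phi_le r0.
rewrite /F dotv_basis; set z := 2 * pi * xi ord0 i.
apply: (le_trans _ (@E_le i xi x (2 * `|x ord0 i| + `|z|) _ _)).
- apply: le_trans (ler_normD _ _) _; rewrite [leRHS]mulrDl; apply: lerD.
  + rewrite normrM -[leRHS]mulr1; apply: ler_pM => //; last exact: cos_max.
    rewrite normrM; apply: ler_pM => //.
    by rewrite normrM (ger0_norm (ler0n R 2)).
  + rewrite normrM -[leRHS]mulr1; apply: ler_pM => //; last exact: sin_max.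
    by rewrite normrM; apply: ler_wpM2l.
- by rewrite addr_ge0// mulr_ge0.
- rewrite -/z; have := coord_le x i; have := mulr_ge0 (normr_ge0 z) r0; have := sqr_ge0 z.
  by move=> h; have := mulr_ge0 h r0; nra.
Qed.

Let dF_le i xi x : `|dF i xi x| <= D i xi * expR (- dotv x x / (2 * c)).
Proof.
have r0 := dotv_ge0 x; have p1 := phi1_le r0; have p := phi_le r0; have p2 := phi2_le r0.
rewrite /dF; set z := 2 * pi * xi ord0 i; have z2 := sqr_ge0 z.
set E := C * expR _ in p p1 p2; have E0 : 0 <= E by rewrite mulr_ge0// expR_ge0.
apply: (le_trans _ (@E_le i xi x (2 + 4 * x ord0 i ^+ 2 + z ^+ 2) _ _)); rewrite -/E -/z.
- rewrite -mulrDl normrM -[leRHS]mulr1; apply: ler_pM => //; last exact: cos_max.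
  have x2 : 0 <= 4 * x ord0 i ^+ 2 by rewrite mulr_ge0// sqr_ge0.
  apply: le_trans (ler_normD _ _) _; rewrite [leRHS]mulrDl; apply: lerD.
    apply: le_trans (ler_normD _ _) _; rewrite [leRHS]mulrDl; apply: lerD.
      by rewrite normrM (ger0_norm (ler0n R 2)); apply: ler_wpM2l.
    by rewrite normrM (ger0_norm x2); apply: ler_wpM2l.
  by rewrite normrM (ger0_norm z2); apply: ler_wpM2l.
- by have := sqr_ge0 (x ord0 i); lra.
- have := coord_sqr_le x i; have := mulr_ge0 (normr_ge0 z) r0; have := normr_ge0 z.
  by have := mulr_ge0 z2 r0; nra.
Qed.

Let coord_dot_measurable i : measurable_fun setT (fun x : Rn R n => x ord0 i) := @coord_measurable R n i.

Let F_measurable i xi : measurable_fun setT (F i xi : Rn R n -> R).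
Proof.
apply: measurable_funD; apply: measurable_funM.
- apply: measurable_funM; last exact: radial_measurable.
  by apply: measurable_funM => //; exact: dotv_measurable.
- exact: cos_dot_measurable.
- by apply: measurable_funM => //; exact: radial_measurable.
- exact: sin_dot_measurable.
Qed.

Let dF_measurable i xi : measurable_fun setT (dF i xi : Rn R n -> R).
Proof.
apply: measurable_funD; apply: measurable_funM; [|exact: cos_dot_measurable| |exact: cos_dot_measurable].
- apply: measurable_funD; apply: measurable_funM => //; [exact: radial_measurable| |exact: radial_measurable].
  by apply: measurable_funM => //; apply: measurable_funX; exact: coord_dot_measurable.
- by apply: measurable_funM => //; exact: radial_measurable.
Qed.

Lemma ct_radlap xi : ct mu radlap xi = - (lapsym xi * ct mu (fun x => phi (dotv x x)) xi).
Proof.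
have c20 : 0 < 2 * c by rewrite mulr_gt0.
have i0 i : \int[mu]_x dF i xi x = 0.
  exact: (Rint_dirder0_gauss mu_leb c20 (dFE i xi) (F_measurable i xi) (dF_measurable i xi)
    (F_le i xi) (dF_le i xi)).
have dFi i : L1 mu (dF i xi).
  apply: (@L1_le _ _ R mu _ (fun x => D i xi * expR (- dotv x x / (2 * c)))).
  - exact: dF_measurable.
  - by move=> x; rewrite (le_trans (dF_le i xi x))// ler_norm.
  - by apply: L1Z; exact: gauss_L1.
have := Rint_sum dFi; rewrite big1// => S0.
have ri := L1_cos xi radlap_L1; have pi_ := L1_cos xi radial_L1.
apply/eqP; rewrite -addr_eq0; apply/eqP; rewrite -[RHS]S0.
rewrite [ct _ (fun x => _) _]/ct -RintZT// -RintDT//; last exact: L1Z.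
apply: eq_RintegralT => x; rewrite /dF big_split /= -!mulr_suml big_split /= -!mulr_suml.
have -> : \sum_(i < n) 4 * x ord0 i ^+ 2 = 4 * dotv x x.
  by rewrite -mulr_sumr /dotv; congr (_ * _); apply: eq_bigr => i _; rewrite expr2.
have -> : \sum_(i < n) 2 = 2 * n%:R :> R by rewrite sumr_const card_ord mulr_natr.
have -> : \sum_(i < n) (2 * pi * xi ord0 i) ^+ 2 = lapsym xi.
  rewrite /lapsym /dotv mulr_sumr; apply: eq_bigr => i _; ring.
by rewrite /radlap; ring.
Qed.

Lemma ct_sub_radlap xi : ct mu (fun x => phi (dotv x x) - radlap x) xi =
  (1 + lapsym xi) * ct mu (fun x => phi (dotv x x)) xi.
Proof.
rewrite mulrDl mul1r -[_ * ct _ _ _]opprK -ct_radlap /ct -RintBT; [|exact: L1_cos radial_L1|exact: L1_cos radlap_L1].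
by apply: eq_RintegralT => x; rewrite mulrBl.
Qed.

End radial_laplacian.

(** * The operator 1 - Lap on a radial profile times a Gaussian *)

Section parametrix.
Context (R : realType) (n : nat).
Variable mu : {sigma_finite_measure set (Rn R n) -> \bar R}.
Hypothesis mu_leb : is_lebesgue mu.
Implicit Types (x y xi : 'rV[R]_n) (r t b l c s : R).

(** [pow_expRN] at y = (1 + r) / c; the shift from r to 1 + r costs e^(1/c). *)
Lemma pow_gauss_le (m : nat) r c : 0 < c -> 0 <= r ->
  (1 + r) ^+ m * expR (- r / c) <= c ^+ m * m`!%:R * expR c^-1.
Proof.
move=> c0 r0; have cn0 := lt0r_neq0 c0.
have y0 : 0 <= (1 + r) / c by rewrite divr_ge0 ?addr_ge0// ltW.
have -> : (1 + r) ^+ m * expR (- r / c) = c ^+ m * (((1 + r) / c) ^+ m * expR (- ((1 + r) / c))) * expR c^-1.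
  rewrite exprMn exprVn mulrA -[in RHS]mulrA -expRD.
  have -> : - ((1 + r) / c) + c^-1 = - r / c by field.
  by congr (_ * _); field; rewrite expf_neq0.
rewrite ler_wpM2r ?expR_ge0// ler_wpM2l ?exprn_ge0 ?pow_expRN//; exact: ltW.
Qed.

(* If [g1], [g2] are the derivatives of [g], then [(1 - Lap) (g(|x|^2) e^(-b|x|^2))]
   is [Afun b g g1 g2 |x|^2 e^(-b|x|^2)]. *)
Definition Afun b (g g1 g2 r : R) : R :=
  g - 2 * n%:R * (g1 - b * g) - 4 * r * (g2 - 2 * b * g1 + b ^+ 2 * g).

(** Each factor b = 1 / (4 l) produced by differentiating the Gaussian meets a factor r, since [g]
    and [g1] vanish to matching order. The bound therefore sees l only through the scale-free
    quantity b r. *)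
Lemma Bfun_le b (g g1 g2 r M : R) : 0 <= b -> 0 <= r ->
  `|g| <= M * r ^+ 2 -> `|g1| <= M * r -> `|g2| <= M ->
  `|g2 - 2 * b * g1 + b ^+ 2 * g| <= M * (1 + b * r) ^+ 2.
Proof.
move=> b0 r0 h0 h1 h2; have b20 := sqr_ge0 b.
have -> : M * (1 + b * r) ^+ 2 = M + 2 * b * (M * r) + b ^+ 2 * (M * r ^+ 2) by ring.
apply: le_trans (ler_normD _ _) _; apply: lerD; last first.
  by rewrite normrM (ger0_norm b20) ler_wpM2l.
apply: le_trans (ler_normB _ _) _; apply: lerD => //.
have b2 : 0 <= 2 * b by rewrite mulr_ge0.
by rewrite normrM (ger0_norm b2) ler_wpM2l.
Qed.

(** The estimate is pointwise in r, so [M] may itself contain powers of r; this is how one lemma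
    serves every order of vanishing. One application of 1 - Lap turns order two into order one. *)
Lemma Afun_le b (g g1 g2 r M : R) : 0 <= b -> 0 <= r ->
  `|g| <= M * r ^+ 2 -> `|g1| <= M * r -> `|g2| <= M ->
  `|Afun b g g1 g2 r| <= M * ((2 * n%:R + 4) * (r * (1 + r) * (1 + b * r) ^+ 2)).
Proof.
move=> b0 r0 h0 h1 h2; have hB := Bfun_le b0 r0 h0 h1 h2.
have M0 : 0 <= M := le_trans (normr_ge0 _) h2.
have n0 : 0 <= 2 * n%:R :> R by rewrite mulr_ge0.
have r40 : 0 <= 4 * r by rewrite mulr_ge0.
have br0 : 0 <= b * r by rewrite mulr_ge0.
apply: (@le_trans _ _ (M * r ^+ 2 + 2 * n%:R * (M * r + b * (M * r ^+ 2)) + 4 * r * (M * (1 + b * r) ^+ 2))).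
  apply: le_trans (ler_normB _ _) _; apply: lerD; last first.
    by rewrite normrM (ger0_norm r40) ler_wpM2l.
  apply: le_trans (ler_normB _ _) _; apply: lerD => //.
  rewrite normrM (ger0_norm n0) ler_wpM2l//.
  apply: le_trans (ler_normB _ _) _; apply: lerD => //.
  by rewrite normrM (ger0_norm b0) ler_wpM2l.
rewrite (_ : _ + _ = M * (r * (r + 2 * n%:R * (1 + b * r) + 4 * (1 + b * r) ^+ 2))); last by ring.
apply: ler_wpM2l => //; rewrite -[r * (1 + r) * _]mulrA [leRHS]mulrCA; apply: ler_wpM2l => //.
move: (b * r) br0 (2 * n%:R) n0 => z z0 N N0.
have z1 : 1 + z <= (1 + z) ^+ 2 by nra.
have z2 : 1 <= (1 + z) ^+ 2 by nra.
set Z := (1 + z) ^+ 2 in z1 z2 *.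
have h3 : N * (1 + z) <= N * Z by rewrite ler_wpM2l.
have h4 : 0 <= N * (r * Z) by rewrite !mulr_ge0//; lra.
have h5 : r <= r * Z by rewrite ler_peMr.
by nra.
Qed.

Definition Bfun b (g g1 g2 : R) : R := g2 - 2 * b * g1 + b ^+ 2 * g.

Section gauss_step.
Variables (l M : R) (m : nat) (g g1 g2 : R -> R).
Hypothesis l0 : 0 < l.
Hypothesis dg : forall r, is_derive r 1 g (g1 r).
Hypothesis dg1 : forall r, is_derive r 1 g1 (g2 r).
Hypothesis g2c : continuous g2.
Hypotheses (g_le : forall r, 0 <= r -> `|g r| <= M * (1 + r) ^+ m)
  (g1_le : forall r, 0 <= r -> `|g1 r| <= M * (1 + r) ^+ m)
  (g2_le : forall r, 0 <= r -> `|g2 r| <= M * (1 + r) ^+ m).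

Let b : R := (4 * l)^-1.
Let N : R := Num.sqrt (4 * pi * l) ^- n.
Let e r : R := N * expR (- r / (4 * l)).
Let phi r : R := g r * e r.
Let phi1 r : R := (g1 r - b * g r) * e r.
Let phi2 r : R := (g2 r - 2 * b * g1 r + b ^+ 2 * g r) * e r.

Let b0 : 0 <= b. Proof. by rewrite invr_ge0 mulr_ge0// ltW. Qed.
Let N0 : 0 <= N. Proof. by rewrite invr_ge0 exprn_ge0// sqrtr_ge0. Qed.
Let e0 r : 0 <= e r. Proof. by rewrite mulr_ge0// expR_ge0. Qed.

Let de r : is_derive r 1 e (- (b * e r)).
Proof.
apply: (deq (dmul (dcst r N) (dexp (dmul (dopp (did r)) (dcst r (4 * l)^-1))))).
by rewrite /e /b; ring.
Qed.

Let dphi r : is_derive r 1 phi (phi1 r).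
Proof. by apply: (deq (dmul (dg r) (de r))); rewrite /phi1; ring. Qed.

Let dphi1 r : is_derive r 1 phi1 (phi2 r).
Proof.
apply: (deq (dmul (dadd (dg1 r) (dopp (dmul (dcst r b) (dg r)))) (de r))).
by rewrite /phi2; ring.
Qed.

Let phi2_cont : continuous phi2.
Proof.
have c1 : continuous g1 by move=> r; exact: is_derive_continuous (dg1 r).
have cg : continuous g by move=> r; exact: is_derive_continuous (dg r).
move=> r; apply: cvgM; last exact: is_derive_continuous (de r).
apply: cvgD; last by apply: cvgM; [exact: cvg_cst|exact: cg].
apply: cvgB; first exact: g2c.
by apply: cvgM; [exact: cvg_cst|exact: c1].
Qed.

Let M0 : 0 <= M.
Proof. by have := le_trans (normr_ge0 _) (g_le (lexx 0)); rewrite addr0 expr1n mulr1. Qed.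

Let C : R := M * (1 + 2 * b + b ^+ 2) * N * ((8 * l) ^+ m * m`!%:R * expR (8 * l)^-1).

Let bound (A : R) r : 0 <= r -> `|A| <= M * (1 + 2 * b + b ^+ 2) * (1 + r) ^+ m ->
  `|A * e r| <= C * expR (- r / (8 * l)).
Proof.
move=> r0 AM; rewrite normrM (ger0_norm (e0 r)).
have l80 : 0 < 8 * l by rewrite mulr_gt0.
have k0 : 0 <= M * (1 + 2 * b + b ^+ 2).
  by rewrite mulr_ge0// addr_ge0 ?sqr_ge0// addr_ge0// mulr_ge0.
have -> : e r = N * (expR (- r / (8 * l)) * expR (- r / (8 * l))).
  rewrite /e -expRD; congr (_ * expR _); field; lra.
apply: (@le_trans _ _ (M * (1 + 2 * b + b ^+ 2) * N * ((1 + r) ^+ m * expR (- r / (8 * l))) * expR (- r / (8 * l)))).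
  rewrite (_ : _ * N * _ * _ = M * (1 + 2 * b + b ^+ 2) * (1 + r) ^+ m * (N * (expR (- r / (8 * l)) * expR (- r / (8 * l))))); last by ring.
  by rewrite ler_wpM2r// !mulr_ge0// expR_ge0.
rewrite ler_wpM2r ?expR_ge0// /C; apply: ler_wpM2l; first by rewrite mulr_ge0.
exact: pow_gauss_le.
Qed.

Let phi_le r : 0 <= r -> `|phi r| <= C * expR (- r / (8 * l)).
Proof.
move=> r0; apply: bound => //; rewrite (le_trans (g_le r0))// mulrAC ler_peMr//.
  by rewrite mulr_ge0// exprn_ge0// addr_ge0.
by rewrite -addrA lerDl addr_ge0 ?sqr_ge0// mulr_ge0.
Qed.

Let phi1_le r : 0 <= r -> `|phi1 r| <= C * expR (- r / (8 * l)).
Proof.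
move=> r0; apply: bound => //; rewrite mulrAC.
have h := g_le r0; have h1 := g1_le r0; set K := M * _ in h h1 *.
apply: le_trans (ler_normB _ _) _; rewrite normrM (ger0_norm b0).
have K0 : 0 <= K := le_trans (normr_ge0 _) h.
have b2K : 0 <= b ^+ 2 * K by rewrite mulr_ge0// sqr_ge0.
have bK : 0 <= b * K by rewrite mulr_ge0.
by have bh := ler_wpM2l b0 h; rewrite !mulrDr mulr1; move: b bh bK b2K => c ? ? ?; lra.
Qed.

Let phi2_le r : 0 <= r -> `|phi2 r| <= C * expR (- r / (8 * l)).
Proof.
move=> r0; apply: bound => //; rewrite [leRHS]mulrAC.
have h := g_le r0; have h1 := g1_le r0; have h2 := g2_le r0; set K := M * _ in h h1 h2 *.
have b20 : 0 <= 2 * b by rewrite mulr_ge0.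
have bb := sqr_ge0 b.
rewrite [leRHS]mulrDr [K * (1 + _)]mulrDr mulr1; apply: le_trans (ler_normD _ _) _; apply: lerD; last first.
  by rewrite normrM (ger0_norm bb) [leRHS]mulrC ler_wpM2l.
apply: le_trans (ler_normB _ _) _; apply: lerD => //.
by rewrite normrM (ger0_norm b20) [leRHS]mulrC ler_wpM2l.
Qed.

Let l80 : 0 < 8 * l. Proof. by rewrite mulr_gt0. Qed.

Lemma ct_gauss_step xi :
  ct mu (fun x => Afun b (g (dotv x x)) (g1 (dotv x x)) (g2 (dotv x x)) (dotv x x) * heat l x) xi =
  (1 + lapsym xi) * ct mu (fun x => g (dotv x x) * heat l x) xi.
Proof.
rewrite -[RHS](ct_sub_radlap mu_leb l80 dphi dphi1 phi2_cont phi_le phi1_le phi2_le).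
apply: eq_RintegralT => x; congr (_ * _).
have -> : heat l x = e (dotv x x) by [].
by rewrite /radlap /phi /phi1 /phi2 /Afun; move: (e _) b => E c; ring.
Qed.

End gauss_step.
End parametrix.

(** * The remainder kernel left by the truncation *)

Section parametrix_remainder.
Context (R : realType) (n : nat).
Variable mu : {sigma_finite_measure set (Rn R n) -> \bar R}.
Hypothesis mu_leb : is_lebesgue mu.
Local Notation leb := (@lebesgue_measure R).
Implicit Types (x y xi : 'rV[R]_n) (r t b l s : R).
Variable rho0 : R.
Hypothesis rho0_gt0 : 0 < rho0.

Let K : R := kapC / rho0 ^+ 4.
Let k0 r : R := kap0 (r / rho0).
Let k1 r : R := kap1 (r / rho0) / rho0.
Let k2 r : R := kap2 (r / rho0) / rho0 ^+ 2.
Let k3 r : R := kap3 (r / rho0) / rho0 ^+ 3.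
Let k4 r : R := kap4 (r / rho0) / rho0 ^+ 4.

Let K0 : 0 <= K. Proof. by rewrite mulr_ge0 ?kapC_ge0// invr_ge0 exprn_ge0// ltW. Qed.
Let rn0 : rho0 != 0. Proof. exact: lt0r_neq0. Qed.

Let dscale (f : R -> R) (a : R) r : is_derive (r / rho0) 1 f a ->
  is_derive r 1 (fun u => f (u / rho0)) (a / rho0).
Proof.
move=> fa; have d1 : is_derive r 1 (fun u : R => u / rho0) rho0^-1.
  by apply: (deq (dmul (did r) (dcst r rho0^-1))); rewrite mulr0 addr0 mul1r.
exact: (@dcomp _ r f (fun u => u / rho0) _ _ fa d1).
Qed.

Let dk0 r : is_derive r 1 k0 (k1 r). Proof. exact: dscale (dkap0 _). Qed.
Let dk1 r : is_derive r 1 k1 (k2 r).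
Proof.
apply: (deq (dmul (dscale (dkap1 _)) (dcst r rho0^-1))); rewrite /k2; field; exact: rn0.
Qed.
Let dk2 r : is_derive r 1 k2 (k3 r).
Proof.
apply: (deq (dmul (dscale (dkap2 _)) (dcst r (rho0 ^+ 2)^-1))); rewrite /k3; field; exact: rn0.
Qed.
Let dk3 r : is_derive r 1 k3 (k4 r).
Proof.
apply: (deq (dmul (dscale (dkap3 _)) (dcst r (rho0 ^+ 3)^-1))); rewrite /k4; field; exact: rn0.
Qed.

Let k4_continuous : continuous k4.
Proof.
move=> r; apply: cvgM; last exact: cvg_cst.
apply: (@continuous_comp _ _ _ (fun u : R => u / rho0) kap4); last exact: kap4_continuous.
by apply: cvgM; [exact: cvg_id|exact: cvg_cst].
Qed.

Let scale_le (f : R -> R) (m j : nat) r : (m + j = 4)%N -> 0 <= r ->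
  (forall y : R, 0 <= y -> `|f y| <= kapC * y ^+ m) -> `|f (r / rho0) / rho0 ^+ j| <= K * r ^+ m.
Proof.
move=> mj r0 H; have y0 : 0 <= r / rho0 by rewrite divr_ge0// ltW.
have j0 : 0 < rho0 ^+ j by rewrite exprn_gt0.
rewrite normrM normfV (gtr0_norm j0) ler_pdivrMr//.
apply: le_trans (H _ y0) _; rewrite /K expr_div_n -mj exprD.
rewrite le_eqVlt; apply/orP; left; apply/eqP.
have : rho0 ^+ m != 0 by rewrite expf_neq0.
have : rho0 ^+ j != 0 by rewrite expf_neq0.
move: (rho0 ^+ m) (rho0 ^+ j) => A B A0 B0; field; by rewrite A0 B0.
Qed.

Let k0_le r : 0 <= r -> `|k0 r| <= K * r ^+ 4.
Proof. by move=> r0; have := @scale_le kap0 4 0 r erefl r0 (@kap0_le R); rewrite expr0 divr1. Qed.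
Let k1_le r : 0 <= r -> `|k1 r| <= K * r ^+ 3.
Proof. by move=> r0; have := @scale_le kap1 3 1 r erefl r0 (@kap1_le R); rewrite expr1. Qed.
Let k2_le r : 0 <= r -> `|k2 r| <= K * r ^+ 2.
Proof. move=> r0; exact: (@scale_le kap2 2 2 r erefl r0 (@kap2_le R)). Qed.
Let k3_le r : 0 <= r -> `|k3 r| <= K * r.
Proof. by move=> r0; have := @scale_le kap3 1 3 r erefl r0; rewrite expr1; apply => y; rewrite expr1; exact: kap3_le. Qed.
Let k4_le r : 0 <= r -> `|k4 r| <= K.
Proof. by move=> r0; have := @scale_le kap4 0 4 r erefl r0; rewrite expr0 mulr1; apply => y; rewrite expr0 mulr1; exact: kap4_le. Qed.

Let A b g g1 g2 r := @Afun R n b g g1 g2 r.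
(** [g0] is the radial factor of (1 - Lap) (k0 e^(- b r)), [g1] and [g2] are its derivatives in r.
    The [Bfun] terms come from differentiating the explicit factor r in [Afun], once for [g1] and
    twice for [g2]. *)
Let g0 b r : R := A b (k0 r) (k1 r) (k2 r) r.
Let g1 b r : R := A b (k1 r) (k2 r) (k3 r) r - 4 * Bfun b (k0 r) (k1 r) (k2 r).
Let g2 b r : R := A b (k2 r) (k3 r) (k4 r) r - 8 * Bfun b (k1 r) (k2 r) (k3 r).
Let qA b r : R := A b (g0 b r) (g1 b r) (g2 b r) r.

Let dA b (f f1 f2 f3 : R -> R) r : is_derive r 1 f (f1 r) -> is_derive r 1 f1 (f2 r) -> is_derive r 1 f2 (f3 r) ->
  is_derive r 1 (fun u => A b (f u) (f1 u) (f2 u) u)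
    (A b (f1 r) (f2 r) (f3 r) r - 4 * Bfun b (f r) (f1 r) (f2 r)).
Proof.
move=> d0 d1 d2.
apply: (deq (dadd (dadd d0 (dopp (dmul (dcst r (2 * n%:R)) (dadd d1 (dopp (dmul (dcst r b) d0))))))
  (dopp (dmul (dmul (dcst r 4) (did r)) (dadd (dadd d2 (dopp (dmul (dcst r (2 * b)) d1))) (dmul (dcst r (b ^+ 2)) d0)))))).
by rewrite /A /Afun /Bfun; ring.
Qed.

Let dg0 b r : is_derive r 1 (g0 b) (g1 b r).
Proof. exact: dA (dk0 r) (dk1 r) (dk2 r). Qed.

Let dg1 b r : is_derive r 1 (g1 b) (g2 b r).
Proof.
apply: (deq (dadd (dA b (dk1 r) (dk2 r) (dk3 r)) (dopp (dmul (dcst r 4)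
  (dadd (dadd (dk2 r) (dopp (dmul (dcst r (2 * b)) (dk1 r)))) (dmul (dcst r (b ^+ 2)) (dk0 r))))))).
by rewrite /g2 /Bfun; ring.
Qed.

Let k_continuous : [/\ continuous k0, continuous k1, continuous k2 & continuous k3].
Proof.
by split=> r; [exact: is_derive_continuous (dk0 r)|exact: is_derive_continuous (dk1 r)
  |exact: is_derive_continuous (dk2 r)|exact: is_derive_continuous (dk3 r)].
Qed.

Let g2_continuous b : continuous (g2 b).
Proof.
have [c0 c1 c2 c3] := k_continuous; move=> r.
have cc (a : R) : (fun _ : R => a) x @[x --> r] --> a by exact: cvg_cst.
apply: cvgB; last first.
  apply: cvgM => //; apply: cvgD; last by apply: cvgM => //; exact: c1.
  by apply: cvgB; [exact: c3|apply: cvgM => //; exact: c2].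
apply: cvgB.
  apply: cvgB; first exact: c2.
  apply: cvgM => //; apply: cvgB; [exact: c3|apply: cvgM => //; exact: c2].
apply: cvgM; first by apply: cvgM => //; exact: cvg_id.
apply: cvgD; last by apply: cvgM => //; exact: c2.
by apply: cvgB; [exact: k4_continuous|apply: cvgM => //; exact: c3].
Qed.

(** 2 n + 12 is the 2 n + 4 of [Afun_le] plus 8 for the [Bfun] terms. *)
Let Mg b r : R := K * (2 * n%:R + 12) * (1 + r) * (1 + b * r) ^+ 2.

Let Mg_aux b r (a z : R) : 0 <= b -> 0 <= r -> 0 <= z ->
  a <= (2 * n%:R + 4) * ((1 + r) * (1 + b * r) ^+ 2) + 8 * (1 + b * r) ^+ 2 ->
  K * z * a <= Mg b r * z.
Proof.
move=> b0 r0 z0 aE; rewrite /Mg.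
rewrite (_ : K * _ * _ * _ * z = K * z * ((2 * n%:R + 12) * (1 + r) * (1 + b * r) ^+ 2)); last by ring.
apply: ler_wpM2l; first by rewrite mulr_ge0.
apply: le_trans aE _.
have := sqr_ge0 (1 + b * r); move: (_ ^+ 2) => Z Z0.
have := mulr_ge0 r0 Z0; lra.
Qed.

Let gs_le b r : 0 <= b -> 0 <= r -> [/\ `|g0 b r| <= Mg b r * r ^+ 3,
  `|g1 b r| <= Mg b r * r ^+ 2 & `|g2 b r| <= Mg b r * r].
Proof.
move=> b0 r0; have h0 := k0_le r0; have h1 := k1_le r0; have h2 := k2_le r0.
have h3 := k3_le r0; have h4 := k4_le r0.
have Z0 := sqr_ge0 (1 + b * r).
have E4 : K * r ^+ 4 = K * r ^+ 2 * r ^+ 2 by ring.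
have E3 : K * r ^+ 3 = K * r ^+ 2 * r by ring.
have E3' : K * r ^+ 3 = K * r * r ^+ 2 by ring.
have E2 : K * r ^+ 2 = K * r * r by ring.
have h0' := h0; have h1' := h1; have h1'' := h1; have h2' := h2.
rewrite E4 in h0'; rewrite E3 in h1'; rewrite E3' in h1''; rewrite E2 in h2'.
have r2 : 0 <= r ^+ 2 by rewrite sqr_ge0.
have r3 : 0 <= r ^+ 3 by rewrite exprn_ge0.
split.
- apply: le_trans (Afun_le n b0 r0 h0' h1' h2) _.
  rewrite (_ : K * r ^+ 2 * _ = K * r ^+ 3 * ((2 * n%:R + 4) * ((1 + r) * (1 + b * r) ^+ 2))); last by ring.
  by apply: Mg_aux => //; lra.
- apply: le_trans (ler_normB _ _) _.
  apply: (@le_trans _ _ (K * r ^+ 2 * ((2 * n%:R + 4) * ((1 + r) * (1 + b * r) ^+ 2) + 8 * (1 + b * r) ^+ 2))); last by apply: Mg_aux.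
  rewrite [leRHS]mulrDr; apply: lerD.
    apply: le_trans (Afun_le n b0 r0 h1'' h2' h3) _.
    by rewrite le_eqVlt; apply/orP; left; apply/eqP; ring.
  rewrite normrM (ger0_norm (ler0n R 4)).
  have hB := Bfun_le b0 r0 h0' h1' h2; rewrite -/(Bfun _ _ _ _) in hB.
  have := mulr_ge0 (mulr_ge0 K0 r2) Z0; move: hB; rewrite -/(Bfun _ _ _ _); set u := `|_|; lra.
- apply: le_trans (ler_normB _ _) _.
  apply: (@le_trans _ _ (K * r * ((2 * n%:R + 4) * ((1 + r) * (1 + b * r) ^+ 2) + 8 * (1 + b * r) ^+ 2))); last by apply: Mg_aux.
  rewrite [leRHS]mulrDr; apply: lerD.
    apply: le_trans (Afun_le n b0 r0 h2 h3 h4) _.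
    by rewrite le_eqVlt; apply/orP; left; apply/eqP; ring.
  rewrite normrM (ger0_norm (ler0n R 8)).
  have hB := Bfun_le b0 r0 h1'' h2' h3; rewrite -/(Bfun _ _ _ _) in hB.
  move: hB; set u := `|_|; lra.
Qed.

Let Q1 : R := K * (2 * n%:R + 12) * (2 * n%:R + 4).

Let Q10 : 0 <= Q1. Proof.
have n0 := ler0n R n.
by apply: mulr_ge0; [apply: mulr_ge0|]; [exact: K0|lra|lra].
Qed.

(** After the first application of 1 - Lap the order of vanishing is still three, so [Afun_le]
    applies again with [M] equal to [Mg b r * r]. What remains is polynomial in r and b r, with no
    bare power of b. *)
Let qA_le b r : 0 <= b -> 0 <= r -> `|qA b r| <= Q1 * ((1 + r) ^+ 4 * (1 + b * r) ^+ 4).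
Proof.
move=> b0 r0; have [h0 h1 h2] := gs_le b0 r0.
have E3 : Mg b r * r ^+ 3 = Mg b r * r * r ^+ 2 by ring.
have E2 : Mg b r * r ^+ 2 = Mg b r * r * r by ring.
rewrite E3 in h0; rewrite E2 in h1.
apply: le_trans (Afun_le n b0 r0 h0 h1 h2) _.
rewrite (_ : Mg b r * r * _ = Q1 * (r ^+ 2 * (1 + r) ^+ 2 * (1 + b * r) ^+ 4)); last by rewrite /Mg /Q1; ring.
apply: (ler_wpM2l Q10); apply: ler_wpM2r; first by rewrite exprn_ge0// addr_ge0// mulr_ge0.
rewrite [leRHS](_ : _ = (1 + r) ^+ 2 * (1 + r) ^+ 2); last by ring.
apply: ler_wpM2r; first by rewrite sqr_ge0.
by apply: lerXn2r; rewrite ?nnegrE; lra.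
Qed.

(** (1 - Lap)^2 ((1 - chi) h_l) in closed form. *)
Definition qker l x : R := qA (4 * l)^-1 (dotv x x) * heat l x.

Let qker_measurable : measurable_fun setT (fun z : measurableTypeR R * Rn R n => qker (expR z.1) z.2).
Proof.
pose T := (measurableTypeR R * Rn R n)%type.
have mA (B f f1 f2 r : T -> R) : measurable_fun setT B -> measurable_fun setT f ->
    measurable_fun setT f1 -> measurable_fun setT f2 -> measurable_fun setT r ->
    measurable_fun setT (fun z => A (B z) (f z) (f1 z) (f2 z) (r z)).
  move=> mB mf mf1 mf2 mr; apply: measurable_funB.
    apply: measurable_funB => //; apply: measurable_funM => //.
    by apply: measurable_funB => //; exact: measurable_funM.
  apply: measurable_funM; first exact: measurable_funM.
  apply: measurable_funD; last by apply: measurable_funM => //; exact: measurable_funX.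
  by apply: measurable_funB => //; apply: measurable_funM => //; exact: measurable_funM.
have mBf (B f f1 f2 : T -> R) : measurable_fun setT B -> measurable_fun setT f ->
    measurable_fun setT f1 -> measurable_fun setT f2 ->
    measurable_fun setT (fun z => Bfun (B z) (f z) (f1 z) (f2 z)).
  move=> mB mf mf1 mf2.
  apply: measurable_funD; last by apply: measurable_funM => //; exact: measurable_funX.
  by apply: measurable_funB => //; apply: measurable_funM => //; exact: measurable_funM.
have mr : measurable_fun setT (fun z : T => dotv z.2 z.2).
  exact: (measurableT_comp (@dotvv_measurable R n) measurable_snd).
have mb : measurable_fun setT (fun z : T => (4 * expR z.1)^-1).
  apply: (measurableT_comp (f := fun t : R => (4 * expR t)^-1 : R)) => //.
  apply: continuous_measurable_fun => t.
  apply: (@cvgV R R _ _ (fun t : R => 4 * expR t : R)).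
    by rewrite gt_eqF// mulr_gt0// expR_gt0.
  by apply: cvgM; [exact: cvg_cst|exact: continuous_expR].
have mk (f : R -> R) : continuous f -> measurable_fun setT (fun z : T => f (dotv z.2 z.2)).
  by move=> cf; apply: (measurableT_comp (f := f)) => //; exact: continuous_measurable_fun.
have [c0 c1 c2 c3] := k_continuous.
have m0 := mk _ c0; have m1 := mk _ c1; have m2 := mk _ c2; have m3 := mk _ c3.
have m4 := mk _ k4_continuous.
apply: measurable_funM; last exact: heat_exp_measurable.
apply: (mA _ (fun z : T => g0 (4 * expR z.1)^-1 (dotv z.2 z.2))
  (fun z : T => g1 (4 * expR z.1)^-1 (dotv z.2 z.2))
  (fun z : T => g2 (4 * expR z.1)^-1 (dotv z.2 z.2))) => //.
- exact: mA.
- apply: measurable_funB; first exact: mA.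
  by apply: measurable_funM => //; exact: mBf.
- apply: measurable_funB; first exact: mA.
  by apply: measurable_funM => //; exact: mBf.
Qed.

Let Q : R := Q1 * 4 ^+ 4 * (2 ^+ 8 * 8`!%:R * expR 2^-1) * Num.sqrt 2 ^+ n.

(** In the scaled variable z = r / (4 l) the polynomial is at most a multiple of (1 + l)^4 (1 +
    z)^8, four powers of 1 + z coming from 1 + r <= 4 (1 + l) (1 + z). Half of the Gaussian absorbs
    (1 + z)^8, the other half is a heat kernel of mass 1. The bound stays finite as l tends to 0,
    and (1 + l)^4 is absorbed by the weight [wB]. *)
Let qker_le l x : 0 < l -> `|qker l x| <= Q * (1 + l) ^+ 4 * heat (2 * l) x.
Proof.
move=> l0; have ln0 := lt0r_neq0 l0; set r := dotv x x; set b := (4 * l)^-1.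
have b0 : 0 <= b by rewrite invr_ge0 mulr_ge0// ltW.
have r0 : 0 <= r := dotv_ge0 x.
pose z := b * r; have z0 : 0 <= z by rewrite mulr_ge0.
have rE : r = 4 * l * z by rewrite /z /b; field.
rewrite /qker normrM (ger0_norm (heat_ge0 l x)) heat_split//.
have eE : expR (- (dotv x x / (8 * l))) = expR (- z / 2).
  by congr expR; rewrite -/r /z /b; field.
rewrite eE; have h0 := heat_ge0 (2 * l) x; have s0 : 0 <= Num.sqrt 2 ^+ n :> R by rewrite exprn_ge0.
apply: (@le_trans _ _ (Q1 * ((1 + r) ^+ 4 * (1 + z) ^+ 4) * (Num.sqrt 2 ^+ n * heat (2 * l) x * expR (- z / 2)))).
  by apply: ler_wpM2r; [rewrite !mulr_ge0// expR_ge0|exact: qA_le].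
have l10 : 0 <= 1 + l by lra.
have r4 : (1 + r) ^+ 4 <= (4 * (1 + l) * (1 + z)) ^+ 4.
  by apply: lerXn2r; rewrite ?nnegrE; [lra|rewrite !mulr_ge0//; lra|rewrite rE; nra].
have G := pow_gauss_le 8 (ltr0n R 2) z0.
rewrite /Q (_ : Q1 * (_ * _) * (_ * _ * _) =
  (Q1 * (Num.sqrt 2 ^+ n * heat (2 * l) x) * ((1 + z) ^+ 4 * expR (- z / 2))) * (1 + r) ^+ 4); last by ring.
apply: (@le_trans _ _ ((Q1 * (Num.sqrt 2 ^+ n * heat (2 * l) x) * ((1 + z) ^+ 4 * expR (- z / 2))) * (4 * (1 + l) * (1 + z)) ^+ 4)).
  apply: ler_wpM2l => //; apply: mulr_ge0.
    by apply: mulr_ge0; [exact: Q10|exact: mulr_ge0].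
  by apply: mulr_ge0; [rewrite exprn_ge0// addr_ge0|exact: expR_ge0].
rewrite (_ : _ * _ ^+ 4 = Q1 * 4 ^+ 4 * Num.sqrt 2 ^+ n * (1 + l) ^+ 4 * heat (2 * l) x * ((1 + z) ^+ 8 * expR (- z / 2))); last by ring.
rewrite [leRHS](_ : _ = Q1 * 4 ^+ 4 * Num.sqrt 2 ^+ n * (1 + l) ^+ 4 * heat (2 * l) x * (2 ^+ 8 * 8`!%:R * expR 2^-1)); last by ring.
apply: ler_wpM2l => //; apply: mulr_ge0 => //; apply: mulr_ge0; last by rewrite exprn_ge0.
by apply: mulr_ge0 => //; apply: mulr_ge0; [exact: Q10|rewrite exprn_ge0].
Qed.

Let one_le_pow (m j : nat) r : (j <= m)%N -> 0 <= r -> r ^+ j <= (1 + r) ^+ m.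
Proof.
move=> jm r0; apply: (@le_trans _ _ ((1 + r) ^+ j)).
  by apply: lerXn2r; rewrite ?nnegrE; lra.
by apply: ler_weXn2l => //; lra.
Qed.

Let k_poly_le (f : R -> R) (j : nat) : (j <= 4)%N ->
  (forall r, 0 <= r -> `|f r| <= K * r ^+ j) -> forall r, 0 <= r -> `|f r| <= K * (1 + r) ^+ 4.
Proof.
move=> j4 fle r r0; apply: le_trans (fle r r0) _; apply: ler_wpM2l; first exact: K0.
exact: one_le_pow.
Qed.

(** Mere polynomial growth in r, as [ct_gauss_step] requires; here the constant may blow up as l
    tends to 0, unlike in [qker_le]. *)
Let g_poly_le b (a : R) (j : nat) r : (j <= 3)%N -> 0 <= b -> 0 <= r -> `|a| <= Mg b r * r ^+ j ->
  `|a| <= K * (2 * n%:R + 12) * (1 + b) ^+ 2 * (1 + r) ^+ 6.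
Proof.
move=> j3 b0 r0 /le_trans; apply; have n0 := ler0n R n.
have C0 : 0 <= K * (2 * n%:R + 12) by apply: mulr_ge0; [exact: K0|lra].
have h : (1 + b * r) ^+ 2 <= ((1 + b) * (1 + r)) ^+ 2.
  have := mulr_ge0 b0 r0; move=> br; apply: lerXn2r; rewrite ?nnegrE; [lra| |lra].
  by apply: mulr_ge0; lra.
rewrite /Mg (_ : K * _ * _ ^+ 2 * (1 + r) ^+ 6 =
   K * (2 * n%:R + 12) * (1 + r) * ((1 + b) * (1 + r)) ^+ 2 * (1 + r) ^+ 3); last by ring.
apply: ler_pM; [|exact: exprn_ge0| |exact: one_le_pow].
  by apply: mulr_ge0; [apply: mulr_ge0 => //; lra|exact: sqr_ge0].
by apply: ler_wpM2l => //; apply: mulr_ge0 => //; lra.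
Qed.

Let ct_qker l xi : 0 < l -> ct mu (qker l) xi =
  (1 + lapsym xi) ^+ 2 * ct mu (fun x => k0 (dotv x x) * heat l x) xi.
Proof.
move=> l0; have b0 : 0 <= (4 * l)^-1 by rewrite invr_ge0 mulr_ge0// ltW.
rewrite expr2 -mulrA -(@ct_gauss_step R n mu mu_leb l K 4 k0 k1 k2 l0 dk0 dk1).
- apply: (@ct_gauss_step R n mu mu_leb l (K * (2 * n%:R + 12) * (1 + (4 * l)^-1) ^+ 2) 6
    (g0 (4 * l)^-1) (g1 (4 * l)^-1) (g2 (4 * l)^-1) l0 (dg0 _) (dg1 _) (@g2_continuous _)) => r r0.
  + by have [h _ _] := gs_le b0 r0; exact: (g_poly_le _ b0 r0 h).
  + by have [_ h _] := gs_le b0 r0; exact: (g_poly_le _ b0 r0 h).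
  + have [_ _ h] := gs_le b0 r0; apply: (@g_poly_le (4 * l)^-1 _ 1) => //; rewrite expr1; exact: h.
- by have [] := k_continuous.
- exact: (k_poly_le _ k0_le).
- exact: (k_poly_le _ k1_le).
- exact: (k_poly_le _ k2_le).
Qed.

Definition cutoff x : R := 1 - kap0 (dotv x x / rho0).

Let kap0_norm_le r : 0 <= r -> `|k0 r| <= kapC + 1.
Proof.
move=> r0; have y0 : 0 <= r / rho0 by rewrite divr_ge0// ltW.
rewrite /k0; have [y1|y1] := leP 1 (r / rho0).
  by rewrite kap0_1// normr1 lerDr kapC_ge0.
apply: le_trans (kap0_le y0) _; apply: (@le_trans _ _ kapC); last by rewrite lerDl.
rewrite -[leRHS]mulr1; apply: ler_wpM2l; first exact: kapC_ge0.
by apply: exprn_ile1 => //; exact: ltW.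
Qed.

Lemma cutoff_le x : `|cutoff x| <= kapC + 2.
Proof.
apply: le_trans (ler_normB _ _) _; rewrite normr1.
by have := kap0_norm_le (dotv_ge0 x); rewrite /k0; set u := `|_|; lra.
Qed.

Lemma cutoff_eq0 x : rho0 <= dotv x x -> cutoff x = 0.
Proof. by move=> h; rewrite /cutoff kap0_1 ?subrr// ler_pdivlMr// mul1r. Qed.

Lemma cutoff_measurable : measurable_fun setT (cutoff : Rn R n -> R).
Proof.
by have [c0 _ _ _] := k_continuous; apply: measurable_funB => //; exact: (radial_measurable c0).
Qed.

Lemma cutoffN x : cutoff (- x) = cutoff x.
Proof. by rewrite /cutoff dotvNl dotvNr opprK. Qed.

Let G s t x : R := wB s t * qker (expR t) x.
Definition remker s x : R := (gam s)^-1 * mix (G s) x.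

Let G_measurable s : measurable_fun setT (fun z : measurableTypeR R * Rn R n => G s z.1 z.2).
Proof.
apply: measurable_funM; last exact: qker_measurable.
apply: (measurableT_comp (f := wB s)) => //; exact: continuous_measurable_fun (@wB_continuous _ s).
Qed.

Let W s t : R := Q * (wB s t * (1 + expR t) ^+ 4).

Let Q0 : 0 <= Q.
Proof.
apply: mulr_ge0; last exact: exprn_ge0.
apply: mulr_ge0; first by apply: mulr_ge0; [exact: Q10|exact: exprn_ge0].
by apply: mulr_ge0; [apply: mulr_ge0 => //; exact: exprn_ge0|exact: expR_ge0].
Qed.

Let G_le s t : (\int[mu]_x `|G s t x|%:E <= (W s t)%:E)%E.
Proof.
have h x : `|G s t x| <= W s t * heat (2 * expR t) x.
  rewrite /G normrM (ger0_norm (wB_ge0 s t)) /W.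
  rewrite (_ : Q * _ * _ = wB s t * (Q * (1 + expR t) ^+ 4 * heat (2 * expR t) x)); last by ring.
  by apply: ler_wpM2l; [exact: wB_ge0|apply: qker_le; exact: expR_gt0].
have W0 : 0 <= W s t.
  apply: mulr_ge0; first exact: Q0.
  by apply: mulr_ge0; [exact: wB_ge0|rewrite exprn_ge0// addr_ge0// expR_ge0].
apply: (@le_trans _ _ (\int[mu]_x (W s t * heat (2 * expR t) x)%:E)%E).
  apply: ge0_le_integral => //.
  - apply/measurable_EFinP; apply: measurableT_comp => //; apply: measurable_funM => //.
    exact: (measurableT_comp qker_measurable (measurable_pair1 t)).
  - by apply/measurable_EFinP; apply: measurable_funM => //; exact: heat_measurable.
  - by move=> x _; rewrite lee_fin.
under eq_integral do rewrite EFinM.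
rewrite ge0_integralZl//.
- by rewrite Rint_heatE ?mule1// mulr_gt0// expR_gt0.
- by apply/measurable_EFinP; exact: heat_measurable.
- by move=> x _; rewrite lee_fin heat_ge0.
Qed.

Let W_L1 s : 0 < s <= 2 -> L1 leb (W s).
Proof. by move=> s02; apply: L1Z; exact: wB_L1. Qed.

Lemma remker_L1 s : 0 < s <= 2 -> L1 mu (remker s).
Proof. by move=> s02; apply: L1Z; exact: (mix_L1 (@G_measurable s) (W_L1 s02) (G_le s)). Qed.

Lemma remkerN s x : remker s (- x) = remker s x.
Proof.
congr (_ * _); apply: eq_RintegralT => t.
by rewrite /G /qker dotvNl dotvNr opprK heatN.
Qed.

(** For each heat time [ct_qker] produces the factor (1 + a)^2; it does not depend on the time and
    so leaves the mixture. *)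
Lemma ct_remker s xi : 0 < s <= 2 -> ct mu (remker s) xi =
  (1 + lapsym xi) ^+ 2 * (ct mu (bessel s) xi - ct mu (fun x => cutoff x * bessel s x) xi).
Proof.
move=> s02.
have bi := bessel_L1 mu_leb s02.
have cbi : L1 mu (fun x => cutoff x * bessel s x).
  apply: eq_integrable (L1M bi cutoff_measurable cutoff_le) => // x _ /=; congr EFin; exact: mulrC.
rewrite /ct -RintBT; [|exact: L1_cos|exact: L1_cos].
have mm : measurable_fun setT (fun x : Rn R n => k0 (dotv x x) * cos (2 * pi * dotv x xi)).
  apply: measurable_funM; last exact: cos_dot_measurable.
  by have [c0 _ _ _] := k_continuous; exact: (radial_measurable c0).
have mle x : `|k0 (dotv x x) * cos (2 * pi * dotv x xi)| <= kapC + 1.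
  rewrite normrM -[leRHS]mulr1; apply: ler_pM => //; last exact: cos_max.
  exact: kap0_norm_le (dotv_ge0 x).
have E1 : \int[mu]_x (bessel s x * cos (2 * pi * dotv x xi) - cutoff x * bessel s x * cos (2 * pi * dotv x xi)) =
  (gam s)^-1 * \int[mu]_x (mix (fun t x => wB s t * heat (expR t) x) x * (k0 (dotv x x) * cos (2 * pi * dotv x xi))).
  rewrite -RintZT; last first.
    apply: L1M mm mle; apply: heat_mix_L1 => //; [exact: wB_ge0|exact: wB_continuous|exact: wB_L10].
  by apply: eq_RintegralT => x; rewrite /bessel /cutoff -/(k0 (dotv x x)); ring.
rewrite E1 -/(ct mu (remker s) xi) ct_scale; last first.
  exact: (mix_L1 (@G_measurable s) (W_L1 s02) (G_le s)).
rewrite mulrCA; congr (_ * _).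
rewrite (ct_mix (@G_measurable s) (W_L1 s02) (G_le s)).
have hm := @heat_mix_measurable R n (wB s) (@wB_continuous _ s).
have hl := @heat_mix_le R n mu mu_leb (wB s) (wB_ge0 s).
rewrite (mix_Rint hm (wB_L10 s02) hl mm mle) -RintZT; last exact: (mix_fst_L1 hm (wB_L10 s02) hl mm mle).
apply: eq_RintegralT => t; rewrite ct_scale; last first.
  apply: (@L1_le _ _ R mu _ (fun x => Q * (1 + expR t) ^+ 4 * heat (2 * expR t) x)).
  - exact: (measurableT_comp qker_measurable (measurable_pair1 t)).
  - by move=> x; apply: le_trans (qker_le x (expR_gt0 t)) _; exact: ler_norm.
  - by apply: L1Z; apply: (heat_L1 mu_leb); rewrite mulr_gt0// expR_gt0.
rewrite ct_qker ?expR_gt0// mulrCA; congr (_ * _).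
rewrite -ct_scale; last first.
  have [c0 _ _ _] := k_continuous.
  have h := L1M (heat_L1 mu_leb (expR_gt0 t)) (@radial_measurable R n k0 c0) (fun x => kap0_norm_le (dotv_ge0 x)).
  by apply: eq_integrable h => // x _ /=; congr EFin; exact: mulrC.
by apply: eq_RintegralT => x; rewrite [k0 _ * heat _ _]mulrC !mulrA.
Qed.

End parametrix_remainder.

(** * The kernels of the parametrix and their symbols *)

Section kernels.
Context (R : realType) (n : nat).
Variable mu : {sigma_finite_measure set (Rn R n) -> \bar R}.
Hypothesis mu_leb : is_lebesgue mu.
Implicit Types (x y xi : 'rV[R]_n).
Variables (s rho0 : R).
Hypotheses (s01 : 0 < s < 1) (rho0_gt0 : 0 < rho0).

Notation B0 := (@bessel R n s).
Notation q := (@remker R n rho0 s).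

Let s02 : 0 < s <= 2. Proof. by case/andP: s01 => ? ?; apply/andP; split; lra. Qed.
Let s2 : 0 < 2 - s <= 2. Proof. by case/andP: s01 => ? ?; apply/andP; split; lra. Qed.
Let s3 : 0 < 2 - 2 * s <= 2. Proof. by case/andP: s01 => ? ?; apply/andP; split; lra. Qed.

(* With [a := lapsym]: [ct rker = 1 - (1 + a)^s ct par] and [ct rker2 = (1 + a)^s ct rker],
   so that [ct mker = (1 + a)^s - a^s (1 - ct rker)], the symbol solving
   [a^s ct par = 1 - (1 + a)^(- s) ct mker] although [(1 + a)^s] is not the symbol of an L^1 kernel. *)
Definition par x : R := cutoff rho0 x * bessel s x.
Definition rker : 'rV[R]_n -> R := conv mu (bessel (2 - s)) q.
Definition rker2 : 'rV[R]_n -> R := conv mu (bessel (2 - 2 * s)) q.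
Definition mker x : R := fracker s x - conv mu rker (fracker s) x + rker2 x.

Let qi : L1 mu q. Proof. exact: remker_L1. Qed.
Let qN x : q (- x) = q x. Proof. exact: remkerN. Qed.
Let Bi : L1 mu B0. Proof. exact: bessel_L1. Qed.

Lemma par_L1 : L1 mu par.
Proof.
apply: eq_integrable (L1M Bi (cutoff_measurable rho0_gt0) (cutoff_le rho0_gt0)) => // x _ /=.
by congr EFin; exact: mulrC.
Qed.

Lemma parN x : par (- x) = par x.
Proof. by rewrite /par cutoffN besselN. Qed.

Lemma rker_L1 : L1 mu rker. Proof. exact: (conv_L1 mu_leb (bessel_L1 mu_leb s2) qi). Qed.
Lemma rker2_L1 : L1 mu rker2. Proof. exact: (conv_L1 mu_leb (bessel_L1 mu_leb s3) qi). Qed.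

Lemma rkerN x : rker (- x) = rker x.
Proof.
exact: (conv_even mu_leb (@besselN R n (2 - s)) qN (L1_measurable (bessel_L1 mu_leb s2)) (L1_measurable qi)).
Qed.

Lemma rker2N x : rker2 (- x) = rker2 x.
Proof.
exact: (conv_even mu_leb (@besselN R n (2 - 2 * s)) qN (L1_measurable (bessel_L1 mu_leb s3)) (L1_measurable qi)).
Qed.

Let Ki : L1 mu (@fracker R n s). Proof. exact: fracker_L1. Qed.

Lemma mker_L1 : L1 mu mker.
Proof.
apply: L1D; last exact: rker2_L1.
exact: (L1B Ki (conv_L1 mu_leb rker_L1 Ki)).
Qed.

Lemma mkerN x : mker (- x) = mker x.
Proof.
have E := conv_even mu_leb rkerN (@frackerN R n s) (L1_measurable rker_L1) (L1_measurable Ki) x.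
by rewrite /mker frackerN rker2N E.
Qed.

Let la xi : 0 < 1 + lapsym xi. Proof. by have := lapsym_ge0 xi; lra. Qed.

Let pow_mul xi (a b : R) : (1 + lapsym xi) `^ a * (1 + lapsym xi) `^ b = (1 + lapsym xi) `^ (a + b).
Proof. by rewrite /powR (gt_eqF (la xi)) -expRD -mulrDl. Qed.

Let ct_conv_remker (sigma : R) xi : 0 < sigma <= 2 -> ct mu (conv mu (bessel sigma) q) xi =
  (1 + lapsym xi) `^ (2 - sigma) * ((1 + lapsym xi) `^ (- s) - ct mu par xi).
Proof.
move=> sg2; have Eb := ct_bessel mu_leb xi sg2; have Es := ct_bessel mu_leb xi s02.
have Eq : ct mu q xi = (1 + lapsym xi) ^+ 2 * ((1 + lapsym xi) `^ (- s) - ct mu par xi).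
  by apply: etrans (ct_remker mu_leb rho0_gt0 xi s02) _; rewrite -Es.
apply: etrans (ct_conv mu_leb xi qN (bessel_L1 mu_leb sg2) qi) _.
apply: etrans (congr2 *%R Eb Eq) _.
rewrite mulrA -(powR_mulrn 2 (ltW (la xi))) pow_mul.
by rewrite [- sigma + _]addrC.
Qed.

Lemma ct_rker xi : ct mu rker xi = 1 - (1 + lapsym xi) `^ s * ct mu par xi.
Proof.
apply: etrans (ct_conv_remker xi s2) _.
rewrite (_ : 2 - (2 - s) = s); last by ring.
by rewrite mulrBr pow_mul subrr powRr0.
Qed.

Lemma ct_rker2 xi : ct mu rker2 xi = (1 + lapsym xi) `^ s * ct mu rker xi.
Proof.
apply: etrans (ct_conv_remker xi s3) _; apply: etrans (congr1 _ (esym (ct_rker xi))).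
rewrite (_ : 2 - (2 - 2 * s) = s + s); last by ring.
by rewrite -pow_mul -mulrA mulrBr pow_mul subrr powRr0.
Qed.

(* Unification would otherwise unfold the kernels down to their integrands. *)
Local Opaque rker rker2 bessel fracker remker.

Lemma ct_par xi : ct mu par xi = (1 + lapsym xi) `^ (- s) * (1 - ct mu rker xi).
Proof.
by rewrite ct_rker subKr mulrA pow_mul addNr powRr0 mul1r.
Qed.

Lemma ctB (f g : 'rV[R]_n -> R) xi : L1 mu f -> L1 mu g ->
  ct mu (fun x => f x - g x) xi = ct mu f xi - ct mu g xi.
Proof.
move=> fi gi; rewrite /ct -RintBT; [|exact: L1_cos|exact: L1_cos].
by apply: eq_RintegralT => x; rewrite mulrBl.
Qed.

Lemma ctD (f g : 'rV[R]_n -> R) xi : L1 mu f -> L1 mu g ->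
  ct mu (fun x => f x + g x) xi = ct mu f xi + ct mu g xi.
Proof.
move=> fi gi; rewrite /ct -RintDT; [|exact: L1_cos|exact: L1_cos].
by apply: eq_RintegralT => x; rewrite mulrDl.
Qed.

Lemma lapsym_ct_par xi : lapsym xi `^ s * ct mu par xi =
  1 - (1 + lapsym xi) `^ (- s) * ct mu mker xi.
Proof.
have rKi : L1 mu (conv mu rker (fracker s)) := conv_L1 mu_leb rker_L1 Ki.
(* The algebra is isolated in real unknowns: X = (1 + a)^(- s), Y = (1 + a)^s, Z = a^s, and
   lower-case letters for the transforms. *)
have aux (X Y Z r r2 p k m rk : R) : m = k - rk + r2 -> rk = r * k -> r2 = Y * r -> k = Y - Z ->
    p = X * (1 - r) -> X * Y = 1 -> Z * p = 1 - X * m.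
  move=> -> -> -> -> -> E; rewrite [RHS](_ : _ = 1 - (X * Y) + X * Z * (1 - r)); last by ring.
  by rewrite E; ring.
have E : (1 + lapsym xi) `^ (- s) * (1 + lapsym xi) `^ s = 1 by rewrite pow_mul addNr powRr0.
refine (aux _ _ _ _ _ _ _ _ _ _ _ (ct_rker2 xi) (ct_fracker mu_leb xi s01) (ct_par xi) E); last first.
  exact: (ct_conv mu_leb xi (@frackerN R n s) rker_L1 Ki).
by rewrite /mker (ctD xi (L1B Ki rKi) rker2_L1) (ctB xi Ki rKi).
Qed.

Section test_kernel.
Variables (beta : 'rV[R]_n -> R) (Mb : R).
Hypotheses (bi : L1 mu beta) (bN : forall x, beta (- x) = beta x) (bM : forall x, `|beta x| <= Mb).

Notation theta := (conv mu beta beta).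
Notation Bt := (conv mu B0 theta).

Let mb := L1_measurable bi.
Let ti : L1 mu theta. Proof. exact: conv_L1. Qed.
Let tN x : theta (- x) = theta x. Proof. exact: conv_even. Qed.
Let tM : forall x, `|theta x| <= Mb * \int[mu]_x `|beta x|.
Proof. by move=> x; apply: norm_conv_le. Qed.

Let Bti : L1 mu Bt. Proof. exact: (conv_L1 mu_leb Bi ti). Qed.
Let BtN x : Bt (- x) = Bt x.
Proof. exact: (conv_even mu_leb (@besselN R n s) tN (L1_measurable Bi) (L1_measurable ti)). Qed.

Let ctt xi : ct mu theta xi = ct mu beta xi ^+ 2.
Proof. by rewrite (ct_conv mu_leb xi bN bi bi) expr2. Qed.

Lemma ct_theta_L1 : L1 mu (ct mu theta).
Proof.
by apply: (ct_ge0_L1 mu_leb ti tN tM) => xi; rewrite ctt sqr_ge0.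
Qed.

(** The candidate for the fractional Laplacian of theta * P. The latter is written beta * (beta * P)
    throughout, because smoothness is inherited from the outermost bump. *)
Definition nker x : R := theta x - conv mu mker Bt x.

Let mBti : L1 mu (conv mu mker Bt). Proof. exact: (conv_L1 mu_leb mker_L1 Bti). Qed.

Lemma nker_L1 : L1 mu nker. Proof. exact: L1B. Qed.

Lemma nkerN x : nker (- x) = nker x.
Proof.
have E := conv_even mu_leb mkerN BtN (L1_measurable mker_L1) (L1_measurable Bti) x.
by rewrite /nker tN E.
Qed.

Let pi_ := par_L1.
Let bpi : L1 mu (conv mu beta par) := conv_L1 mu_leb bi pi_.
Let bpN : forall x, conv mu beta par (- x) = conv mu beta par x :=
  conv_even mu_leb bN parN mb (L1_measurable pi_).

Let ct_bbp xi : ct mu (conv mu beta (conv mu beta par)) xi =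
  ct mu beta xi * (ct mu beta xi * ct mu par xi).
Proof.
exact: etrans (ct_conv mu_leb xi bpN bi bpi) (congr1 _ (ct_conv mu_leb xi parN bi pi_)).
Qed.

Let ct_Bt xi : ct mu Bt xi = (1 + lapsym xi) `^ (- s) * ct mu beta xi ^+ 2.
Proof. exact: etrans (ct_conv mu_leb xi tN Bi ti) (congr2 *%R (ct_bessel mu_leb xi s02) (ctt xi)). Qed.

Let ct_nker0 xi : ct mu nker xi = ct mu theta xi - ct mu mker xi * ct mu Bt xi.
Proof. exact: etrans (ctB xi ti mBti) (congr1 _ (congr1 _ (ct_conv mu_leb xi BtN mker_L1 Bti))). Qed.

Lemma ct_nker xi : ct mu nker xi = lapsym xi `^ s * ct mu (conv mu beta (conv mu beta par)) xi.
Proof.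
have aux (b P m X Z bb t BT N : R) : N = t - m * BT -> t = b ^+ 2 -> BT = X * b ^+ 2 ->
    bb = b * (b * P) -> Z * P = 1 - X * m -> N = Z * bb.
  move=> -> -> -> -> E; rewrite (_ : Z * _ = b ^+ 2 * (Z * P)); last by ring.
  by rewrite E; ring.
exact: (aux _ _ _ _ _ _ _ _ _ (ct_nker0 xi) (ctt xi) (ct_Bt xi) (ct_bbp xi) (lapsym_ct_par xi)).
Qed.

(** The transform is (1 - B^ M^) theta^, a bounded factor times an integrable one. Bounding a^s P^
    directly would give the same, but here [mker] and [bessel] only need to be in L^1. *)
Lemma ct_nker_L1 : L1 mu (ct mu nker).
Proof.
have mN : measurable_fun setT (ct mu nker : Rn R n -> R).
  by apply: ct_measurable; exact: L1_measurable nker_L1.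
apply: (@L1_le _ _ R mu _ (fun xi => (1 + \int[mu]_x `|B0 x| * \int[mu]_x `|mker x|) * ct mu theta xi)) => //; last first.
  by apply: L1Z; exact: ct_theta_L1.
move=> xi; have nb := ct_norm_le xi Bi; have nm := ct_norm_le xi mker_L1.
have E := etrans (ct_nker0 xi) (congr1 _ (congr1 _ (congr1 _ (ct_conv mu_leb xi tN Bi ti)))).
move: E nb nm; move: (ct mu nker xi) (ct mu theta xi) (ct mu mker xi) (ct mu B0 xi) => N t m b ->.
move: (\int[mu]_x _) (\int[mu]_x _) => IB IM hb hm.
have -> : t - m * (b * t) = (1 - b * m) * t by ring.
rewrite !normrM; apply: ler_wpM2r => //; apply: le_trans (ler_norm _).
apply: le_trans (ler_normB _ _) _; rewrite normr1 lerD2l normrM; exact: ler_pM.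
Qed.

(** The fractional Laplacian is by definition an inverse transform; inversion identifies it almost
    everywhere with an explicit integrable function, which can be paired with an L^p function. *)
Lemma nker_inversion : {ae mu, forall x : Rn R n, nker x =
  ct mu (fun xi => lapsym xi `^ s * ct mu (conv mu beta (conv mu beta par)) xi) x}.
Proof.
have := fourier_inversion mu_leb nker_L1 (fun xi => even_st0 mu_leb xi nkerN nker_L1) ct_nker_L1.
by rewrite (funext ct_nker : ct mu nker = _).
Qed.

Lemma test_ae : {ae mu, forall x : Rn R n,
  conv mu beta (conv mu beta par) x = Bt x - conv mu rker Bt x}.
Proof.
have rBi : L1 mu (conv mu rker Bt) := conv_L1 mu_leb rker_L1 Bti.
have lhsi : L1 mu (conv mu beta (conv mu beta par)) := conv_L1 mu_leb bi bpi.
have rhsi : L1 mu (fun x => Bt x - conv mu rker Bt x) := L1B Bti rBi.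
have rBN : forall x, conv mu rker Bt (- x) = conv mu rker Bt x :=
  conv_even mu_leb rkerN BtN (L1_measurable rker_L1) (L1_measurable Bti).
have rhsN x : Bt (- x) - conv mu rker Bt (- x) = Bt x - conv mu rker Bt x by rewrite BtN rBN.
have lhsN : forall x, conv mu beta (conv mu beta par) (- x) = conv mu beta (conv mu beta par) x :=
  conv_even mu_leb bN bpN mb (L1_measurable bpi).
apply: (ct_uniqueness mu_leb lhsi rhsi) => xi; last first.
  exact: etrans (even_st0 mu_leb xi lhsN lhsi) (esym (even_st0 mu_leb xi rhsN rhsi)).
have aux (b P r X bb BT rB D : R) : bb = b * (b * P) -> D = BT - rB -> rB = r * BT ->
    BT = X * b ^+ 2 -> P = X * (1 - r) -> bb = D.
  by move=> -> -> -> -> ->; ring.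
exact: (aux _ _ _ _ _ _ _ _ (ct_bbp xi) (ctB xi Bti rBi) (ct_conv mu_leb xi BtN rker_L1 Bti) (ct_Bt xi) (ct_par xi)).
Qed.

End test_kernel.
End kernels.

(** * Test functions *)

Section bump1d.
Context {R : realType}.
Implicit Types (t z : R) (q : {poly R}).

(** The polynomial factor makes the family stable under differentiation: the derivative of q(1/t)
    e^(-1/t) is (q - q')(1/t) t^(-2) e^(-1/t). *)
Definition eta q t : R := if 0 < t then q.[t^-1] * expR (- t^-1) else 0.

Let poly_exp_le q : exists2 C : R, 0 <= C & forall z, 0 <= z -> `|q.[z] * expR (- z)| <= C.
Proof.
exists (\sum_(i < size q) `|q`_i| * i`!%:R); first by apply: sumr_ge0 => i _; rewrite mulr_ge0.
move=> z z0; rewrite horner_coef mulr_suml; apply: le_trans (ler_norm_sum _ _ _) _.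
apply: ler_sum => i _; rewrite -mulrA normrM; apply: ler_wpM2l => //.
by rewrite ger0_norm ?pow_expRN// mulr_ge0 ?exprn_ge0 ?expR_ge0.
Qed.

Lemma eta_le q : exists2 C : R, 0 <= C & forall t, `|eta q t| <= C.
Proof.
have [C C0 H] := poly_exp_le q; exists C => // t; rewrite /eta.
by case: ifPn => t0; [apply: H; rewrite invr_ge0 ltW|rewrite normr0].
Qed.

Lemma deta q t : is_derive t 1 (eta q) (eta ('X ^+ 2 * (q - q^`())) t).
Proof.
have [t0|t0|->] := ltgtP t 0.
- rewrite {2}/eta ltNge ltW//=.
  apply: (near_eq_is_derive _ (dcst t (0 : R))).
  by near=> u; rewrite /eta ltNge ltW//; near: u; exact: lt_nbhsl.
- have tn0 := lt0r_neq0 t0.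
  have dV : is_derive t 1 (fun u : R => u^-1) (- (t ^- 2)).
    by apply: (deq (@is_deriveV R id t 1 1 tn0 (did t))); rewrite /GRing.scale /= mulr1.
  have dq : is_derive t 1 (fun u : R => q.[u^-1]) (q^`().[t^-1] * - (t ^- 2)).
    exact: (@dcomp _ t (horner q) (fun u => u^-1) _ _ (is_derive_poly q t^-1) dV).
  apply: (near_eq_is_derive _ (deq (dmul dq (dexp (dopp dV))) _)); last first.
    by rewrite /eta t0 hornerM hornerXn hornerD hornerN exprVn; ring.
  by near=> u; rewrite /eta; case: ifPn => //; rewrite -leNgt leNgt => /negP[]; near: u; exact: lt_nbhsr.
(* At the junction 0, q(1/h) e^(-1/h) is h^2 times the same expression for X^2 q, which is
   bounded. *)
- rewrite {2}/eta ltxx; have [C C0 H] := poly_exp_le ('X ^+ 2 * q).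
  apply: (is_derive_quadratic C0) => h; rewrite add0r mul0r subr0 {2}/eta ltxx subr0 /eta.
  case: ifPn => h0; last by rewrite normr0 mulr_ge0// sqr_ge0.
  have hn0 := lt0r_neq0 h0; have := H h^-1; rewrite invr_ge0 (ltW h0) => /(_ isT).
  rewrite hornerM hornerXn -mulrA exprVn normrM normfV (ger0_norm (sqr_ge0 h)).
  by rewrite ler_pdivrMl ?exprn_gt0// [h ^+ 2 * C]mulrC.
Unshelve. all: by end_near. Qed.

End bump1d.

Section bump.
Context (R : realType) (n : nat).
Implicit Types (x y v : 'rV[R]_n) (f g h : 'rV[R]_n -> R).
Variable eps : R.

(** A class of functions that contains the basic bump and is stable under partial derivatives: the
    chain rule on |x|^2 brings out a coordinate, whence the closure under multiplication by
    coordinates. Smoothness is then an induction on the list of derivatives. *)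
Inductive bumpf : ('rV[R]_n -> R) -> Prop :=
| bump_eta q : bumpf (fun x => eta q (eps ^+ 2 - dotv x x))
| bump_coord i f : bumpf f -> bumpf (fun x => x ord0 i * f x)
| bump_add f g : bumpf f -> bumpf g -> bumpf (fun x => f x + g x)
| bump_scale c f : bumpf f -> bumpf (fun x => c * f x).

Lemma bump_eq0 f : bumpf f -> forall x, eps ^+ 2 <= dotv x x -> f x = 0.
Proof.
elim => {f} [q|i f _ IH|f g _ IHf _ IHg|c f _ IH] x xe.
- by rewrite /eta ltNge subr_le0 xe.
- by rewrite IH// mulr0.
- by rewrite IHf// IHg// addr0.
- by rewrite IH// mulr0.
Qed.

Lemma bump_le f : bumpf f -> exists2 C : R, 0 <= C & forall x, `|f x| <= C.
Proof.
elim => {f} [q|i f bf [C C0 H]|f g _ [C C0 H] _ [D D0 K]|c f _ [C C0 H]].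
- by have [C C0 H] := eta_le q; exists C.
- have e0 := sqr_ge0 eps.
  exists ((1 + eps ^+ 2) * C); first by rewrite mulr_ge0//; lra.
  move=> x; have [xe|xe] := leP (eps ^+ 2) (dotv x x).
    by rewrite (bump_eq0 bf xe) mulr0 normr0 mulr_ge0//; lra.
  rewrite normrM; apply: ler_pM => //.
  have := coord_sqr_le x i; have := sqr_ge0 (`|x ord0 i| - 1).
  by rewrite -[x ord0 i ^+ 2]real_normK ?num_real//; have := sqr_ge0 `|x ord0 i|; nra.
- exists (C + D); first by rewrite addr_ge0.
  by move=> x; apply: le_trans (ler_normD _ _) _; exact: lerD.
- exists (`|c| * C); first by rewrite mulr_ge0.
  by move=> x; rewrite normrM ler_wpM2l.
Qed.

Lemma dotvv_continuous : continuous (fun x : 'rV[R]_n => dotv x x).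
Proof.
have S (r : seq 'I_n) : continuous (fun x : 'rV[R]_n => \sum_(i <- r) x ord0 i * x ord0 i : R).
  elim: r => [|i r IH] x.
    have -> : (fun y : 'rV[R]_n => \sum_(i <- [::]) y ord0 i * y ord0 i : R) = fun=> 0.
      by apply/funext => y; rewrite big_nil.
    exact: (@cst_continuous _ _ (0 : R)).
  have -> : (fun y : 'rV[R]_n => \sum_(j <- i :: r) y ord0 j * y ord0 j : R) =
      fun y => y ord0 i * y ord0 i + \sum_(j <- r) y ord0 j * y ord0 j.
    by apply/funext => y; rewrite big_cons.
  have cc := @coord_continuous R 1 n ord0 i x.
  exact: (cvgD (cvgM cc cc) (IH x)).
exact: S.
Qed.

Lemma bump_continuous f : bumpf f -> continuous f.
Proof.
elim => {f} [q|i f _ IH|f g _ IHf _ IHg|c f _ IH] x.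
- apply: (@continuous_comp _ _ _ (fun x : 'rV[R]_n => eps ^+ 2 - dotv x x) (eta q)).
    exact: (cvgB (@cst_continuous _ _ (eps ^+ 2) x) (@dotvv_continuous x)).
  exact: is_derive_continuous (deta q _).
- exact: (cvgM (@coord_continuous R 1 n ord0 i x) (IH x)).
- exact: (cvgD (IHf x) (IHg x)).
- exact: (cvgM (@cst_continuous _ _ c x) (IH x)).
Qed.

Lemma bump_derive f i : bumpf f -> exists2 f', bumpf f' &
  forall x, is_derive (0 : R) 1 (fun t : R => f (x + t *: basis_vec R i)) (f' x).
Proof.
set e := basis_vec R i.
have x0 x : x + (0 : R) *: e = x by rewrite scale0r addr0.
elim => {f} [q|j f bf [f' bf' H]|f g _ [f' bf' H] _ [g' bg' K]|c f _ [f' bf' H]].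
- exists (fun x => - 2 * (x ord0 i * eta ('X ^+ 2 * (q - q^`())) (eps ^+ 2 - dotv x x))).
    by apply: bump_scale; apply: bump_coord; exact: bump_eta.
  move=> x; have d1 : is_derive (0 : R) 1 (fun t : R => eps ^+ 2 - dotv (x + t *: e) (x + t *: e)) (- (2 * x ord0 i)).
    by apply: (deq (dadd (dcst 0 (eps ^+ 2)) (dopp (dline x e 0)))); rewrite x0 dotv_basis add0r.
  have d2 := deta q (eps ^+ 2 - dotv (x + (0 : R) *: e) (x + (0 : R) *: e)).
  apply: (deq (@dcomp _ 0 (eta q) (fun t : R => eps ^+ 2 - dotv (x + t *: e) (x + t *: e)) _ _ d2 d1)).
  by rewrite x0; ring.
- exists (fun x => e ord0 j * f x + x ord0 j * f' x).
    by apply: bump_add; [exact: bump_scale|exact: bump_coord].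
  move=> x; have d1 : is_derive (0 : R) 1 (fun t : R => (x + t *: e) ord0 j) (e ord0 j).
    rewrite (_ : (fun t : R => _) = fun t : R => x ord0 j + t * e ord0 j); last first.
      by apply/funext => t; rewrite !mxE.
    by apply: (deq (dadd (dcst 0 _) (dmul (did 0) (dcst 0 (e ord0 j))))); ring.
  by apply: (deq (dmul d1 (H x))); rewrite x0.
- exists (fun x => f' x + g' x); first exact: bump_add.
  by move=> x; exact: (dadd (H x) (K x)).
- exists (fun x => c * f' x); first exact: bump_scale.
  by move=> x; apply: (deq (dmul (dcst 0 c) (H x))); ring.
Qed.

Lemma is_derive_dir f v x (a : R) : is_derive (0 : R) 1 (fun t : R => f (x + t *: v)) a ->
  is_derive x v f a.
Proof.
have E : (fun h : R => h^-1 *: (((fun t : R => f (x + t *: v)) \o shift (0 : R)) (h *: (1 : R)) -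
     f (x + (0 : R) *: v))) = (fun h : R => h^-1 *: ((f \o shift x) (h *: v) - f x)).
  apply/funext => h /=; have -> : h *: (1 : R) = h by exact: mulr1.
  by rewrite scale0r !addr0 [x + _]addrC.
by move=> [d1 d2]; split; [rewrite /derivable -E|rewrite /derive -E].
Qed.

End bump.

(** * Convolution with a bump is smooth; normalised bumps *)

Section smoothing.
Context (R : realType) (n : nat).
Variable mu : {sigma_finite_measure set (Rn R n) -> \bar R}.
Hypothesis mu_leb : is_lebesgue mu.
Implicit Types (x y v : 'rV[R]_n) (f g h : 'rV[R]_n -> R).

Let mflip f x : continuous f -> measurable_fun setT (fun y : Rn R n => f (x - (y : 'rV[R]_n))).
Proof. by move=> cf; apply: measurable_flip; exact: continuous_Rn_measurable. Qed.

Lemma is_derive_conv f f' h v (C C' : R) : continuous f -> continuous f' ->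
  (forall x, `|f x| <= C) -> (forall x, `|f' x| <= C') -> L1 mu h ->
  (forall x, is_derive (0 : R) 1 (fun t : R => f (x + t *: v)) (f' x)) ->
  forall x, is_derive (0 : R) 1 (fun t : R => conv mu f h (x + t *: v)) (conv mu f' h x).
Proof.
move=> cf cf' fC fC' hi df x.
have H := @is_derive_Rint _ (Rn R n) R mu (fun t y => f (x + t *: v - y) * h y)
  (fun t y => f' (x + t *: v - y) * h y) (fun y => `|C' * h y|) 0.
have -> : conv mu f' h x = \int[mu]_y (f' (x + (0 : R) *: v - y) * h y).
  by rewrite scale0r addr0.
apply: H.
- move=> u y; have d := df (x + u *: v - y).
  have du : is_derive u 1 (fun w : R => w - u) (1 : R).
    by apply: (deq (dadd (did u) (dopp (dcst u u)))); rewrite oppr0 addr0.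
  have d' : is_derive (u - u) 1 (fun t : R => f (x + u *: v - y + t *: v)) (f' (x + u *: v - y)).
    by rewrite subrr.
  have dd := @dcomp _ u (fun t : R => f (x + u *: v - y + t *: v)) (fun w => w - u) _ _ d' du.
  rewrite (_ : (fun w : R => f (x + w *: v - y) * h y) =
    (fun w : R => f (x + u *: v - y + (w - u) *: v) * h y)); last first.
    by apply/funext => w; congr (f _ * _); apply/rowP => j; rewrite !mxE; ring.
  by apply: (deq (dmul dd (dcst u (h y)))); rewrite mulr1 mulr0 addr0.
- move=> u; apply: eq_integrable (L1M hi (mflip (x + u *: v) cf) (fun y => fC _)) => // y _ /=.
  by rewrite mulrC.
- by apply: L1_norm; exact: L1Z.
- move=> u y; rewrite !normrM; apply: ler_wpM2r => //.
  by apply: le_trans (fC' _) _; exact: ler_norm.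
Qed.

(* By sequences: dominated convergence is only available for them. *)
Lemma conv_continuous f h (C : R) : continuous f -> (forall x, `|f x| <= C) -> L1 mu h ->
  continuous (conv mu f h).
Proof.
move=> cf fC hi; have C0 : 0 <= C := le_trans (normr_ge0 _) (fC 0).
suff key (x : 'rV[R]_n) (e : R) : 0 < e -> exists2 d : R, 0 < d &
    forall y, ball x d y -> `|conv mu f h x - conv mu f h y| < e.
  move=> x A /nbhs_ballP[e /= e0 eA]; have [d d0 H] := key x e e0.
  by apply/nbhs_ballP; exists d => //= y xy; apply: eA; exact: H.
move=> e0; apply: contrapT => H.
have /choice[y yP] : forall k : nat, exists y : 'rV[R]_n, ball x k.+1%:R^-1 y /\
    ~ (`|conv mu f h x - conv mu f h y| < e).
  move=> k; apply: contrapT => K; apply: H; exists k.+1%:R^-1; first by rewrite invr_gt0.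
  by move=> y xy; apply: contrapT => Hy; apply: K; exists y.
have yx : y @ \oo --> x.
  apply/cvg_ballP => d d0; have := @cvg_harmonic R; move/cvgrPdist_lt => /(_ d d0).
  apply: filterS => k; rewrite sub0r normrN => kd.
  have [yk _] := yP k; apply: le_ball yk; apply: le_trans (ltW kd); exact: ler_norm.
have HD := @Rint_dct _ (Rn R n) R mu (fun k z => f (y k - z) * h z) (fun z => f (x - z) * h z)
  (fun z => `|C * h z|).
have : (fun k => conv mu f h (y k)) @ \oo --> conv mu f h x.
  apply: (proj2 (HD _ _ _ _)).
  - by move=> k; apply: measurable_funM; [exact: mflip|exact: L1_measurable hi].
  - move=> z; apply: cvgM; last exact: cvg_cst.
    apply: (@continuous_cvg _ _ _ _ _ _ f); first exact: cf.
    by apply: cvgB => //; exact: cvg_cst.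
  - by apply: L1_norm; exact: L1Z.
  - by move=> k z; rewrite !normrM; apply: ler_wpM2r => //; apply: le_trans (fC _) (ler_norm _).
move/cvgrPdist_lt => /(_ e e0) [N _ /(_ N (leqnn _))] /=.
by have [_] := yP N.
Qed.

(** All derivatives fall on the bump, so an iterated partial derivative of the convolution is again
    convolution with a member of [bumpf]. *)
Lemma smooth_conv (eps : R) f h : bumpf eps f -> L1 mu h -> smooth (conv mu f h).
Proof.
move=> bf hi.
have D g i : bumpf eps g -> exists2 g', bumpf eps g' &
    forall x, is_derive x (basis_vec R i) (conv mu g h) (conv mu g' h x).
  move=> bg; have [g' bg' H] := bump_derive i bg; exists g' => // x.
  have [C _ gC] := bump_le bg; have [C' _ gC'] := bump_le bg'.
  apply: is_derive_dir.
  exact: (is_derive_conv (bump_continuous bg) (bump_continuous bg') gC gC' hi H).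
have key l : exists2 g, bumpf eps g & iter_partial l (conv mu f h) = conv mu g h.
  elim: l => [|i l [g bg E]]; first by exists f.
  have [g' bg' H] := D g i bg; exists g' => //.
  rewrite /iter_partial /= -/(iter_partial l _) E.
  by apply/funext => x; have := H x => hx; exact: derive_val.
move=> l; have [g bg ->] := key l; have [C _ gC] := bump_le bg; split.
  exact: (conv_continuous (bump_continuous bg) gC hi).
by move=> i x; have [g' bg' H] := D g i bg; have [] := H x.
Qed.

Lemma bump_L1 (eps : R) f : bumpf eps f -> L1 mu f.
Proof.
move=> bf; have [C C0 fC] := bump_le bf.
pose d : R := `|eps| + 1.
apply: (@L1_le _ _ R mu _ (fun x => C * ind (hbox (const_mx (- d)) (const_mx d)) x)).
- by apply: continuous_Rn_measurable; exact: bump_continuous bf.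
- move=> x; have [xe|xe] := leP (eps ^+ 2) (dotv x x).
    by rewrite (bump_eq0 bf xe) normr0.
  rewrite normrM (ger0_norm C0) /ind indicE mem_set ?normr1 ?mulr1//.
  move=> i; rewrite !mxE; have := le_lt_trans (coord_sqr_le x i) xe.
  rewrite -[x ord0 i ^+ 2]real_normK ?num_real// -[eps ^+ 2]real_normK ?num_real//.
  rewrite ltr_pXn2r ?nnegrE// => h.
  by have := ler_norm (x ord0 i); have := ler_norm (- x ord0 i); rewrite normrN /d => ? ?; apply/andP; split; lra.
- by apply: L1Z; exact: ind_hbox_L1.
Qed.

Lemma bump_exists (eps : R) : 0 < eps -> exists beta, [/\ bumpf eps beta,
  forall x, 0 <= beta x, forall x, beta (- x) = beta x & \int[mu]_x beta x = 1].
Proof.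
move=> e0; pose b (x : 'rV[R]_n) : R := eta 1 (eps ^+ 2 - dotv x x).
have bb : bumpf eps b by exact: bump_eta.
have b0 x : 0 <= b x by rewrite /b /eta; case: ifPn => // _; rewrite hornerC mul1r expR_ge0.
have bi := bump_L1 bb.
have I0 : 0 < \int[mu]_x b x.
  (* On the cube of half-side [d] one has |x|^2 <= n d^2 <= eps^2 / 2, so the bump is at least [m] =
     exp(- 2 / eps^2) there. *)
  pose d : R := eps / (2 * n.+1%:R); have d0 : 0 < d by rewrite divr_gt0// mulr_gt0.
  pose Q : set (Rn R n) := hbox (const_mx (- d)) (const_mx d).
  have mQ : measurable Q by exact: hbox_measurable.
  have muQ : mu Q = ((2 * d) ^+ n)%:E.
    rewrite mu_leb; last by move=> i; rewrite !mxE; lra.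
    under eq_bigr do rewrite !mxE.
    by rewrite prodr_const card_ord; congr (_ ^+ _)%:E; ring.
  pose m : R := expR (- (2 / eps ^+ 2)).
  apply: (@lt_le_trans _ _ (m * (2 * d) ^+ n)).
    by rewrite mulr_gt0 ?expR_gt0// exprn_gt0// mulr_gt0.
  rewrite -lee_fin RintegralE// EFinM -muQ.
  have -> : (mu Q = \int[mu]_x (\1_Q x)%:E)%E by rewrite integral_indic// setIT.
  rewrite -ge0_integralZl//; [|by apply/measurable_EFinP; exact: measurable_indic|by rewrite lee_fin expR_ge0].
  apply: ge0_le_integral => //.
  - by move=> x _; rewrite -EFinM lee_fin mulr_ge0// expR_ge0.
  - by apply/measurable_EFinP; apply: measurable_funM => //; exact: measurable_indic.
  - by apply/measurable_EFinP; exact: L1_measurable bi.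
  - move=> x _; rewrite -EFinM lee_fin indicE; case: (boolP (x \in Q)) => [|_]; last by rewrite mulr0.
    rewrite inE mulr1 => xQ; have xd : dotv (x : 'rV[R]_n) x <= eps ^+ 2 / 2.
      apply: (@le_trans _ _ (\sum_(i < n) d ^+ 2)).
        apply: ler_sum => i _; rewrite -expr2 -[leLHS]real_normK ?num_real//.
        apply: lerXn2r; rewrite ?nnegrE ?(ltW d0)//.
        have := xQ i; rewrite !mxE => /andP[h1 h2]; rewrite ler_norml; apply/andP; split; lra.
      have key (N z : R) : 0 <= N -> N * z ^+ 2 <= (2 * (N + 1) * z) ^+ 2 / 2.
        move=> N0; have Z0 := sqr_ge0 z.
        rewrite [leRHS](_ : _ = 2 * (N * N * z ^+ 2) + 4 * (N * z ^+ 2) + 2 * z ^+ 2); last by field.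
        by have := mulr_ge0 (mulr_ge0 N0 N0) Z0; have := mulr_ge0 N0 Z0; lra.
      have dE : 2 * (n%:R + 1) * d = eps by rewrite /d natr1 mulrC divfK// mulf_neq0.
      by rewrite sumr_const card_ord -[leLHS]mulr_natl -[in leRHS]dE; exact: key.
    have t0 : 0 < eps ^+ 2 - dotv (x : 'rV[R]_n) x by have := exprn_gt0 2 e0; lra.
    rewrite /b /eta t0 hornerC mul1r ler_expR lerN2.
    have -> : 2 / eps ^+ 2 = (eps ^+ 2 / 2)^-1 by rewrite invf_div.
    by rewrite lef_pV2 ?posrE ?divr_gt0 ?exprn_gt0//; lra.
exists (fun x => (\int[mu]_x b x)^-1 * b x); split.
- exact: bump_scale.
- by move=> x; rewrite mulr_ge0// invr_ge0 ltW.
- by move=> x; rewrite /b dotvNl dotvNr opprK.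
- by rewrite RintZT// mulVf// gt_eqF.
Qed.

End smoothing.

(** a + b is at most twice the larger term. The crude constant is valid both for r = p and for r = 1
    / p. *)
Lemma powR_add_le (R : realType) (r a b : R) : 0 <= r -> 0 <= a -> 0 <= b ->
  (a + b) `^ r <= 2 `^ r * (a `^ r + b `^ r).
Proof.
move=> r0 a0 b0.
wlog ab : a b a0 b0 / a <= b.
  move=> W; have [ab|ba] := leP a b; first exact: W.
  by rewrite addrC [X in _ * X]addrC; apply: W => //; exact: ltW.
apply: (@le_trans _ _ ((2 * b) `^ r)).
  by apply: ge0_ler_powR => //; rewrite ?nnegrE; lra.
rewrite powRM//; apply: ler_wpM2l; first exact: powR_ge0.
by rewrite lerDr powR_ge0.
Qed.

(** * L^p functions, translations and supports *)

Section Lp_tools.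
Context (R : realType) (n : nat).
Variable mu : {sigma_finite_measure set (Rn R n) -> \bar R}.
Hypothesis mu_leb : is_lebesgue mu.
Implicit Types (x y c : 'rV[R]_n) (f g k v w : 'rV[R]_n -> R).
Variable p : R.
Hypothesis p1 : 1 <= p.

Definition Lp v : Prop := measurable_fun setT (v : Rn R n -> R) /\ L1 mu (fun x => `|v x| `^ p).

Lemma Lp_mul_L1 v w (M : R) : Lp v -> L1 mu w -> (forall x, `|w x| <= M) ->
  L1 mu (fun x => v x * w x).
Proof.
move=> [mv vp] wi wM; have M0 : 0 <= M := le_trans (normr_ge0 _) (wM 0).
apply: (@L1_le _ _ R mu _ (fun x => `|w x| + M * `|v x| `^ p)).
- by apply: measurable_funM => //; exact: L1_measurable wi.
- move=> x; rewrite normrM; apply: le_trans (ler_norm _).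
  have h := le_1powR p1 (normr_ge0 (v x)).
  apply: (@le_trans _ _ ((1 + `|v x| `^ p) * `|w x|)); first exact: ler_wpM2r.
  by rewrite mulrDl mul1r lerD2l mulrC ler_wpM2r ?powR_ge0.
- by apply: L1D; [exact: L1_norm|exact: L1Z].
Qed.

Lemma Lp_add v w : Lp v -> Lp w -> Lp (fun x => v x + w x) /\
  \int[mu]_x (`|v x + w x| `^ p) <= 2 `^ p * (\int[mu]_x (`|v x| `^ p) + \int[mu]_x (`|w x| `^ p)).
Proof.
move=> [mv vp] [mw wp]; have p0 : 0 <= p := le_trans ler01 p1.
have ms : measurable_fun setT (fun x : Rn R n => v x + w x) by exact: measurable_funD.
have bi : L1 mu (fun x => 2 `^ p * (`|v x| `^ p + `|w x| `^ p)) by apply: L1Z; exact: L1D.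
have le x : `|v x + w x| `^ p <= 2 `^ p * (`|v x| `^ p + `|w x| `^ p).
  apply: le_trans (powR_add_le p0 (normr_ge0 _) (normr_ge0 _)).
  by apply: ge0_ler_powR => //; rewrite ?nnegrE ?addr_ge0// ler_normD.
have mp := @powR_measurable R n p _ ms.
have [si sle] := ge0_ae_le_Rint mp (fun x => powR_ge0 _ _) (aeW mu le) bi.
split; first by split.
apply: le_trans sle _; rewrite RintZT; last exact: L1D.
by rewrite RintDT.
Qed.

Lemma Lp_opp v : Lp v -> Lp (fun x => - v x).
Proof.
move=> [mv vp]; split; first exact: measurableT_comp.
by apply: eq_integrable vp => // x _ /=; rewrite normrN.
Qed.

Lemma Lp_sub v w : Lp v -> Lp w -> Lp (fun x => v x - w x).
Proof. by move=> hv hw; have [] := Lp_add hv (Lp_opp hw). Qed.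

Lemma Lp_shift v c : Lp v -> Lp (fun x => v (x + c)).
Proof.
move=> [mv vp]; split; first exact: (measurableT_comp mv (@add_Rn_measurable R n c)).
exact: (L1_translation mu_leb c vp).
Qed.

Lemma Lp_conv k v : L1 mu k -> Lp v -> Lp (conv mu k v).
Proof.
move=> ki [mv vp]; split; first by apply: conv_measurable => //; exact: L1_measurable ki.
by have [] := young mu_leb p1 ki mv vp.
Qed.

Lemma conv_shift k v c x : measurable_fun setT (k : Rn R n -> R) -> measurable_fun setT (v : Rn R n -> R) ->
  conv mu k (fun y => v (y + c)) x = conv mu k v (x + c).
Proof.
move=> mk mv; rewrite /conv.
have mF : measurable_fun setT (fun y : Rn R n => k (x + c - (y : 'rV[R]_n)) * v y).
  by apply: measurable_funM => //; exact: measurable_flip.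
rewrite -[RHS](Rint_translation mu_leb c mF).
by apply: eq_RintegralT => y; congr (k _ * _); apply/rowP => j; rewrite !mxE; ring.
Qed.

(** Supports are measured coordinate by coordinate, in keeping with the balls of the topology and
    with boxes; sizes add under convolution. *)
Definition csupp (a : R) f := forall x, f x != 0 -> forall i, `|x ord0 i| < a.

Lemma csupp_conv (a b : R) f g : csupp a f -> csupp b g -> csupp (a + b) (conv mu f g).
Proof.
move=> cf cg x fx i; rewrite ltNge; apply/negP => h; move/negP: fx; apply; apply/eqP.
rewrite -[RHS](Rint0 mu); apply: eq_RintegralT => y.
have [->|fy] := eqVneq (f (x - y)) 0; first by rewrite mul0r.
have [->|gy] := eqVneq (g y) 0; first by rewrite mulr0.
have := cf _ fy i; have := cg _ gy i; rewrite !mxE => h1 h2.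
have := ler_normD ((x - y) ord0 i) ((y : 'rV[R]_n) ord0 i); rewrite !mxE subrK => h3.
by have := lt_le_trans (ltrD h2 h1) (le_trans h h3); rewrite ltxx.
Qed.

Lemma csupp_bump (eps : R) f : 0 < eps -> bumpf eps f -> csupp eps f.
Proof.
move=> e0 bf x fx i; have : dotv x x < eps ^+ 2.
  by rewrite ltNge; apply/negP => h; rewrite (bump_eq0 bf h) eqxx in fx.
move/(le_lt_trans (coord_sqr_le x i)); rewrite -[x ord0 i ^+ 2]real_normK ?num_real//.
by rewrite ltr_pXn2r ?nnegrE// ltW.
Qed.

End Lp_tools.

(** * Admissible test functions and their fractional Laplacian *)

Section test_functions.
Context (R : realType) (n : nat).
Variable mu : {sigma_finite_measure set (Rn R n) -> \bar R}.
Hypothesis mu_leb : is_lebesgue mu.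
Implicit Types (x y c xi : 'rV[R]_n) (f g phi : 'rV[R]_n -> R).

Lemma fsupport_csupp (delta : R) phi c (Om : set 'rV[R]_n) :
  csupp delta phi -> (forall x, (forall i, `|x ord0 i - c ord0 i| <= delta) -> Om x) ->
  compact (fsupport (fun x => phi (x - c))) /\ fsupport (fun x => phi (x - c)) `<=` Om.
Proof.
(* Passing to the closure of the support weakens the strict bound to a large one, which is why [Om]
   must contain the closed cube. *)
move=> cp Ob; have K x : fsupport (fun x => phi (x - c)) x -> forall i, `|x ord0 i - c ord0 i| <= delta.
  move=> Sx i; apply/ler_addgt0Pl => e e0.
  have [y [/= py /(ball_coordP _ _ e0) xy]] := Sx _ (nbhsx_ballx x e e0).
  have := cp _ py i; rewrite !mxE => h; have := xy i.
  have := ler_normD (x ord0 i - y ord0 i) (y ord0 i - c ord0 i); rewrite addrA subrK; lra.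
split; last by move=> x /K; exact: Ob.
have Cc : compact [set v : 'rV[R]_n | forall i, `[c ord0 i - delta, c ord0 i + delta]%classic (v ord0 i)].
  by apply: (@rV_compact _ _ (fun i => `[c ord0 i - delta, c ord0 i + delta]%classic)) => i; exact: segment_compact.
apply: subclosed_compact Cc _; first exact: closed_closure.
by move=> x /K Kx i; have := Kx i; rewrite /= in_itv /= ler_distl.
Qed.

Lemma powR_enorm s xi : (2 * pi * enorm xi) `^ (2 * s) = lapsym xi `^ s.
Proof.
rewrite powRrM (powR_mulrn 2); last by rewrite !mulr_ge0 ?pi_ge0// sqrtr_ge0.
congr (_ `^ _); rewrite exprMn /enorm sqr_sqrtr ?dotv_ge0// /lapsym; ring.
Qed.

Lemma fourier_shift phi c xi : L1 mu phi -> (forall x, phi (- x) = phi x) ->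
  fourier mu (fun x => phi (x - c)) xi =
  Complex (cos (2 * pi * dotv c xi) * ct mu phi xi) (- (sin (2 * pi * dotv c xi) * ct mu phi xi)).
Proof.
move=> pi_ pN; have st0 := even_st0 mu_leb xi pN pi_; rewrite /fourier /cintegral; congr Complex.
  transitivity (\int[mu]_x (phi (x - c) * cos (2 * pi * dotv x xi))).
    by apply: eq_RintegralT => x; rewrite /= mul0r subr0 cosN.
  by rewrite ct_shift// st0 mulr0 subr0.
transitivity (\int[mu]_x (-1 * (phi (x - c) * sin (2 * pi * dotv x xi)))).
  by apply: eq_RintegralT => x; rewrite /= mul0r addr0 sinN; ring.
rewrite RintZT; last first.
  have := L1_translation mu_leb (- c) pi_ => h; exact: (L1_sin xi h).
by rewrite st_shift// st0 mulr0 add0r mulN1r.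
Qed.

(** The phase due to the translation merges with that of the inverse transform and gives the
    argument x - c. The symbol being even, the sine part vanishes and the value is real. *)
Lemma frac_lap_shift s phi c x : L1 mu phi -> (forall x, phi (- x) = phi x) ->
  L1 mu (fun xi => lapsym xi `^ s * ct mu phi xi) ->
  frac_lap mu s (fun x => phi (x - c)) x =
  Complex (ct mu (fun xi => lapsym xi `^ s * ct mu phi xi) (x - c)) 0.
Proof.
move=> pi_ pN Ai; set A := fun xi => _ in Ai *.
have AN xi : A (- xi) = A xi.
  rewrite /A /lapsym dotvNl dotvNr opprK; congr (_ * _).
  by apply: eq_RintegralT => y; rewrite dotvNr mulrN cosN.
have stA := even_st0 mu_leb (x - c) AN Ai.
have E xi : 2 * pi * dotv xi (x - c) = 2 * pi * dotv x xi - 2 * pi * dotv c xi.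
  by rewrite dotvDr dotvNr (dotvC xi x) (dotvC xi c); ring.
rewrite /frac_lap /ifourier /cintegral; congr Complex; last rewrite -stA.
  apply: eq_RintegralT => xi; rewrite fourier_shift// powR_enorm /=.
  by rewrite E cosB /A; ring.
apply: eq_RintegralT => xi; rewrite fourier_shift// powR_enorm /=.
by rewrite E sinB /A; ring.
Qed.

End test_functions.

(** * The representation of solutions *)

Section local_identity.
Context (R : realType) (n : nat).
Variable mu : {sigma_finite_measure set (Rn R n) -> \bar R}.
Hypothesis mu_leb : is_lebesgue mu.
Implicit Types (x y c xi : 'rV[R]_n).
Variables (s rho0 p : R).
Hypotheses (s01 : 0 < s < 1) (rho0_gt0 : 0 < rho0) (p1 : 1 <= p).

Variables (u F : 'rV[R]_n -> R).
Hypotheses (uLp : Lp mu p u) (FLp : Lp mu p F).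

Notation B0 := (@bessel R n s).
Notation rk := (rker mu s rho0).
Notation mk := (mker mu s rho0).
Notation P := (@par R n s rho0).

(** In the application [F] is [f] extended by zero outside the domain. *)
Definition density x : R := F x - conv mu rk F x + conv mu mk u x.

Let ri : L1 mu rk := rker_L1 mu_leb s01 rho0_gt0.
Let mi : L1 mu mk := mker_L1 mu_leb s01 rho0_gt0.
Let rN : forall x, rk (- x) = rk x := rkerN mu_leb s01 rho0_gt0.
Let mN : forall x, mk (- x) = mk x := mkerN mu_leb s01 rho0_gt0.
Let s02 : 0 < s <= 2. Proof. by case/andP: s01 => ? ?; apply/andP; split; lra. Qed.
Let Bi : L1 mu B0 := bessel_L1 mu_leb s02.

Let rFLp : Lp mu p (conv mu rk F) := Lp_conv mu_leb p1 ri FLp.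
Let muLp : Lp mu p (conv mu mk u) := Lp_conv mu_leb p1 mi uLp.

Lemma density_Lp : Lp mu p density.
Proof. by have [] := Lp_add p1 (Lp_sub p1 FLp rFLp) muLp. Qed.

Local Opaque rker mker bessel.

Lemma duality v k w (M : R) : Lp mu p v -> L1 mu k -> (forall x, k (- x) = k x) ->
  L1 mu w -> (forall x, `|w x| <= M) ->
  \int[mu]_x (v x * conv mu k w x) = \int[mu]_x (conv mu k v x * w x).
Proof.
by move=> [mv vp] ki kN wi wM; rewrite (conv_duality mu_leb p1 ki mv vp kN wi wM).
Qed.

Section test_pair.
Variables (beta : 'rV[R]_n -> R) (Mb : R) (c : 'rV[R]_n).
Hypotheses (bi : L1 mu beta) (bN : forall x, beta (- x) = beta x) (bM : forall x, `|beta x| <= Mb).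

Notation theta := (conv mu beta beta).
Notation phi := (conv mu beta (conv mu beta P)).
Notation A := (fun xi => lapsym xi `^ s * ct mu phi xi).
Notation Bt := (conv mu B0 theta).

(** The equation tested with phi(x - c), its left side already written as an inverse transform
    evaluated at x - c. *)
Hypothesis weak : \int[mu]_x (u x * ct mu A (x - c)) = \int[mu]_x (F x * phi (x - c)).

Let mb := L1_measurable bi.
Let ti : L1 mu theta := conv_L1 mu_leb bi bi.
Let tM : forall x, `|theta x| <= Mb * \int[mu]_x `|beta x| := norm_conv_le mu_leb bi mb bM.
Let Bti : L1 mu Bt := conv_L1 mu_leb Bi ti.
Let BtM := norm_conv_le mu_leb Bi (L1_measurable ti) tM.
Let mBti : L1 mu (conv mu mk Bt) := conv_L1 mu_leb mi Bti.
Let mBtM := norm_conv_le mu_leb mi (L1_measurable Bti) BtM.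
Let rBti : L1 mu (conv mu rk Bt) := conv_L1 mu_leb ri Bti.
Let rBtM := norm_conv_le mu_leb ri (L1_measurable Bti) BtM.

Let uc x := u (x + c).
Let Fc x := F (x + c).
Let uLc : Lp mu p uc := Lp_shift mu_leb c uLp.
Let FLc : Lp mu p Fc := Lp_shift mu_leb c FLp.

Let phii : L1 mu phi := conv_L1 mu_leb bi (conv_L1 mu_leb bi (par_L1 mu_leb s01 rho0_gt0)).

Let Ai : L1 mu A.
Proof.
have := ct_nker_L1 mu_leb s01 rho0_gt0 bi bN bM.
by rewrite (funext (ct_nker mu_leb s01 rho0_gt0 bi bN) : ct mu _ = _).
Qed.

Let shift_pair (v w : 'rV[R]_n -> R) : measurable_fun setT (v : Rn R n -> R) ->
  measurable_fun setT (w : Rn R n -> R) ->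
  \int[mu]_x (v x * w (x - c)) = \int[mu]_x (v (x + c) * w x).
Proof.
move=> mv mw.
have mf : measurable_fun setT (fun x : Rn R n => v ((x : 'rV[R]_n) + c) * w x).
  by apply: measurable_funM => //; exact: (measurableT_comp mv (@add_Rn_measurable R n c)).
by rewrite -(Rint_shift mu_leb c mf); apply: eq_RintegralT => x; rewrite subrK.
Qed.

(** The translation is moved onto [u] and [F], and each side of the equation is replaced by the
    kernel expression it equals almost everywhere. *)
Let weak0 : \int[mu]_x (uc x * nker mu s rho0 beta x) = \int[mu]_x (Fc x * (Bt x - conv mu rk Bt x)).
Proof.
have mA : measurable_fun setT (ct mu A : Rn R n -> R) by apply: ct_measurable; exact: L1_measurable Ai.
have Ni := nker_L1 mu_leb s01 rho0_gt0 bi.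
have E1 : \int[mu]_x (uc x * nker mu s rho0 beta x) = \int[mu]_x (uc x * ct mu A x).
  apply: ae_eq_RintT.
  - by apply: measurable_funM; [case: uLc|exact: L1_measurable Ni].
  - by apply: measurable_funM; [case: uLc|].
  - by apply: filterS (nker_inversion mu_leb s01 rho0_gt0 bi bN bM) => x E _; rewrite E.
have E2 : \int[mu]_x (Fc x * phi x) = \int[mu]_x (Fc x * (Bt x - conv mu rk Bt x)).
  apply: ae_eq_RintT.
  - by apply: measurable_funM; [case: FLc|exact: L1_measurable phii].
  - by apply: measurable_funM; [case: FLc|exact: L1_measurable (L1B Bti rBti)].
  - by apply: filterS (test_ae mu_leb s01 rho0_gt0 bi bN) => x E _; rewrite E.
rewrite E1 -E2 -(shift_pair (proj1 uLp) mA) -(shift_pair (proj1 FLp) (L1_measurable phii)).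
exact: weak.
Qed.

Let dc x := density (x + c).

Let dcE x : dc x = Fc x - conv mu rk Fc x + conv mu mk uc x.
Proof.
rewrite /dc /density /Fc /uc.
rewrite (conv_shift mu_leb c x (L1_measurable ri) (proj1 FLp)).
by rewrite (conv_shift mu_leb c x (L1_measurable mi) (proj1 uLp)).
Qed.

(** The kernels are even, so duality moves them from the test function to [u] and [F]. Apart from u
    theta, everything is then a pairing with B * theta; collecting the terms produces [density], and
    a last duality moves B onto it. *)
Lemma weak_pairing : \int[mu]_x (uc x * theta x) = \int[mu]_x (conv mu B0 density (x + c) * theta x).
Proof.
have e1 : \int[mu]_x (uc x * nker mu s rho0 beta x) =
    \int[mu]_x (uc x * theta x) - \int[mu]_x (conv mu mk uc x * Bt x).
  rewrite -(duality uLc mi mN Bti BtM).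
  rewrite -RintBT; [|exact: (Lp_mul_L1 p1 uLc ti tM)|exact: (Lp_mul_L1 p1 uLc mBti mBtM)].
  by apply: eq_RintegralT => x; rewrite /nker mulrBr.
have mucLp := Lp_conv mu_leb p1 mi uLc.
have rFcLp := Lp_conv mu_leb p1 ri FLc.
have e2 : \int[mu]_x (Fc x * (Bt x - conv mu rk Bt x)) =
    \int[mu]_x (Fc x * Bt x) - \int[mu]_x (conv mu rk Fc x * Bt x).
  rewrite -(duality FLc ri rN Bti BtM).
  rewrite -RintBT; [|exact: (Lp_mul_L1 p1 FLc Bti BtM)|exact: (Lp_mul_L1 p1 FLc rBti rBtM)].
  by apply: eq_RintegralT => x; rewrite mulrBr.
have e3 : \int[mu]_x (dc x * Bt x) = \int[mu]_x (Fc x * Bt x) - \int[mu]_x (conv mu rk Fc x * Bt x)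
    + \int[mu]_x (conv mu mk uc x * Bt x).
  have i1 := Lp_mul_L1 p1 FLc Bti BtM; have i2 := Lp_mul_L1 p1 rFcLp Bti BtM.
  have i3 := Lp_mul_L1 p1 mucLp Bti BtM.
  rewrite -(RintBT i1 i2) -(RintDT (L1B i1 i2) i3).
  by apply: eq_RintegralT => x; rewrite dcE mulrDl mulrBl.
have dLc : Lp mu p dc := Lp_shift mu_leb c density_Lp.
have e4 : \int[mu]_x (dc x * Bt x) = \int[mu]_x (conv mu B0 density (x + c) * theta x).
  rewrite (duality dLc Bi (@besselN R n s) ti tM).
  have E x : conv mu B0 dc x = conv mu B0 density (x + c) :=
    conv_shift mu_leb c x (L1_measurable Bi) (proj1 density_Lp).
  exact: (@eq_RintegralT _ _ _ mu (fun x => conv mu B0 dc x * theta x)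
    (fun x => conv mu B0 density (x + c) * theta x) (fun x => congr1 (fun t => t * theta x) (E x))).
have aux (a b d e N D T U : R) : N = a - b -> D = d - e -> T = d - e + b -> T = U -> N = D -> a = U.
  by move=> -> -> -> <- E; rewrite -E; ring.
exact: (aux _ _ _ _ _ _ _ _ e1 e2 e3 e4 weak0).
Qed.

Let tN x : theta (- x) = theta x.
Proof. exact: (conv_even mu_leb bN bN mb mb). Qed.

(** As theta is even, (theta * v)(c) is the pairing of theta with v translated by c. *)
Lemma conv_theta_eq0 : conv mu theta (fun y => u y - conv mu B0 density y) c = 0.
Proof.
have BdLp : Lp mu p (conv mu B0 density) := Lp_conv mu_leb p1 Bi density_Lp.
have vLp := Lp_sub p1 uLp BdLp; set v := fun y => _ in vLp *.
have mf : measurable_fun setT (fun z : Rn R n => theta z * v (c - (z : 'rV[R]_n))).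
  by apply: measurable_funM; [exact: L1_measurable ti|exact: (measurable_flip c (proj1 vLp))].
transitivity (\int[mu]_z (theta z * v (c - z))).
  rewrite -(Rint_flip mu_leb c mf); apply: eq_RintegralT => y.
  by rewrite opprB addrCA subrr addr0.
rewrite -(Rint_reflection mu_leb mf).
transitivity (\int[mu]_x (uc x * theta x - conv mu B0 density (x + c) * theta x)).
  by apply: eq_RintegralT => x; rewrite tN opprK [c + x]addrC -mulrBl mulrC.
rewrite RintBT; [by rewrite weak_pairing subrr|exact: (Lp_mul_L1 p1 uLc ti tM)|].
exact: (Lp_mul_L1 p1 (Lp_shift mu_leb c BdLp) ti tM).
Qed.

End test_pair.
End local_identity.

(** * From pairings to an identity almost everywhere *)

Section main_identity.
Context (R : realType) (n : nat).
Variable mu : {sigma_finite_measure set (Rn R n) -> \bar R}.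
Hypothesis mu_leb : is_lebesgue mu.
Implicit Types (x y c xi : 'rV[R]_n) (Om : set 'rV[R]_n).

(** Near each point of the compact closure some radius works uniformly; compactness in its covering
    form yields one radius for all points. *)
Lemma thickening (O Om : set 'rV[R]_n) : compact (closure O) -> closure O `<=` Om -> open Om ->
  exists2 d : R, 0 < d & forall c x, O c -> (forall i, `|x ord0 i - c ord0 i| <= d) -> Om x.
Proof.
move=> cO OOm oOm.
pose Q (d : R) c := forall x, (forall i, `|x ord0 i - c ord0 i| <= d) -> Om x.
have NC := (compact_near_coveringP (closure O)).1 cO.
have : \forall d \near (0 : R)^'+, closure O `<=` Q d.
  apply: NC => c Oc.
  have /nbhs_ballP[e /= e0 eOm] := open_nbhs_nbhs (conj oOm (OOm c Oc)).
  have e20 : 0 < e / 2 by rewrite divr_gt0.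
  exists (ball c (e / 2), [set d : R | d < e / 2]) => /=.
    by split; [exact: nbhsx_ballx|exact: nbhs_right_lt].
  move=> [c' d] [/= /(ball_coordP _ _ e20) cc' de] x xd; apply: eOm.
  apply/(ball_coordP _ _ e0) => i; have := cc' i; have := xd i.
  have := ler_normD (c ord0 i - c' ord0 i) (c' ord0 i - x ord0 i).
  by rewrite addrA subrK [`|c' ord0 i - x ord0 i|]distrC; lra.
move=> H; have : \forall d \near (0 : R)^'+, 0 < d /\ closure O `<=` Q d.
  by near=> d; split; near: d; [exact: nbhs_right_gt|exact: H].
move=> H'; have [d [d0 Hd]] := filter_ex H'; exists d => // c x Oc.
by apply: Hd; exact: subset_closure.
Unshelve. all: by end_near. Qed.

Section local_identity_ae.
Variables (s p delta : R) (Om Om' : set 'rV[R]_n) (u f : 'rV[R]_n -> R).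
Hypotheses (s01 : 0 < s < 1) (p1 : 1 <= p) (delta0 : 0 < delta).
Hypotheses (oOm : open Om) (oOm' : open Om').
Hypothesis near_Om : forall c x, Om' c -> (forall i, `|x ord0 i - c ord0 i| <= delta) -> Om x.
Let F x : R := f x * ind Om x.
Hypotheses (uLp : Lp mu p u) (FLp : Lp mu p F).
Hypothesis sol : dist_solution mu s Om u f.

(** The test function beta * (beta * P) has three factors, each supported within [d0], so it reaches
    no further than delta. As [cutoff] is a function of |x|^2, its parameter is [d0 ^+ 2]. *)
Let d0 : R := delta / 3.
Let d00 : 0 < d0. Proof. by rewrite divr_gt0. Qed.
Let rho0 : R := d0 ^+ 2.
Let rho00 : 0 < rho0. Proof. by rewrite exprn_gt0. Qed.

Notation P := (@par R n s rho0).
Notation g := (density mu s rho0 u F).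

Let P_csupp : csupp d0 P.
Proof.
move=> x Px i; have : dotv x x < d0 ^+ 2.
  by rewrite ltNge; apply/negP => h; rewrite /par (cutoff_eq0 rho00 h) mul0r eqxx in Px.
move/(le_lt_trans (coord_sqr_le x i)); rewrite -[x ord0 i ^+ 2]real_normK ?num_real//.
by rewrite ltr_pXn2r ?nnegrE// ltW.
Qed.

(** This is where the equation enters: phi(x - c) is supported within delta of a point of Omega',
    hence is admissible, and the real part of the equation is the hypothesis of [conv_theta_eq0]. *)
Lemma conv_bump_eq0 (eps : R) (beta : 'rV[R]_n -> R) c : 0 < eps -> eps <= d0 -> bumpf eps beta ->
  (forall x, beta (- x) = beta x) -> Om' c ->
  conv mu (conv mu beta beta) (fun y => u y - conv mu (bessel s) g y) c = 0.
Proof.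
move=> e0 ed bb bN cO; have [Mb _ bM] := bump_le bb; have bi := bump_L1 mu_leb bb.
apply: (conv_theta_eq0 mu_leb s01 rho00 p1 uLp FLp bi bN bM).
have Pi := par_L1 mu_leb s01 rho00; have hi := conv_L1 mu_leb bi Pi.
have phii := conv_L1 mu_leb bi hi.
have hN : forall x, conv mu beta P (- x) = conv mu beta P x.
  exact: (conv_even mu_leb bN (@parN R n s rho0) (L1_measurable bi) (L1_measurable Pi)).
have phiN : forall x, conv mu beta (conv mu beta P) (- x) = conv mu beta (conv mu beta P) x.
  exact: (conv_even mu_leb bN hN (L1_measurable bi) (L1_measurable hi)).
set phi := conv mu beta (conv mu beta P) in phii phiN *.
have Ai : L1 mu (fun xi => lapsym xi `^ s * ct mu phi xi).
  have := ct_nker_L1 mu_leb s01 rho00 bi bN bM.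
  by rewrite (funext (ct_nker mu_leb s01 rho00 bi bN) : ct mu _ = _).
have tst : test_fun Om (fun x => phi (x - c)).
  have cs : csupp delta phi.
    have cb := csupp_bump e0 bb.
    move=> x px i; apply: lt_le_trans (csupp_conv cb (csupp_conv cb P_csupp) px i) _.
    by move: ed; rewrite /d0; lra.
  have [cK KO] := fsupport_csupp cs (fun x => @near_Om c x cO).
  split => //.
  have -> : (fun x => phi (x - c)) = conv mu beta (fun y => conv mu beta P (y - c)).
    by apply/funext => x; rewrite (conv_shift mu_leb (- c) x (L1_measurable bi) (L1_measurable hi)).
  have h2 : L1 mu (fun y : Rn R n => conv mu beta P ((y : 'rV[R]_n) - c)) := L1_translation mu_leb (- c) hi.
  exact: (@smooth_conv R n mu eps beta (fun y => conv mu beta P (y - c)) bb h2).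
have /(congr1 (@complex.Re R)) := sol tst.
rewrite /cintegral /= => E.
transitivity (\int[mu]_x complex.Re ((u x)%:C%C * frac_lap mu s (fun x => phi (x - c)) x)).
  apply: eq_RintegralT => x; rewrite (frac_lap_shift mu_leb c x phii phiN Ai) /=.
  by rewrite mul0r subr0.
rewrite E /Rintegral integral_mkcond; congr fine; apply: eq_integral => x _.
by rewrite patchE /F /ind indicE; case: ifPn => _; rewrite ?mulr1// mulr0 mul0r.
Qed.

(** The functions beta_j * beta_j form an approximate identity, and their convolutions with v = u -
    B * g vanish on Omega'. In the limit [v] integrates to 0 over every box inside Omega'. *)
Lemma solution_ae : {ae mu, forall x : Rn R n, Om' x -> u x = conv mu (bessel s) g x}.
Proof.
have gLp : Lp mu p g := density_Lp mu_leb s01 rho00 p1 uLp FLp.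
have s02 : 0 < s <= 2 by case/andP: s01 => ? ?; apply/andP; split; lra.
have BLp : Lp mu p (conv mu (bessel s) g) := Lp_conv mu_leb p1 (bessel_L1 mu_leb s02) gLp.
pose v y := u y - conv mu (bessel s) g y.
have vLp : Lp mu p v := Lp_sub p1 uLp BLp.
pose eps (j : nat) : R := d0 / j.+1%:R.
have eps0 j : 0 < eps j by rewrite divr_gt0.
have epsd j : eps j <= d0 by rewrite ler_pdivrMr// ler_peMr ?ler1n// ltW.
have /choice[beta betaP] : forall j, exists beta, [/\ bumpf (eps j) beta,
    forall x, 0 <= beta x, forall x, beta (- x) = beta x & \int[mu]_x beta x = 1].
  by move=> j; exact: (bump_exists mu_leb (eps0 j)).
pose k j := conv mu (beta j) (beta j).
have bi j : L1 mu (beta j) by have [bb _ _ _] := betaP j; exact: (bump_L1 mu_leb bb).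
have ki j : L1 mu (k j) by exact: (conv_L1 mu_leb (bi j) (bi j)).
have k0 j x : 0 <= k j x.
  have [_ b0 _ _] := betaP j.
  by apply: Rintegral_ge0 => y _; exact: mulr_ge0.
have ct0 (h : 'rV[R]_n -> R) : ct mu h 0 = \int[mu]_x h x.
  apply: eq_RintegralT => x; rewrite (_ : dotv (x : 'rV[R]_n) 0 = 0) ?mulr0 ?cos0 ?mulr1//.
  by rewrite /dotv big1// => i _; rewrite mxE mulr0.
have k1 j : \int[mu]_x k j x = 1.
  have [_ _ bN b1] := betaP j.
  by rewrite -ct0 /k (ct_conv mu_leb 0 bN (bi j) (bi j)) !ct0 b1 mulr1.
have kN j x : k j (- x) = k j x.
  have [_ _ bN b1] := betaP j.
  exact: (conv_even mu_leb bN bN (L1_measurable (bi j)) (L1_measurable (bi j))).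
have kc j : csupp (eps j + eps j) (k j).
  have [bb _ _ _] := betaP j; have cb := csupp_bump (eps0 j) bb; exact: csupp_conv.
(* Each coordinate is below 2 eps_j on the support of k_j, so the second moment is at most n (2
   eps_j)^2. *)
pose cj (j : nat) : R := n%:R * (eps j + eps j) ^+ 2.
have k2le j x : `|dotv x x * k j x| <= cj j * k j x.
  have [->|kx] := eqVneq (k j x) 0; first by rewrite !mulr0 normr0.
  have r0 : 0 <= dotv x x * k j x by apply: mulr_ge0; [exact: dotv_ge0|exact: k0].
  rewrite (ger0_norm r0); apply: ler_wpM2r; first exact: k0.
  apply: (@le_trans _ _ (\sum_(i < n) (eps j + eps j) ^+ 2)).
    apply: ler_sum => i _; rewrite -expr2 -[leLHS]real_normK ?num_real//.
    by apply: lerXn2r; rewrite ?nnegrE ?addr_ge0 ?(ltW (eps0 j))//; exact: ltW (kc j x kx i).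
  by rewrite sumr_const card_ord /cj mulr_natl.
have k2i j : L1 mu (fun x => dotv x x * k j x).
  apply: (@L1_le _ _ R mu _ (fun x => cj j * k j x)).
  - by apply: measurable_funM; [exact: dotvv_measurable|exact: L1_measurable (ki j)].
  - by move=> x; apply: le_trans (k2le j x) (ler_norm _).
  - exact: L1Z.
have k2 j : \int[mu]_x (dotv x x * k j x) <= cj j.
  apply: le_trans (ler_norm _) _.
  apply: le_trans (norm_Rint_le (k2i j) (L1Z (cj j) (ki j)) (k2le j)) _.
  by rewrite (RintZT _ (ki j)) k1 mulr1.
have c0 : cj @ \oo --> (0 : R).
  have e0 : eps @ \oo --> (0 : R).
    by rewrite -(mulr0 d0); apply: cvgM; [exact: cvg_cst|exact: cvg_harmonic].
  have e20 : (fun j => eps j + eps j) @ \oo --> (0 : R) by rewrite -(addr0 (0 : R)); exact: cvgD.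
  rewrite -(mulr0 (n%:R : R)); apply: cvgM; first exact: cvg_cst.
  by rewrite -(mulr0 (0 : R)); exact: (cvgM e20 e20).
have box_int a b : hbox a b `<=` Om' -> \int[mu]_x (v x * ind (hbox a b) x) = 0.
  (* [v] is only in L^p, while [approx_id_box] wants an integrable function, so [v] is cut to the
     box enlarged by delta. The pairings do not change: k_j spreads the indicator of the box by at
     most 2 eps_j <= 2 delta / 3. *)
  move=> abO; pose Q' := hbox (\row_i (a ord0 i - delta)) (\row_i (b ord0 i + delta)).
  pose v' y := v y * ind Q' y.
  have v'i : L1 mu v'.
    exact: (Lp_mul_L1 p1 vLp (ind_hbox_L1 mu_leb _ _) (@ind_norm _ _ _)).
  have I0 j : \int[mu]_x (v' x * conv mu (k j) (ind (hbox a b)) x) = 0.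
    transitivity (\int[mu]_x (v x * conv mu (k j) (ind (hbox a b)) x)).
      apply: eq_RintegralT => x; rewrite /v' /ind [X in _ * X * _]indicE.
      have [_|xQ] := boolP (x \in Q'); first by rewrite mulr1.
      rewrite (_ : conv _ _ _ _ = 0) ?mulr0//.
      rewrite -[RHS](Rint0 mu); apply: eq_RintegralT => y; rewrite indicE.
      have [yQ|_] := boolP (y \in hbox a b); last by rewrite mulr0.
      have [->|ky] := eqVneq (k j (x - y)) 0; first by rewrite mul0r.
      exfalso; move/negP: xQ; apply; rewrite inE => i; have := set_mem yQ i; have := kc j _ ky i.
      rewrite !mxE ltr_norml => /andP[h1 h2] /andP[h3 h4].
      have := epsd j; rewrite /d0 => h5; apply/andP; split; lra.
    rewrite (duality mu_leb p1 vLp (ki j) (kN j) (ind_hbox_L1 mu_leb a b) (@ind_norm _ _ _)).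
    rewrite -[RHS](Rint0 mu); apply: eq_RintegralT => x; rewrite /ind indicE.
    have [xQ|_] := boolP (x \in hbox a b); last by rewrite mulr0.
    have [bb _ bN _] := betaP j.
    by rewrite (conv_bump_eq0 (eps0 j) (epsd j) bb bN (abO _ (set_mem xQ))) mul0r.
  have := @approx_id_box R n mu mu_leb k cj k0 ki k1 k2i k2 c0 v' a b v'i.
  rewrite (_ : (fun j => _) = fun=> 0); last by apply/funext => j; exact: I0.
  move=> /(cvg_lim (@Rhausdorff R)); rewrite lim_cst// => E.
  rewrite [RHS]E; apply: eq_RintegralT => x; rewrite /v' /ind !indicE.
  have [xQ|_] := boolP (x \in hbox a b); last by rewrite !mulr0.
  rewrite mem_set ?mulr1// => i; have := set_mem xQ i; rewrite !mxE => /andP[h1 h2].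
  by have := delta0; move=> ?; apply/andP; split; lra.
have vI a b : L1 mu (fun x => v x * ind (hbox a b) x).
  exact: (Lp_mul_L1 p1 vLp (ind_hbox_L1 mu_leb _ _) (@ind_norm _ _ _)).
have mk_cond a b : (EFin \o v) \_ (hbox a b) = (fun x : Rn R n => (v x * ind (hbox a b) x)%:E).
  by apply/funext => x; rewrite patchE /ind indicE /=; case: ifPn => _; rewrite ?mulr1 ?mulr0.
have := @ae_eq0_boxes R n mu v Om' oOm' _ _.
have H1 a b : hbox a b `<=` Om' -> mu.-integrable (hbox a b) (EFin \o v).
  by move=> _; apply/(integrable_mkcond _ (hbox_measurable a b)); rewrite mk_cond; exact: vI.
have H2 a b : hbox a b `<=` Om' -> (\int[mu]_(x in hbox a b) (v x)%:E = 0)%E.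
  by move=> abO; rewrite integral_mkcond [X in integral _ _ X]mk_cond -(RintegralE (vI a b)) box_int.
move=> /(_ H1 H2); apply: filterS => x H Ox.
by apply/subr0_eq; exact: H.
Qed.

End local_identity_ae.
End main_identity.

(** * The estimate *)

Section norms.
Context (R : realType) (n : nat).
Variable mu : {sigma_finite_measure set (Rn R n) -> \bar R}.
Hypothesis mu_leb : is_lebesgue mu.
Implicit Types (x y : 'rV[R]_n) (D : set (Rn R n)) (f g v : 'rV[R]_n -> R).
Variable p : R.
Hypothesis p1 : 1 < p.

Let p0 : 0 < p. Proof. exact: lt_trans ltr01 p1. Qed.

Lemma in_Lp_restrict D f : measurable D -> in_Lp mu D p f ->
  Lp mu p (fun x => f x * ind D x) /\
  lp_norm mu D p f = ((\int[mu]_x (`|f x * ind D x| `^ p)) `^ p^-1)%:E.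
Proof.
move=> mD [mf fin].
have mF : measurable_fun setT (fun x : Rn R n => f x * ind D x).
  have := (measurable_restrictT _ mD).1 mf.
  congr measurable_fun; apply/funext => x; rewrite patchE /ind indicE.
  by case: ifPn => _; rewrite ?mulr1 ?mulr0.
have E : (\int[mu]_(x in D) (`|f x| `^ p)%:E = \int[mu]_x (`|f x * ind D x| `^ p)%:E)%E.
  rewrite [LHS]integral_mkcond; apply: eq_integral => x _; rewrite patchE /ind indicE.
  by case: ifPn => _; rewrite ?mulr1// mulr0 normr0 powR0// gt_eqF.
have ip0 : p^-1 != 0 by rewrite invr_eq0 gt_eqF.
have I_fin : (\int[mu]_x (`|f x * ind D x| `^ p)%:E < +oo)%E.
  rewrite -E ltey; apply/negP => /eqP Ey; move: fin; rewrite /lp_norm Ey.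
  by rewrite (poweRyr ip0) ltxx.
have FLp : Lp mu p (fun x => f x * ind D x).
  split => //; apply: L1I; first exact: powR_measurable.
  by under eq_integral do rewrite ger0_norm ?powR_ge0//.
by split => //; rewrite /lp_norm E -(RintegralE (proj2 FLp)) poweR_EFin.
Qed.

Lemma in_LpT_Lp v : in_Lp mu setT p v -> Lp mu p v /\
  lp_norm mu setT p v = ((\int[mu]_x (`|v x| `^ p)) `^ p^-1)%:E.
Proof.
move=> h; have [h1 h2] := in_Lp_restrict measurableT h.
have Ex x : v x * ind (setT : set (Rn R n)) x = v x by rewrite /ind indicT mulr1.
split; first by move: h1; rewrite (funext Ex).
exact: (etrans h2 (congr1 (fun t => (t `^ p^-1)%:E)
  (eq_RintegralT mu (fun x => congr1 (fun t => `|t| `^ p) (Ex x))))).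
Qed.

Lemma Lp_in_LpT v : Lp mu p v -> in_Lp mu setT p v.
Proof.
move=> [mv vp]; split => //.
by rewrite /lp_norm -(RintegralE vp) poweR_EFin ltry.
Qed.

End norms.

(** * Identification of the given Bessel kernel *)

Section bessel_kernel.
Context (R : realType) (n : nat).
Variable mu : {sigma_finite_measure set (Rn R n) -> \bar R}.
Hypothesis mu_leb : is_lebesgue mu.
Variables (s : R) (B : 'rV[R]_n -> R).
Hypotheses (s01 : 0 < s < 1) (BK : is_bessel_kernel mu s B).

Let s02 : 0 < s <= 2. Proof. by case/andP: s01 => ? ?; apply/andP; split; lra. Qed.
Let B0i : L1 mu (@bessel R n s) := bessel_L1 mu_leb s02.

(** [B] is prescribed through its Fourier transform alone. The real and imaginary parts of that
    transform give the cosine and sine transforms, and these determine an integrable function almost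
    everywhere. *)
Lemma bessel_kernel_ae : {ae mu, forall x : Rn R n, B x = bessel s x}.
Proof.
case: BK => mB Bi FB.
apply: (ct_uniqueness mu_leb Bi B0i) => xi.
  rewrite (ct_bessel mu_leb xi s02); have := congr1 (@complex.Re R) (FB xi); rewrite /fourier /cintegral /=.
  rewrite (_ : 4 * pi ^+ 2 * enorm xi ^+ 2 = lapsym xi); last by rewrite /enorm sqr_sqrtr ?dotv_ge0.
  by move=> <-; apply: eq_RintegralT => x; rewrite /= mul0r subr0 cosN.
rewrite (even_st0 mu_leb xi (@besselN R n s) B0i).
have := congr1 (@complex.Im R) (FB xi); rewrite /fourier /cintegral /= => E.
have : \int[mu]_x (-1 * (B x * sin (2 * pi * dotv x xi))) = 0.
  by rewrite -[RHS]E; apply: eq_RintegralT => x; rewrite /= mul0r addr0 sinN; ring.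
by rewrite RintZT; [rewrite mulN1r => /eqP; rewrite oppr_eq0 => /eqP|exact: L1_sin].
Qed.

(** The equality holds at every x: the reflection y -> x - y preserves the null set on which the two
    kernels differ. *)
Lemma conv_bessel_kernel g x : measurable_fun setT (g : Rn R n -> R) ->
  conv mu B g x = conv mu (bessel s) g x.
Proof.
move=> mg; case: (BK) => mB Bi _; have mB0 := L1_measurable B0i.
have mD : measurable_fun setT (fun y : Rn R n => B y - bessel s y) by exact: measurable_funB.
have I0 : (\int[mu]_y `|(B (x - y)%R - bessel s (x - y)%R)%R|%:E = 0)%E.
  rewrite (@ge0_int_flip R n mu mu_leb (fun y => B y - bessel s y) x mD).
  have mDE : measurable_fun setT (fun y : Rn R n => (B y - bessel s y)%:E) by exact/measurable_EFinP.
  apply: (ae_eq_integral_abs mu measurableT mDE).2.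
  by apply: filterS bessel_kernel_ae => y E _ /=; rewrite E subrr.
apply: ae_eq_RintT.
- exact: (measurable_funM (measurable_flip x mB) mg).
- exact: (measurable_funM (measurable_flip x mB0) mg).
have : ae_eq mu setT (fun y : Rn R n => (B (x - (y : 'rV[R]_n)) - bessel s (x - (y : 'rV[R]_n)))%:E) (cst 0%E).
  have mDE : measurable_fun setT (fun y : Rn R n => (B (x - (y : 'rV[R]_n)) - bessel s (x - (y : 'rV[R]_n)))%:E).
    by apply/measurable_EFinP; exact: (measurable_flip x mD).
  exact: (ae_eq_integral_abs mu measurableT mDE).1.
by apply: filterS => y /(_ I) [/subr0_eq ->] _.
Qed.

End bessel_kernel.

(** [T] stands for 2^p, once for each of the two additions in [density]; [cr] and [cm] are the Young
    constants of [rker] and [mker]. *)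
Lemma combine_bounds (R : realType) (T cr cm a b d e D f : R) : 0 <= T -> 0 <= cr -> 0 <= cm ->
  0 <= a -> 0 <= b -> d <= cr * a -> e <= cm * b -> D <= T * (a + d) -> f <= T * (D + e) ->
  f <= T * (T * (1 + cr) + cm) * (a + b).
Proof.
move=> hT hcr hcm ha hb hd he hD hf.
apply: le_trans hf _; rewrite -mulrA; apply: ler_wpM2l => //.
have hD' : D <= T * ((1 + cr) * a) by apply: le_trans hD _; apply: ler_wpM2l => //; lra.
have t1 : 0 <= T * ((1 + cr) * b) by apply: mulr_ge0 => //; apply: mulr_ge0 => //; lra.
have t2 : 0 <= cm * a by apply: mulr_ge0.
rewrite (_ : _ * (a + b) = T * ((1 + cr) * a) + T * ((1 + cr) * b) + cm * a + cm * b); last by ring.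
lra.
Qed.

Lemma root_bound (R : realType) (p C a b G : R) : 1 < p -> 0 <= C -> 0 <= a -> 0 <= b -> 0 <= G ->
  G <= C * (a + b) -> G `^ p^-1 <= (C `^ p^-1 * 2 `^ p^-1 + 1) * (a `^ p^-1 + b `^ p^-1).
Proof.
move=> p1 C0 a0 b0 G0 H; have ip0 : 0 <= p^-1 by rewrite invr_ge0 ltW// (lt_trans ltr01).
have ab0 : 0 <= a + b by exact: addr_ge0.
apply: (@le_trans _ _ ((C * (a + b)) `^ p^-1)).
  by apply: ge0_ler_powR => //; rewrite nnegrE// mulr_ge0.
rewrite powRM//.
apply: (@le_trans _ _ (C `^ p^-1 * (2 `^ p^-1 * (a `^ p^-1 + b `^ p^-1)))).
  by apply: ler_wpM2l; [exact: powR_ge0|exact: powR_add_le].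
rewrite mulrA; apply: ler_wpM2r; first by apply: addr_ge0; exact: powR_ge0.
by rewrite lerDl.
Qed.

Section density_norm.
Context (R : realType) (n : nat).
Variable mu : {sigma_finite_measure set (Rn R n) -> \bar R}.
Hypothesis mu_leb : is_lebesgue mu.
Variables (s rho0 p : R).
Hypotheses (s01 : 0 < s < 1) (rho0_gt0 : 0 < rho0) (p1 : 1 <= p).

Let rk := rker mu s rho0 : 'rV[R]_n -> R.
Let mk := mker mu s rho0 : 'rV[R]_n -> R.
Let ri : L1 mu rk := rker_L1 mu_leb s01 rho0_gt0.
Let mi : L1 mu mk := mker_L1 mu_leb s01 rho0_gt0.
Let Cr : R := (1 + \int[mu]_x `|rk x|) `^ p * \int[mu]_x `|rk x|.
Let Cm : R := (1 + \int[mu]_x `|mk x|) `^ p * \int[mu]_x `|mk x|.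

Lemma density_norm_le : exists2 C : R, 0 <= C & forall u F : 'rV[R]_n -> R, Lp mu p u -> Lp mu p F ->
  \int[mu]_x (`|density mu s rho0 u F x| `^ p) <=
  C * (\int[mu]_x (`|F x| `^ p) + \int[mu]_x (`|u x| `^ p)).
Proof.
have Cr0 : 0 <= Cr by apply: mulr_ge0; [exact: powR_ge0|apply: Rintegral_ge0].
have Cm0 : 0 <= Cm by apply: mulr_ge0; [exact: powR_ge0|apply: Rintegral_ge0].
have T0 : 0 <= 2 `^ p :> R := powR_ge0 _ _.
exists (2 `^ p * (2 `^ p * (1 + Cr) + Cm)).
  by apply: mulr_ge0 => //; apply: addr_ge0 => //; apply: mulr_ge0 => //; apply: addr_ge0.
move=> u F uLp FLp.
have rF := Lp_conv mu_leb p1 ri FLp; have mU := Lp_conv mu_leb p1 mi uLp.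
have h1 := proj2 (young mu_leb p1 ri (proj1 FLp) (proj2 FLp)); rewrite -/Cr in h1.
have h2 := proj2 (young mu_leb p1 mi (proj1 uLp) (proj2 uLp)); rewrite -/Cm in h2.
have h3 := proj2 (Lp_add p1 FLp (Lp_opp rF)).
have h4 := proj2 (Lp_add p1 (Lp_sub p1 FLp rF) mU).
have E : \int[mu]_x (`|- conv mu rk F x| `^ p) = \int[mu]_x (`|conv mu rk F x| `^ p).
  by apply: eq_RintegralT => x; rewrite normrN.
rewrite E in h3.
have nF : 0 <= \int[mu]_x (`|F x| `^ p) by apply: Rintegral_ge0 => x _; exact: powR_ge0.
have nu : 0 <= \int[mu]_x (`|u x| `^ p) by apply: Rintegral_ge0 => x _; exact: powR_ge0.
exact: (combine_bounds T0 Cr0 Cm0 nF nu h1 h2 h3 h4).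
Qed.

End density_norm.

Theorem theorem5p2 (R : realType) (n : nat)
    (mu : {measure set (Rn R n) -> \bar R}) (s p : R) (B : 'rV[R]_n -> R)
    (Om Om' : set 'rV[R]_n) :
  (0 < n)%N -> is_lebesgue mu ->
  0 < s < 1 -> 1 < p -> is_bessel_kernel mu s B ->
  open Om -> bounded_set Om ->
  open Om' -> compact (closure Om') -> closure Om' `<=` Om ->
  exists C : R, 0 < C /\
    forall f u : 'rV[R]_n -> R,
      in_Lp mu Om p f -> in_Lp mu setT p u -> dist_solution mu s Om u f ->
      in_bessel_loc mu B p Om' u /\
      (bessel_loc_norm mu B p Om' u <=
         C%:E * (lp_norm mu Om p f + lp_norm mu setT p u))%E.
Proof.
move=> _ mu_leb s01 p1 BK oOm _ oOm' cOm' OOm.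
have [nu E] := sigma_finite_is_lebesgue mu_leb; subst mu.
have p1' := ltW p1.
have [d d0 Hd] := thickening cOm' OOm oOm.
have rho00 : 0 < (d / 3) ^+ 2 by rewrite exprn_gt0// divr_gt0.
(* [C] is fixed before [f] and [u] appear: it is made of p and the L^1 norms of [rker] and [mker],
   hence depends on n, s, p and the distance [d] only. *)
have [C C0 HC] := density_norm_le mu_leb s01 rho00 p1'.
have ip0 : 0 <= p^-1 by rewrite invr_ge0 (le_trans ler01).
(* The added 1 makes the constant positive even when [C] is 0. *)
exists (C `^ p^-1 * 2 `^ p^-1 + 1); split.
  by apply: ltr_wpDl => //; apply: mulr_ge0; exact: powR_ge0.
move=> f u fLp uLp sol.
have mOm : measurable (Om : set (Rn R n)) by exact: open_Rn_measurable.
have [FLp fE] := in_Lp_restrict p1 mOm fLp.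
have [uLp' uE] := in_LpT_Lp p1 uLp.
have gLp := density_Lp mu_leb s01 rho00 p1' uLp' FLp.
set g := density _ _ _ _ _ in gLp.
have ae := solution_ae mu_leb s01 p1' d0 oOm' Hd uLp' FLp sol.
have BE x := conv_bessel_kernel mu_leb s01 BK x (proj1 gLp).
case: (BK) => mB Bi _.
have wLp := Lp_conv mu_leb p1' Bi gLp.
have gin := Lp_in_LpT gLp.
have ext : extends_on nu B p Om' u (conv nu B g).
  split; last by apply: filterS ae => x H Ox; rewrite BE H.
  split; first exact: (Lp_in_LpT wLp).
  by exists g; split => //; apply: aeW.
split; first by exists (conv nu B g).
(* Both norms are infima: the extension [conv nu B g] bounds the outer one, its representative [g]
   the inner one. *)
apply: (@le_trans _ _ (bessel_norm nu B p (conv nu B g))).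
  by apply: ereal_inf_lbound; exists (conv nu B g).
apply: (@le_trans _ _ (lp_norm nu setT p g)).
  by apply: ereal_inf_lbound; exists g => //; split => //; apply: aeW.
rewrite (proj2 (in_LpT_Lp p1 gin)) fE uE -EFinD -EFinM lee_fin.
have H := HC _ _ uLp' FLp; rewrite -/g in H.
have nF : 0 <= \int[nu]_x (`|f x * ind Om x| `^ p) by apply: Rintegral_ge0 => x _; exact: powR_ge0.
have nU : 0 <= \int[nu]_x (`|u x| `^ p) by apply: Rintegral_ge0 => x _; exact: powR_ge0.
have nG : 0 <= \int[nu]_x (`|g x| `^ p) by apply: Rintegral_ge0 => x _; exact: powR_ge0.
exact: (root_bound p1 C0 nF nU nG H).
Qed.
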